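(* Suppose that the random dynamical system $(T_\omega)_{\omega\in\Omega}$ is quenched stretched exponentially mixing of all orders in the Banach algebra $\mathfrak{B}$, with random thresholds $N^*_m$, $m\ge 2$, and that there is a constant $K>0$ such that for all $f\in\mathfrak{B}$ and $\mathbb{P}$-almost all $\omega$ one has $f\circ T_\omega\in\mathfrak{B}$ and $\|f\circ T_\omega\|_{\mathfrak{B}}\le K\|f\|_{\mathfrak{B}}$. Assume furthermore that $N^*_m\in L^1(\mathbb{P})$ for each $m\ge 2$. Let $\mathbf{f}=(f_\omega)_{\omega\in\Omega}\in\bar{\mathfrak{B}}$ and put $S_{N,\omega}(\mathbf{f})=\sum_{n=0}^{N-1} f_{\sigma^n\omega}\circ T_\omega^n$. Then there is a $\sigma_{\mathbf{f}}\ge 0$ such that, for $\mathbb{P}$-a.e. $\omega$, the random variables $\frac{S_{N,\omega}(\mathbf{f})}{\sqrt N}$ on the probability space $(M,\mu_\omega)$ converge in distribution, as $N\to\infty$, to $\mathcal{N}(0,\sigma_{\mathbf{f}}^2)$ (for $\sigma_{\mathbf f}=0$ this is the point mass at $0$). Furthermore, for $\mathbb{P}$-a.e. $\omega$, the following limit exists, the right-hand expectation is well defined, and $$\sigma_{\mathbf{f}}^2=\lim_{N\to\infty}\frac1N\int_M (S_{N,\omega}(\mathbf{f}))^2\,d\mu_\omega=\mathbb{E}\left(\int_M f_{\omega}^2\,d\mu_{\omega}+2\sum_{n=1}^\infty\int_M f_{\omega}\cdot f_{\sigma^n\omega}\circ T_{\omega}^n\,d\mu_{\omega}\right),$$ where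 $\mathbb{E}$ denotes integration over $\omega$ with respect to $\mathbb{P}$.
   Context: Setting. $(\Omega,\mathbb{P})$ is a probability space and $\sigma:\Omega\to\Omega$ is an invertible, $\mathbb{P}$-preserving, ergodic map. $M$ is a $C^\kappa$ smooth manifold ($\kappa>0$) of dimension $d$, and $T_\omega:M\to M$, $\omega\in\Omega$, are maps. For $n\ge1$ put $T_\omega^n:=T_{\sigma^{n-1}\omega}\circ\cdots\circ T_{\sigma\omega}\circ T_\omega$, and $T_\omega^0=\mathrm{id}$. The skew product $\mathcal{S}(x,\omega)=(T_\omega(x),\sigma\omega)$ on $M\times\Omega$ preserves a probability measure $\nu$ which projects onto $\mathbb{P}$ in the second coordinate; $\nu=\int_\Omega\mu_\omega\,d\mathbb{P}(\omega)$ denotes its disintegration into probability measures $\mu_\omega$ on $M$. All functions and sets are assumed measurable (in particular $(x,\omega)\mapsto f_\omega(x)$ is measurable for a family $(f_\omega)$). $\mathfrak{B}$ is a Banach algebra of real functions on $M$. Definition (quenched stretched exponential mixing). $(T_\omega)$ is quenched stretched exponentially mixing of order $m\ge2$ in $\mathfrak{B}$ if there exist a measurable function $N^*_m:\Omega\to\mathbb{N}$ (the random threshold) and constants $\gamma_m>0$, $\theta_m\in(0,1]$ such that for $\mathbb{P}$-a.e. $\omega$, for all $f_0,\dots,f_{m-1}\in\mathfrak{B}$ and all integers $0=k_0\le\cdots\le k_{m-1}$ satisfying $k_{j+1}-k_j\ge N^*_m(\sigma^{k_j}\omega)$ for $0\le j\le m-2$, it holds that $$\left|\int_M\prod_{j=0}^{m-1}f_j\circ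 T_\omega^{k_j}\,d\mu_\omega-\prod_{j=0}^{m-1}\int_M f_j\,d\mu_{\sigma^{k_j}\omega}\right|\le e^{-\gamma_m\min_{0\le j\le m-2}(k_{j+1}-k_j)^{\theta_m}}\prod_{j=0}^{m-1}\|f_j\|_{\mathfrak{B}}.$$ It is quenched stretched exponentially mixing of all orders in $\mathfrak{B}$ if this holds for all $m\ge2$ with $\gamma_m=\gamma$ and $\theta_m=\theta$ independent of $m$. $\bar{\mathfrak{B}}$ is the collection of all families $\mathbf{f}=(f_\omega)_{\omega\in\Omega}$ such that $f_\omega\in\mathfrak{B}$ and $\int_M f_\omega\,d\mu_\omega=0$ for all $\omega\in\Omega$, and $\sup_{\omega\in\Omega}\left(\|f_\omega\|_{\mathfrak{B}}+\|f_\omega\|_{L^\infty}\right)<\infty$. *)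

(* Defs.v *)
From HB Require Import structures.
From mathcomp Require Import all_boot all_order all_algebra.
From mathcomp Require Import all_classical all_reals all_analysis.
Import Order.TTheory GRing.Theory Num.Theory.
Import numFieldNormedType.Exports.

Set Implicit Arguments.
Unset Strict Implicit.
Unset Printing Implicit Defensive.

Local Open Scope classical_set_scope.
Local Open Scope ring_scope.

Section Manifold.
Context {R : realType} {d : nat}.

Local Notation coord := ('rV[R]_d).

(* [f] has continuous partial derivatives up to order [k] on the open set [U],
   those of order [k] being locally [a]-Hoelder.  For [a = 0] the last condition
   is local boundedness, hence redundant. *)
Fixpoint Ck_holder_on (k : nat) (a : R) (U : set coord)
    (f : coord -> coord) : Prop :=
  (forall x, U x -> {for x, continuous f}) /\
  match k with
  | 0%N => forall x, U x -> exists C : R,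
      \forall y \near x & z \near x, `|f y - f z| <= C * (`|y - z| `^ a)
  | k'.+1 => forall i : 'I_d, let e : coord := delta_mx 0 i in
      (forall x, U x -> derivable f x e) /\
      Ck_holder_on k' a U (fun x => 'D_e f x)
  end.

Definition Ckappa_on (kappa : R) (U : set coord) (f : coord -> coord) : Prop :=
  Ck_holder_on (Num.truncn kappa) (kappa - (Num.truncn kappa)%:R) U f.

(* [chart_inv] is only meaningful on the image of the chart. *)
Record chart (M : topologicalType) := Chart {
  chart_dom : set M;
  chart_map : M -> coord;
  chart_inv : coord -> M }.

Definition is_chart (M : topologicalType) (c : chart M) : Prop :=
  [/\ open (chart_dom c),
      open (chart_map c @` chart_dom c),
      (forall x, chart_dom c x -> chart_inv c (chart_map c x) = x),
      (forall x, chart_dom c x -> {for x, continuous (chart_map c)}) &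
      (forall x, chart_dom c x ->
         {for chart_map c x, continuous (chart_inv c)})].

Definition is_atlas (kappa : R) (M : topologicalType) (A : set (chart M)) :
    Prop :=
  [/\ (forall c, A c -> is_chart c),
      (forall x, exists2 c, A c & chart_dom c x) &
      (forall c1 c2, A c1 -> A c2 ->
         Ckappa_on kappa (chart_map c1 @` (chart_dom c1 `&` chart_dom c2))
           (chart_map c2 \o chart_inv c1))].

Definition is_manifold (kappa : R) (M : topologicalType) (A : set (chart M)) :
    Prop :=
  [/\ hausdorff_space M, @second_countable M & is_atlas kappa A].

End Manifold.

Arguments chart R d M : clear implicits.

Definition borel (M : ptopologicalType) := g_sigma_algebraType (@open M).

Section BaseSystem.
Context {R : realType} d (Omega : measurableType d) (P : probability Omega R).

Definition invertible_measurable (sigma : Omega -> Omega) : Prop :=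
  measurable_fun setT sigma /\
  exists sigma' : Omega -> Omega,
    [/\ measurable_fun setT sigma', cancel sigma sigma' & cancel sigma' sigma].

Definition ergodic (sigma : Omega -> Omega) : Prop :=
  forall A, measurable A -> sigma @^-1` A = A -> P A = 0%E \/ P A = 1%E.

End BaseSystem.

Definition preserves {R : realType} d (X : measurableType d)
    (Q : probability X R) (S : X -> X) : Prop :=
  forall A, measurable A -> Q (S @^-1` A) = Q A.

(* A Banach algebra of real functions on [M]: a Banach space whose elements are
   (via the injective map [fba_eval]) measurable functions, closed under
   pointwise multiplication, with a submultiplicative norm.
   No unit is required. *)
Record functionBanachAlgebra (R : realType) d (M : measurableType d) :=
  FunctionBanachAlgebra {
    fba_sort :> completeNormedModType R;
    fba_eval : fba_sort -> M -> R;
    fba_eval_inj : injective fba_eval;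
    fba_eval_linear : forall (a : R) (f g : fba_sort) (x : M),
      fba_eval (a *: f + g) x = a * fba_eval f x + fba_eval g x;
    fba_mul : forall f g : fba_sort, exists2 h : fba_sort,
      (forall x, fba_eval h x = fba_eval f x * fba_eval g x) &
      `|h| <= `|f| * `|g|;
    fba_measurable : forall f : fba_sort, measurable_fun setT (fba_eval f) }.

Arguments fba_eval {R d M} _ _ _.

Section RandomDynamics.
Context {R : realType} {d d'} {Omega : measurableType d}
  {M : measurableType d'}.
Variables (P : probability Omega R) (sigma : Omega -> Omega)
  (T : Omega -> M -> M) (mu : R.-pker Omega ~> M).

(* T_{sigma^{n-1} w} o ... o T_{sigma w} o T_w *)
Fixpoint cocycle (n : nat) (w : Omega) (x : M) : M :=
  if n is n'.+1 then T (iter n' sigma w) (cocycle n' w x) else x.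

Definition skew_product (p : M * Omega) : M * Omega := (T p.2 p.1, sigma p.2).

Definition disintegration (nu : probability (M * Omega)%type R) : Prop :=
  forall A, measurable A -> nu A = (\int[P]_w mu w (ysection A w))%E.

Variable B : functionBanachAlgebra R M.
Local Notation ev := (fba_eval B).

(* min_{0 <= j <= m-2} (k_{j+1} - k_j)^theta, for m >= 2; the range contains
   j = 0, so the default value of the big operator is harmless *)
Definition min_gap (m : nat) (theta : R) (k : nat -> nat) : R :=
  let g j : R := (k j.+1 - k j)%N%:R `^ theta in
  \big[Num.min/g 0%N]_(j < m.-1) g j.

(* only the values [f j], [k j] with [j < m] matter *)
Definition quenched_mixing_with (m : nat) (Nstar : Omega -> nat)
    (gamma theta : R) : Prop :=
  measurable_fun setT Nstar /\
  {ae P, forall w, forall (f : nat -> B) (k : nat -> nat),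
    k 0%N = 0%N ->
    (forall j, (j.+1 < m)%N -> (k j <= k j.+1)%N) ->
    (forall j, (j.+1 < m)%N ->
       (Nstar (iter (k j) sigma w) <= k j.+1 - k j)%N) ->
    `| (\int[mu w]_x (\prod_(j < m) ev (f j) (cocycle (k j) w x)))%R
       - \prod_(j < m) (\int[mu (iter (k j) sigma w)]_x ev (f j) x)%R |
    <= expR (- gamma * min_gap m theta k) * \prod_(j < m) `|f j| }.

Definition quenched_mixing_all_orders (Nstar : nat -> Omega -> nat) : Prop :=
  exists gamma theta : R, [/\ 0 < gamma, 0 < theta <= 1 &
    forall m, (2 <= m)%N -> quenched_mixing_with m (Nstar m) gamma theta].

Definition composition_bounded (K : R) : Prop :=
  {ae P, forall w, forall f : B, exists2 g : B,
    ev g = ev f \o T w & `|g| <= K * `|f| }.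

(* The L^infty norm of f_w is taken with respect to mu_w. *)
Definition centered_bounded_family (f : Omega -> B) : Prop :=
  [/\ measurable_fun setT (fun p : M * Omega => ev (f p.2) p.1),
      (forall w, (\int[mu w]_x ev (f w) x)%R = 0) &
      (ereal_sup (range (fun w : Omega =>
         (`|f w|)%:E + 'N[mu w]_+oo[EFin \o ev (f w)])) < +oo)%E].

Variable f : Omega -> B.

Definition birkhoff_sum (N : nat) (w : Omega) (x : M) : R :=
  \sum_(0 <= n < N) ev (f (iter n sigma w)) (cocycle n w x).

Definition corr_fun (n : nat) (w : Omega) (x : M) : R :=
  ev (f w) x * ev (f (iter n sigma w)) (cocycle n w x).

Definition corr (n : nat) (w : Omega) : R := (\int[mu w]_x corr_fun n w x)%R.

Definition green_kubo (w : Omega) : R :=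
  (\int[mu w]_x (ev (f w) x) ^+ 2)%R +
  2 * limn (fun N => \sum_(1 <= n < N) corr n w).

(* The integrals and the series in [green_kubo] make sense almost everywhere,
   and the resulting function is integrable. *)
Definition green_kubo_well_defined : Prop :=
  [/\ {ae P, forall w, forall n, (mu w).-integrable setT
        (EFin \o corr_fun n w)},
      {ae P, forall w, cvgn (fun N => \sum_(1 <= n < N) corr n w)} &
      P.-integrable setT (EFin \o green_kubo)].

End RandomDynamics.

Section Distribution.
Context {R : realType}.

(* The library's [normal_prob 0 0] is a default value, not the point mass. *)
Definition centered_normal (s : R) : probability (measurableTypeR R) R :=
  if s == 0 then (@dirac _ (measurableTypeR R) 0 R : probability (measurableTypeR R) R)
  else (normal_prob 0 s : probability (measurableTypeR R) R).

(* Weak convergence of the laws of [Y n] under [Q] (a probability measure in the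
   intended use) to [L], tested on bounded continuous functions. *)
Definition cvg_in_distribution d (X : measurableType d)
    (Q : {measure set X -> \bar R}) (Y : nat -> X -> R)
    (L : probability (measurableTypeR R) R) : Prop :=
  (forall n, measurable_fun setT (Y n)) /\
  forall g : R -> R, continuous g -> bounded_fun g ->
    (\int[Q]_x g (Y n x))%R @[n --> \oo] --> (\int[L]_y g y)%R.

End Distribution.

(* Main.v *)
Require Import Defs.
From mathcomp Require Import all_boot all_order all_algebra.
From mathcomp Require Import all_classical all_reals all_analysis.
From mathcomp Require Import measurable_realfun ess_sup_inf.
From mathcomp Require Import ring lra zify.
Import Order.TTheory GRing.Theory Num.Theory.
Import numFieldNormedType.Exports.

(** Fix a point [w] of the base. By equivariance of the fiber measures the functions
    [X n = f (sigma^n w) o T_w^n] form a centered and essentially bounded process on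
    the probability space of the fiber over [w], and the theorem is a central limit
    theorem for this nonstationary process.

    Gaussian moments. Let [y] be the sum of [X 0], ..., [X (N - 1)] divided by
    [sqrt N]. If mixed moments of order at most [p] factorise up to [exp (- n)]
    across gaps of length [n ^ a], then Stein's method gives
    [E (y ^ (q + 1)) = q * E (y ^ 2) * E (y ^ (q - 1)) + o(1)], the recursion of the
    moments of a normal law ([moment_recursion],
    [moments_asymptotically_gaussian]). Moments determine the limit because
    trigonometric sums are dense enough and cosines have rapidly convergent Taylor
    series ([trig_sum_approx], [method_of_moments]).

    Decorrelation. Mixing applies to observables of the algebra. A product of
    several values of the process within a time [D] is one of them, of norm of the
    order of [K ^ D], so that a cluster of diameter [D] must be followed by a gap
    [g] with [g ^ theta] much larger than [D]. Consider the scales [n], [n ^ l],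
    [n ^ (l ^ 2)], ... with [l >= 2 / theta]. Between at most [p] times there are
    fewer than [p] gaps, hence for one of the first [p] scales no gap lies between
    this scale and the next one. Cutting at that scale yields short clusters
    separated by long gaps, both for the whole list of times and for its two halves,
    and the factorised moments agree ([restricted_decorrelated]).

    Random thresholds. The thresholds along the orbit are unbounded. One keeps the
    times at which those of order at most [p] are at most [L]. Integrability enters
    here: correlations being negligible beyond the threshold of order two, the
    variance of the sum over the bad times is at most a constant times the sum over
    bad times of [1 + N*_2 + const] ([bad_second_moment]); by the ergodic theorem
    the average of these weights tends to its mean, which vanishes as [L] grows
    ([bad_times_sparse]). The method of moments tolerates such a perturbation,
    small in L2.

    Variance. Up to the correlations at distance at least [k], the second moment of
    the sum is a sum along the orbit of the truncated series of correlations, to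
    which the ergodic theorem applies; the neglected part is controlled by the
    averages of [N*_2] restricted to [N*_2 > k] and by a tail of a convergent series
    ([averages_cvg_green_kubo]).

    Null sets. Invariance of the measure on the product, invertibility of the base
    and countable generation of the Borel sets of the manifold give the equivariance
    of the fiber measures outside one null set ([ae_equivariance]), and invariance
    of the base measure carries almost sure properties over to whole orbits
    ([ae_orbit]). *)


Set Implicit Arguments.
Unset Strict Implicit.
Unset Printing Implicit Defensive.

Local Open Scope classical_set_scope.
Local Open Scope ring_scope.

(** * Expectations of bounded measurable functions *)

Section BoundedMeasurable.
Context {R : realType} {d : measure_display} {X : measurableType d}.
Implicit Types f g : X -> R.

Definition bounded_measurable f :=
  measurable_fun setT f /\ exists C, forall x, `|f x| <= C.

Lemma bm_cst c : bounded_measurable (fun=> c).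
Proof. by split=> //; exists `|c|. Qed.

Lemma bmD f g : bounded_measurable f -> bounded_measurable g ->
  bounded_measurable (fun x => f x + g x).
Proof.
move=> [mf [C fC]] [mg [D gD]]; split; first exact: measurable_funD.
by exists (C + D) => x; rewrite (le_trans (ler_normD _ _)) ?lerD.
Qed.

Lemma bmM f g : bounded_measurable f -> bounded_measurable g ->
  bounded_measurable (fun x => f x * g x).
Proof.
move=> [mf [C fC]] [mg [D gD]]; split; first exact: measurable_funM.
by exists (C * D) => x; rewrite normrM ler_pM.
Qed.

Lemma bmN f : bounded_measurable f -> bounded_measurable (fun x => - f x).
Proof.
move=> [mf [C fC]]; split; last by exists C => x; rewrite normrN.
exact: measurableT_comp.
Qed.

Lemma bmB f g : bounded_measurable f -> bounded_measurable g ->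
  bounded_measurable (fun x => f x - g x).
Proof. by move=> bf bg; apply: bmD => //; exact: bmN. Qed.

Lemma bmX n f : bounded_measurable f -> bounded_measurable (fun x => f x ^+ n).
Proof.
move=> bf; elim: n => [|n IH].
  by under eq_fun do rewrite expr0; exact: bm_cst.
by under eq_fun do rewrite exprS; exact: bmM.
Qed.

Lemma bm_norm f : bounded_measurable f -> bounded_measurable (fun x => `|f x|).
Proof.
move=> [mf [C fC]]; split; last by exists C => x; rewrite normr_id.
exact: measurableT_comp.
Qed.

Lemma bm_sum (I : Type) (s : seq I) (F : I -> X -> R) :
  (forall i, bounded_measurable (F i)) ->
  bounded_measurable (fun x => \sum_(i <- s) F i x).
Proof.
move=> bF; elim: s => [|i s IH].
  by under eq_fun do rewrite big_nil; exact: bm_cst.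
by under eq_fun do rewrite big_cons; exact: bmD.
Qed.

Lemma bm_prod (I : Type) (s : seq I) (F : I -> X -> R) :
  (forall i, bounded_measurable (F i)) ->
  bounded_measurable (fun x => \prod_(i <- s) F i x).
Proof.
move=> bF; elim: s => [|i s IH].
  by under eq_fun do rewrite big_nil; exact: bm_cst.
by under eq_fun do rewrite big_cons; exact: bmM.
Qed.

Lemma bm_comp (h : R -> R) f : measurable_fun setT h ->
  (exists C, forall y, `|h y| <= C) -> measurable_fun setT f ->
  bounded_measurable (fun x => h (f x)).
Proof.
move=> mh [C hC] mf; split; last by exists C.
exact: (measurableT_comp mh mf).
Qed.

End BoundedMeasurable.

#[export] Hint Resolve bm_cst bmD bmM bmN bmB bmX bm_norm bm_sum bm_prod : core.

Ltac solve_bm := solve [repeat first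
  [ assumption | solve [trivial] | apply: bm_cst | apply: bmX | apply: bm_norm
  | apply: bmN | apply: bmM | apply: bmB | apply: bmD ]].

Section Expectation.
Context {R : realType} {d : measure_display} {X : measurableType d}.
Variable Q : {measure set X -> \bar R}.
Hypothesis Q1 : Q setT = 1%E.
Implicit Types f g : X -> R.

Local Notation E f := (Rintegral Q setT f).
Local Notation int f := (Q.-integrable setT (EFin \o f)).

Lemma bm_integrable f : bounded_measurable f -> int f.
Proof.
move=> [mf [C fC]]; apply: measurable_bounded_integrable => //.
  by rewrite Q1 ltry.
exists C; split; first exact: num_real.
by move=> y Cy x _ /=; rewrite (le_trans (fC x))// ltW.
Qed.

Lemma intD f g : int f -> int g -> int (fun x => f x + g x).
Proof.
move=> If Ig.
rewrite (_ : _ \o _ = (EFin \o f) \+ (EFin \o g))%E//.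
exact: integrableD.
Qed.

Lemma intZ c f : int f -> int (fun x => c * f x).
Proof.
move=> If; rewrite (_ : _ \o _ = fun x => c%:E * (EFin \o f) x)%E//.
exact: integrableZl.
Qed.

Lemma int_sum (I : Type) (s : seq I) (F : I -> X -> R) :
  (forall i, int (F i)) -> int (fun x => \sum_(i <- s) F i x).
Proof.
move=> IF; elim: s => [|i s IH].
  by under eq_fun do rewrite big_nil; exact/bm_integrable/bm_cst.
by under eq_fun do rewrite big_cons; exact: intD.
Qed.

Lemma E_D f g : int f -> int g -> E (fun x => f x + g x) = E f + E g.
Proof. by move=> If Ig; rewrite RintegralD. Qed.

Lemma E_B f g : int f -> int g -> E (fun x => f x - g x) = E f - E g.
Proof. by move=> If Ig; rewrite RintegralB. Qed.

Lemma E_Z c f : int f -> E (fun x => c * f x) = c * E f.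
Proof. by move=> If; rewrite RintegralZl. Qed.

Lemma E_cst c : E (fun=> c) = c.
Proof. by rewrite Rintegral_cst// Q1 mulr1. Qed.

Lemma E_sum (I : Type) (s : seq I) (F : I -> X -> R) :
  (forall i, int (F i)) ->
  E (fun x => \sum_(i <- s) F i x) = \sum_(i <- s) E (F i).
Proof.
move=> IF; elim: s => [|i s IH].
  by under eq_Rintegral do rewrite big_nil; rewrite big_nil E_cst.
under eq_Rintegral do rewrite big_cons.
by rewrite big_cons E_D// ?IH//; exact: int_sum.
Qed.

Lemma E_le f g : int f -> int g -> (forall x, f x <= g x) -> E f <= E g.
Proof. by move=> If Ig fg; apply: le_Rintegral. Qed.

Lemma E_ge0 f : (forall x, 0 <= f x) -> 0 <= E f.
Proof. by move=> f0; apply: Rintegral_ge0. Qed.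

Lemma E_norm_le f g : int f -> int g -> (forall x, `|f x| <= g x) ->
  `|E f| <= E g.
Proof.
move=> If Ig fg; apply: le_trans; first exact: le_normr_Rintegral.
by apply: E_le => //; exact: integrable_norm.
Qed.

Lemma E_bound f c : bounded_measurable f -> (forall x, `|f x| <= c) ->
  `|E f| <= c.
Proof.
move=> bf fc; rewrite -[leRHS]E_cst; apply: E_norm_le => //.
  exact: bm_integrable.
exact/bm_integrable/bm_cst.
Qed.

End Expectation.

#[export] Hint Resolve bm_integrable : core.

(** * Stein's recursion for the moments of a weakly dependent sum *)

Section PowerDifference.
Context {R : realFieldType}.

Lemma norm_sum5_le (a1 a2 a3 a4 a5 u v : R) : `|a1| <= u -> `|a2| <= v ->
  `|a3| <= u -> `|a4| <= v -> `|a5| <= u ->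
  `|a1 + a2 + a3 + a4 + a5| <= 3 * u + 2 * v.
Proof.
have n1 := ler_normD (a1 + a2 + a3 + a4) a5.
have n2 := ler_normD (a1 + a2 + a3) a4.
have n3 := ler_normD (a1 + a2) a3; have n4 := ler_normD a1 a2.
by lra.
Qed.

Implicit Types u v B : R.

Lemma power_diff_le q u v B : 1 <= B -> `|u| <= B -> `|v| <= B ->
  `|u ^+ q - v ^+ q| <= q%:R * `|u - v| * B ^+ q.-1.
Proof.
move=> B1 uB vB; have B0 : 0 <= B by lra.
elim: q => [|q IH]; first by rewrite !expr0 subrr normr0 !mul0r.
rewrite (_ : _ - _ = u * (u ^+ q - v ^+ q) + (u - v) * v ^+ q); last first.
  by rewrite !exprS; ring.
rewrite (le_trans (ler_normD _ _))// !normrM normrX -[in leRHS]natr1 /=.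
have h1 : `|u| * `|u ^+ q - v ^+ q| <= q%:R * `|u - v| * B ^+ q.
  case: q IH => [|q] IH.
    by rewrite !expr0 subrr normr0 mulr0 !mul0r.
  rewrite (le_trans (ler_pM _ _ uB IH))// (exprS B) /=.
  by rewrite le_eqVlt; apply/orP; left; apply/eqP; ring.
have h2 : `|u - v| * `|v| ^+ q <= `|u - v| * B ^+ q.
  by rewrite ler_wpM2l// lerXn2r// nnegrE.
rewrite (le_trans (lerD h1 h2))//.
by rewrite le_eqVlt; apply/orP; left; apply/eqP; ring.
Qed.

(** The second-order Taylor bound for monomials; the wasteful exponent [q.-1]
    (instead of [q - 2]) makes all error terms of the moment recursion share one
    factor. *)
Lemma power_taylor2_le q u v B : 1 <= B -> `|u| <= B -> `|v| <= B ->
  `|u ^+ q - v ^+ q - q%:R * (u - v) * v ^+ q.-1|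
    <= q%:R ^+ 2 * (u - v) ^+ 2 * B ^+ q.-1.
Proof.
move=> B1 uB vB; have B0 : 0 <= B by lra.
elim: q => [|q IH]; first by rewrite !expr0 subrr !mul0r subrr normr0 expr0n !mul0r.
case: q IH => [|q] IH.
  rewrite !expr1 !expr0 (_ : u - v - _ = 0); last by ring.
  by rewrite normr0 mulr1 mulr_ge0// sqr_ge0.
rewrite (_ : _ - _ - _ = u * (u ^+ q.+1 - v ^+ q.+1 - q.+1%:R * (u - v) * v ^+ q)
   + q.+1%:R * (u - v) ^+ 2 * v ^+ q); last first.
  have -> : (q.+2%:R : R) = q.+1%:R + 1 by rewrite natr1.
  by rewrite /= !exprS; ring.
have h1 : `|u| * `|u ^+ q.+1 - v ^+ q.+1 - q.+1%:R * (u - v) * v ^+ q| <=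
     q.+1%:R ^+ 2 * (u - v) ^+ 2 * B ^+ q.+1.
  rewrite (le_trans (ler_pM _ _ uB IH))// (exprS B) /=.
  by rewrite le_eqVlt; apply/orP; left; apply/eqP; ring.
have h2 : `|q.+1%:R * (u - v) ^+ 2 * v ^+ q| <=
    q.+1%:R * (u - v) ^+ 2 * B ^+ q.+1.
  have c0 : 0 <= q.+1%:R * (u - v) ^+ 2 by apply: mulr_ge0 => //; exact: sqr_ge0.
  rewrite normrM (ger0_norm c0); apply: ler_wpM2l => //.
  rewrite normrX (@le_trans _ _ (B ^+ q))//.
    by rewrite lerXn2r// nnegrE.
  by rewrite ler_weXn2l.
rewrite (le_trans (ler_normD _ _))// normrM (le_trans (lerD h1 h2))//.
rewrite -mulrDl /= ler_wpM2r ?exprn_ge0//.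
rewrite -mulrDl ler_wpM2r ?sqr_ge0// -[in leRHS]natr1.
by rewrite sqrrD mulr1 expr1n; have : (0 : R) <= q.+1%:R by []; lra.
Qed.

End PowerDifference.

(** The index set of the expansion of the [q]-th power of a sum over [s]. *)
Fixpoint words (q : nat) (s : seq nat) : seq (seq nat) :=
  if q is q'.+1 then [seq j :: t | j <- s, t <- words q' s] else [:: [::]].

Lemma size_words q s : size (words q s) = (size s ^ q)%N.
Proof.
elim: q => [|q IH] //=.
by rewrite size_allpairs IH expnS.
Qed.

Lemma mem_words q s t : t \in words q s -> size t = q /\ {subset t <= s}.
Proof.
elim: q t => [|q IH] t /=; first by rewrite inE => /eqP ->.
move=> /allpairsP[[j u]/= [js us ->]]; have [<- us'] := IH _ us.
by split => // k; rewrite inE => /predU1P[->//|]; exact: us'.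
Qed.

Lemma sum_expr_words (R : comPzRingType) (F : nat -> R) q s :
  (\sum_(j <- s) F j) ^+ q = \sum_(t <- words q s) \prod_(j <- t) F j.
Proof.
elim: q => [|q IH]; first by rewrite big_seq1 big_nil expr0.
rewrite exprS IH /= big_allpairs_dep mulr_suml; apply: eq_bigr => j _.
by rewrite mulr_sumr; apply: eq_bigr => t _; rewrite big_cons.
Qed.

Section MomentRecursion.
Context {R : realType} {d : measure_display} {X : measurableType d}.
Variable Q : {measure set X -> \bar R}.
Hypothesis Q1 : Q setT = 1%E.
Variables (Y : nat -> X -> R) (C : R).
Hypothesis C1 : 1 <= C.
Hypothesis mY : forall i, measurable_fun setT (Y i).
Hypothesis YC : forall i x, `|Y i x| <= C.

Local Notation E f := (Rintegral Q setT f).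

Definition mixed_moment (t : seq nat) : R := E (fun x => \prod_(i <- t) Y i x).

(** The error depends neither on the diameters of the two groups of times nor on
    what separates the times inside a group. *)
Definition decorrelated (r : nat) (dl : R) (p : nat) :=
  forall s t : seq nat, (size s + size t <= p)%N ->
    (forall i j, i \in s -> j \in t -> (i + r <= j)%N) ->
    `|mixed_moment (s ++ t) - mixed_moment s * mixed_moment t| <= dl.

Definition psum (s : seq nat) (x : X) : R := \sum_(i <- s) Y i x.

Let C0 : 0 <= C. Proof. exact: le_trans ler01 C1. Qed.

Let bmY i : bounded_measurable (Y i).
Proof. by split => //; exists C. Qed.
Local Hint Resolve bmY : core.

Lemma bm_psum s : bounded_measurable (psum s).
Proof. exact: bm_sum. Qed.
Local Hint Resolve bm_psum : core.

Lemma psum_bound s x : `|psum s x| <= (size s)%:R * C.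
Proof.
rewrite /psum; elim: s => [|i s IH]; first by rewrite big_nil normr0 mul0r.
by rewrite big_cons (le_trans (ler_normD _ _))// -nat1r mulrDl mul1r lerD.
Qed.

Lemma mixed_moment_bound t : `|mixed_moment t| <= C ^+ size t.
Proof.
apply: E_bound => //; first exact: bm_prod.
move=> x; elim: t => [|i t IH]; first by rewrite big_nil normr1.
by rewrite big_cons normrM exprS ler_pM.
Qed.

Lemma mixed_moment_perm s t : perm_eq s t -> mixed_moment s = mixed_moment t.
Proof. by move=> st; apply: eq_Rintegral => x _; exact: perm_big. Qed.

Variables (r : nat) (dl : R) (p : nat).
Hypothesis dec : decorrelated r dl p.
Hypothesis centered : forall i, mixed_moment [:: i] = 0.

Let dl0 : 0 <= dl.
Proof. exact: le_trans (normr_ge0 _) (@dec [::] [::] _ _). Qed.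

(** The times of [t] before [u] are cut off first, then those after [u]; a third
    cut glues the two parts of [t] together again. *)
Lemma mixed_moment_isolated (u t : seq nat) : (size u + size t <= p)%N ->
  (forall j, j \in t -> (forall i, i \in u -> (j + r <= i)%N) \/
                        (forall i, i \in u -> (i + r <= j)%N)) ->
  u != [::] ->
  `|mixed_moment (u ++ t) - mixed_moment u * mixed_moment t| <=
    (1 + C ^+ size t + C ^+ size u) * dl.
Proof.
move=> sp far u0.
have trans_far j k : (forall i, i \in u -> (j + r <= i)%N) ->
    (forall i, i \in u -> (i + r <= k)%N) -> (j + r <= k)%N.
  case: u u0 {sp far} => // i u' _ /(_ i (mem_head _ _)) ji /(_ i (mem_head _ _)).
  by lia.
pose lt j := all (fun i => (j + r <= i)%N) u.
pose tl := [seq j <- t | lt j]; pose tr := [seq j <- t | predC lt j].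
have ptt : perm_eq (tl ++ tr) t by rewrite perm_filterC.
have st : (size tl + size tr = size t)%N by rewrite -size_cat; exact: perm_size.
have pe : perm_eq (tl ++ u ++ tr) (u ++ t).
  by rewrite perm_catCA perm_cat2l.
have ltlP j : j \in tl -> j \in t /\ forall i, i \in u -> (j + r <= i)%N.
  by rewrite mem_filter => /andP[/allP].
have trP j : j \in tr -> j \in t /\ forall i, i \in u -> (i + r <= j)%N.
  rewrite mem_filter /= => /andP[nl jt]; split => //.
  by case: (far _ jt) => // /allP ltj; move: nl; rewrite /lt ltj.
have d1 : `|mixed_moment (tl ++ u ++ tr)
             - mixed_moment tl * mixed_moment (u ++ tr)| <= dl.
  apply: dec; first by rewrite size_cat; lia.
  move=> i j /ltlP[it il]; rewrite mem_cat => /orP[/il//|/trP[jt jr]].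
  exact: trans_far.
have d2 : `|mixed_moment (u ++ tr) - mixed_moment u * mixed_moment tr| <= dl.
  apply: dec; first lia.
  by move=> i j iu /trP[jt]; exact.
have d3 : `|mixed_moment (tl ++ tr) - mixed_moment tl * mixed_moment tr| <= dl.
  apply: dec; first lia.
  by move=> i j /ltlP[it il] /trP[jt jr]; exact: trans_far.
rewrite (mixed_moment_perm pe) in d1; rewrite (mixed_moment_perm ptt) in d3.
set a := mixed_moment (u ++ t) in d1 *; set b := mixed_moment tl in d1 d3.
set c := mixed_moment (u ++ tr) in d1 d2; set e := mixed_moment u in d2 *.
set g := mixed_moment tr in d2 d3; set h := mixed_moment t in d3 *.
rewrite (_ : a - e * h = (a - b * c) + b * (c - e * g) + - e * (h - b * g)); last by ring.
have hb : `|b| <= C ^+ size t.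
  by rewrite (le_trans (mixed_moment_bound _))// ler_weXn2l//; lia.
have he : `|e| <= C ^+ size u by exact: mixed_moment_bound.
rewrite (le_trans (ler_normD _ _))// !mulrDl mul1r lerD//; last first.
  by rewrite normrM normrN ler_pM.
by rewrite (le_trans (ler_normD _ _))// lerD// normrM ler_pM.
Qed.

Lemma E_mul_psum_pow u s q :
  E (fun x => \prod_(i <- u) Y i x * psum s x ^+ q) =
  \sum_(t <- words q s) mixed_moment (u ++ t).
Proof.
rewrite -E_sum//; last by move=> t; apply: bm_integrable => //; exact: bm_prod.
apply: eq_Rintegral => x _; rewrite sum_expr_words mulr_sumr.
by apply: eq_bigr => t _; rewrite big_cat.
Qed.

(** Expanding the power into words reduces to the previous lemma, at the price of
    a factor [size s] for each letter. *)
Lemma isolated_power (u s : seq nat) k : (size u + k <= p)%N -> u != [::] ->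
  (forall j, j \in s -> (forall i, i \in u -> (j + r <= i)%N) \/
                        (forall i, i \in u -> (i + r <= j)%N)) ->
  `|E (fun x => \prod_(i <- u) Y i x * psum s x ^+ k)
      - mixed_moment u * E (fun x => psum s x ^+ k)|
  <= (size s)%:R ^+ k * ((1 + C ^+ k + C ^+ size u) * dl).
Proof.
move=> sp u0 far; rewrite E_mul_psum_pow.
have -> : E (fun x => psum s x ^+ k) =
    E (fun x => \prod_(i <- [::]) Y i x * psum s x ^+ k).
  by apply: eq_Rintegral => x _; rewrite big_nil mul1r.
rewrite E_mul_psum_pow mulr_sumr -sumrB.
rewrite (le_trans (ler_norm_sum _ _ _))//.
rewrite -natrX -size_words mulr_natl -[leRHS]iter_addr_0 -count_predT -big_const_seq.
rewrite big_seq [leRHS]big_seq; apply: ler_sum => t /mem_words[st ts].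
rewrite -st; apply: mixed_moment_isolated => //; first by rewrite st.
by move=> j /ts; exact: far.
Qed.

Definition near_times (k i N : nat) :=
  [seq j <- iota 0 N | (i < j + k)%N && (j < i + k)%N].
Definition far_times (k i N : nat) :=
  [seq j <- iota 0 N | ~~ ((i < j + k)%N && (j < i + k)%N)].

Lemma psum_near_far k i N x :
  psum (iota 0 N) x = psum (near_times k i N) x + psum (far_times k i N) x.
Proof. by rewrite /psum !big_filter (bigID (fun j => (i < j + k)%N && (j < i + k)%N)). Qed.

Lemma size_near_times k i N : (size (near_times k i N) <= k + k)%N.
Proof.
rewrite -(size_iota (i - k) (k + k)); apply: uniq_leq_size.
  by rewrite filter_uniq ?iota_uniq.
move=> j; rewrite mem_filter !mem_iota => /andP[/andP[h1 h2] _].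
by apply/andP; split; lia.
Qed.

Lemma size_far_times k i N : (size (far_times k i N) <= N)%N.
Proof. by rewrite -[leqRHS](size_iota 0 N) size_filter count_size. Qed.

Lemma far_timesP k i N j : j \in far_times k i N ->
  (j + k <= i)%N \/ (i + k <= j)%N.
Proof. by rewrite mem_filter => /andP[jn _]; lia. Qed.

(** With a doubled radius the far times keep a gap [k] not only from [i] but from
    all times near [i]. *)
Lemma near_far_sep k i N j l : j \in near_times k i N ->
  l \in far_times (k + k) i N ->
  (forall m, m \in [:: i; j] -> (l + k <= m)%N) \/
  (forall m, m \in [:: i; j] -> (m + k <= l)%N).
Proof.
rewrite mem_filter => /andP[/andP[h1 h2] _] /far_timesP[h|h]; [left|right];
  by move=> m; rewrite !inE => /orP[/eqP ->|/eqP ->]; lia.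
Qed.

Section OneStep.
Variables (N q : nat) (x : R).
Hypotheses (N0 : (0 < N)%N) (q0 : (0 < q)%N) (qp : (q.+1 <= p)%N).
Hypotheses (x0 : 0 < x) (xN : x ^+ 2 * N%:R = 1) (xr : 6 * r%:R * C * x <= 1).

Let y w := x * psum (iota 0 N) w.
Let B w := 1 + `|y w|.
(* [x] times the sum over any group of near times used below is at most [eta]. *)
Let eta := 6 * r%:R * C * x.

Let x1 : x <= 1.
Proof.
rewrite -(@expr_le1 _ 2) ?(ltW x0)// -[leRHS]xN ler_peMr ?sqr_ge0//.
by rewrite ler1n.
Qed.

Let eta0 : 0 <= eta. Proof. by rewrite /eta !mulr_ge0// ltW. Qed.

Let bmy : bounded_measurable y. Proof. exact: bmM. Qed.
Local Hint Resolve bmy : core.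
Let bmB : bounded_measurable B. Proof. by apply: bmD => //; exact: bm_norm. Qed.
Local Hint Resolve bmB : core.

Let B1 w : 1 <= B w. Proof. by rewrite /B; have := normr_ge0 (y w); lra. Qed.

Let near_small k i w : (k <= r + r)%N ->
  `|x * psum (near_times k i N) w| <= k%:R * 2 * C * x.
Proof.
move=> kr; rewrite normrM (ger0_norm (ltW x0)) mulrC ler_wpM2r ?(ltW x0)//.
rewrite (le_trans (psum_bound _ _))// ler_wpM2r// -natrM ler_nat.
by rewrite (leq_trans (size_near_times _ _ _))//; lia.
Qed.

Let far_le_B k i w : (k <= r + r)%N -> `|x * psum (far_times k i N) w| <= B w.
Proof.
move=> kr.
rewrite (_ : x * _ = y w - x * psum (near_times k i N) w); last first.
  by rewrite /y (psum_near_far k i); ring.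
rewrite (le_trans (ler_normB _ _))// /B addrC lerD2r (le_trans (near_small _ _ _))//.
rewrite (le_trans _ xr)// ler_wpM2r ?(ltW x0)// ler_wpM2r//.
by rewrite -!natrM ler_nat; lia.
Qed.

(** Stein's method. The near part [a] of [y] is removed by a Taylor expansion
    around the far part [w1]. In the term of order zero the centered variable
    [Y i] is isolated, hence this term is negligible; in the term of order one
    [w1] is exchanged for [w2], the part that is also far from the times in [a],
    and then [Y i * a] is isolated; finally [y] takes the place of [w2]. *)
Let one_term i :
  `|E (fun w => Y i w * y w ^+ q)
    - q%:R * E (fun w => Y i w * (x * psum (near_times r i N) w))
           * E (fun w => y w ^+ q.-1)|
  <= 3 * q%:R ^+ 2 * C * eta ^+ 2 * E (fun w => B w ^+ q.-1)
     + 6 * q%:R * C ^+ q.+1 * N%:R ^+ q * dl.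
Proof.
pose a w := x * psum (near_times r i N) w.
pose w1 w := x * psum (far_times r i N) w.
pose w2 w := x * psum (far_times (r + r) i N) w.
have rr : (r <= r + r)%N := leq_addr r r.
have bma : bounded_measurable a by exact: bmM.
have bm1 : bounded_measurable w1 by exact: bmM.
have bm2 : bounded_measurable w2 by exact: bmM.
have ya w : y w - w1 w = a w by rewrite /y /w1 /a (psum_near_far r i); ring.
have aeta w : `|a w| <= eta.
  rewrite (le_trans (near_small _ _ _))// /eta.
  by rewrite ler_wpM2r ?(ltW x0)// ler_wpM2r// -!natrM ler_nat; lia.
have y2 w : `|y w - w2 w| <= eta.
  rewrite (_ : _ - _ = x * psum (near_times (r + r) i N) w); last first.
    by rewrite /y /w2 (psum_near_far (r + r) i); ring.
  rewrite (le_trans (near_small _ _ _))// /eta.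
  by rewrite ler_wpM2r ?(ltW x0)// ler_wpM2r// -!natrM ler_nat; lia.
have w12 w : `|w1 w - w2 w| <= eta.
  rewrite (_ : _ - _ = x * psum (near_times (r + r) i N) w - a w); last first.
    have h1 := psum_near_far r i N w; rewrite (psum_near_far (r + r) i) in h1.
    by rewrite /w1 /w2 /a -!mulrBr; congr (x * _); lra.
  rewrite (le_trans (ler_normB _ _))// (le_trans (lerD (near_small _ _ _) (near_small _ _ _)))//.
  rewrite -!mulrDl /eta ler_wpM2r ?(ltW x0)// ler_wpM2r// natrD.
  by have : (0 : R) <= r%:R by []; lra.
have yB w : `|y w| <= B w by rewrite /B; lra.
have w1B w : `|w1 w| <= B w by exact: far_le_B.
have w2B w : `|w2 w| <= B w by exact: far_le_B.
have diffB u v w : `|u| <= B w -> `|v| <= B w -> `|u - v| <= eta ->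
    `|u ^+ q.-1 - v ^+ q.-1| <= q%:R * eta * B w ^+ q.-1.
  move=> uB vB uv; rewrite (le_trans (power_diff_le _ (B1 w) uB vB))//.
  rewrite ler_pM ?mulr_ge0 ?exprn_ge0// ?(le_trans ler01)//.
    by rewrite ler_pM// ler_nat leq_pred.
  by rewrite ler_weXn2l// leq_pred.
pose R1 w := Y i w * (y w ^+ q - w1 w ^+ q - q%:R * (y w - w1 w) * w1 w ^+ q.-1).
pose R2 w := Y i w * w1 w ^+ q.
pose R3 w := Y i w * a w * (w1 w ^+ q.-1 - w2 w ^+ q.-1).
pose R4 w := Y i w * a w * w2 w ^+ q.-1.
have bR1 : bounded_measurable R1 by rewrite /R1; solve_bm.
have bR2 : bounded_measurable R2 by rewrite /R2; solve_bm.
have bR3 : bounded_measurable R3 by rewrite /R3; solve_bm.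
have bR4 : bounded_measurable R4 by rewrite /R4; solve_bm.
have bYa : bounded_measurable (fun w => Y i w * a w) by solve_bm.
have bq k : bounded_measurable (fun w => B w ^+ k) by solve_bm.
have EyE : E (fun w => Y i w * y w ^+ q) =
    E R1 + E R2 + q%:R * E R3 + q%:R * E R4.
  rewrite -!E_Z//; try exact: bm_integrable.
  rewrite -!E_D; try (apply: bm_integrable => //; solve_bm).
  by apply: eq_Rintegral => w _; rewrite /R1 /R2 /R3 /R4 -ya; ring.
rewrite EyE.
pose Ea := E (fun w => Y i w * a w); rewrite -/a -/Ea.
pose E2 := E (fun w => w2 w ^+ q.-1); pose Ey := E (fun w => y w ^+ q.-1).
rewrite -/Ey (_ : _ - _ = E R1 + E R2 + q%:R * E R3 + q%:R * (E R4 - Ea * E2)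
   + q%:R * Ea * (E2 - Ey)); last by ring.
pose EB := E (fun w => B w ^+ q.-1); rewrite -/EB.
have EBq c : E (fun w => c * B w ^+ q.-1) = c * EB.
  by rewrite E_Z//; exact: bm_integrable.
have EB_norm_le f c : bounded_measurable f ->
    (forall w, `|f w| <= c * B w ^+ q.-1) -> `|E f| <= c * EB.
  move=> bf fc; rewrite -EBq; apply: E_norm_le => //; first exact: bm_integrable.
  by apply: bm_integrable => //; solve_bm.
have q_ge0 : (0 : R) <= q%:R by [].
have b1 : `|E R1| <= q%:R ^+ 2 * C * eta ^+ 2 * EB.
  apply: EB_norm_le => // w; rewrite /R1 normrM.
  rewrite (le_trans (ler_pM _ _ (YC i w) (power_taylor2_le q (B1 w) (yB w) (w1B w))))//.
  rewrite ya mulrA ler_wpM2r ?exprn_ge0 ?(le_trans ler01)//.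
  rewrite mulrA [C * _]mulrC ler_wpM2l ?mulr_ge0 ?sqr_ge0//.
  by rewrite -real_normK ?num_real// lerXn2r ?nnegrE.
have x_pow_le1 k : x ^+ k <= 1 by rewrite exprn_ile1// ltW.
have N1 : (1 : R) <= N%:R by rewrite ler1n.
have far_pow k l : (size (far_times l i N))%:R ^+ k <= N%:R ^+ k :> R.
  by rewrite lerXn2r ?nnegrE// ler_nat size_far_times.
have Cle k l : (k <= l)%N -> C ^+ k <= C ^+ l by move=> kl; rewrite ler_weXn2l.
have b2 : `|E R2| <= 3 * C ^+ q.+1 * N%:R ^+ q * dl.
  have -> : E R2 = x ^+ q * (E (fun w => \prod_(j <- [:: i]) Y j w *
       psum (far_times r i N) w ^+ q) - mixed_moment [:: i] *
       E (fun w => psum (far_times r i N) w ^+ q)).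
    rewrite centered mul0r subr0 -E_Z; last by apply: bm_integrable => //; apply: bmM => //; [exact: bm_prod|solve_bm].
    by apply: eq_Rintegral => w _; rewrite big_seq1 /R2 /w1 exprMn; ring.
  rewrite normrM (ger0_norm (exprn_ge0 _ (ltW x0))).
  rewrite (@le_trans _ _ (1 * (N%:R ^+ q * ((1 + C ^+ q + C ^+ 1) * dl))))//.
    apply: ler_pM => //; first exact: exprn_ge0 _ (ltW x0).
    apply: le_trans; first apply: isolated_power => //.
      by move=> j /far_timesP[h|h]; [left|right] => k; rewrite inE => /eqP ->.
    by rewrite ler_wpM2r ?mulr_ge0 ?addr_ge0 ?exprn_ge0.
  rewrite mul1r mulrA ler_wpM2r// mulrC ler_wpM2r ?exprn_ge0//.
  have h1 := Cle 0 q.+1 isT; have h2 := Cle q q.+1 (leqnSn q).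
  by have h3 := Cle 1 q.+1 isT; rewrite expr0 in h1; lra.
have b3 : `|E R3| <= q%:R * C * eta ^+ 2 * EB.
  apply: EB_norm_le => // w; rewrite /R3 normrM (normrM (Y i w)).
  rewrite (@le_trans _ _ (C * eta * (q%:R * eta * B w ^+ q.-1)))//.
    by apply: ler_pM => //; [apply: ler_pM|exact: diffB].
  by rewrite le_eqVlt; apply/orP; left; apply/eqP; ring.
have b4 : `|E R4 - Ea * E2| <= 3 * C ^+ q.+1 * N%:R ^+ q * dl.
  have qS : q = q.-1.+1 by rewrite prednK.
  have -> : E R4 = x ^+ q * \sum_(j <- near_times r i N)
      E (fun w => \prod_(l <- [:: i; j]) Y l w *
                  psum (far_times (r + r) i N) w ^+ q.-1).
    rewrite -E_sum//; last by move=> j; apply: bm_integrable => //; apply: bmM; [exact: bm_prod|solve_bm].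
    rewrite -E_Z; last by apply: bm_integrable => //; apply: bm_sum => j; apply: bmM; [exact: bm_prod|solve_bm].
    apply: eq_Rintegral => w _; rewrite /R4 /a /w2 exprMn {3}qS exprS.
    rewrite -mulr_suml [\sum_(j <- _) _](_ : _ = Y i w * psum (near_times r i N) w); first by ring.
    by rewrite /psum mulr_sumr; apply: eq_bigr => j _; rewrite big_cons big_seq1.
  have -> : Ea = x * \sum_(j <- near_times r i N) mixed_moment [:: i; j].
    rewrite -E_sum//; last by move=> j; apply: bm_integrable => //; exact: bm_prod.
    rewrite -E_Z; last by apply: bm_integrable => //; apply: bm_sum => j; exact: bm_prod.
    apply: eq_Rintegral => w _; rewrite /a [\sum_(j <- _) _](_ : _ = Y i w * psum (near_times r i N) w); first by ring.
    by rewrite /psum mulr_sumr; apply: eq_bigr => j _; rewrite big_cons big_seq1.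
  have -> : E2 = x ^+ q.-1 * E (fun w => psum (far_times (r + r) i N) w ^+ q.-1).
    rewrite -E_Z; last by apply: bm_integrable => //; solve_bm.
    by apply: eq_Rintegral => w _; rewrite /w2 exprMn.
  have xq : x ^+ q = x * x ^+ q.-1 by rewrite -exprS -qS.
  rewrite xq; set S1 := \sum_(j <- _) _; set S2 := \sum_(j <- _) _; set E' := E _.
  rewrite (_ : _ - _ = x ^+ q.-1 * (x * (S1 - S2 * E'))); last by ring.
  rewrite /S1 /S2 mulr_suml -sumrB normrM (ger0_norm (exprn_ge0 _ (ltW x0))).
  rewrite normrM (ger0_norm (ltW x0)) /E'.
  have term j : j \in near_times r i N ->
     `|E (fun w => \prod_(l <- [:: i; j]) Y l w * psum (far_times (r + r) i N) w ^+ q.-1)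
       - mixed_moment [:: i; j] * E (fun w => psum (far_times (r + r) i N) w ^+ q.-1)|
     <= 3 * C ^+ q.+1 * N%:R ^+ q * dl.
    move=> jn; apply: le_trans; first apply: isolated_power => //.
    - by rewrite /= add2n -qS.
    - by move=> l; exact: near_far_sep.
    rewrite mulrA ler_wpM2r// mulrC; apply: ler_pM.
    - by rewrite !addr_ge0// exprn_ge0.
    - by rewrite exprn_ge0.
    - have h1 := Cle 0 q.+1 isT; rewrite expr0 in h1.
      have h2 := Cle q.-1 q.+1 (leq_trans (leq_pred q) (leqnSn q)).
      by have h3 := Cle 2 q.+1 q0; lra.
    by rewrite (le_trans (far_pow _ _))// ler_weXn2l// leq_pred.
  rewrite mulrA -[leRHS]mul1r.
  have c0 : 0 <= 3 * C ^+ q.+1 * N%:R ^+ q * dl.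
    by rewrite !mulr_ge0// exprn_ge0.
  apply: (@le_trans _ _ (x ^+ q.-1 * x *
      ((size (near_times r i N))%:R * (3 * C ^+ q.+1 * N%:R ^+ q * dl)))).
    apply: ler_wpM2l; first by rewrite mulr_ge0 ?exprn_ge0 ?(ltW x0).
    rewrite (le_trans (ler_norm_sum _ _ _))// mulr_natl -[leRHS]iter_addr_0.
    rewrite -count_predT -big_const_seq big_seq [leRHS]big_seq.
    exact: ler_sum.
  rewrite mulrA ler_wpM2r// -mulrA mulr_ile1 ?exprn_ge0 ?mulr_ge0 ?(ltW x0)//.
  rewrite mulrC (le_trans _ xr)// ler_wpM2r ?(ltW x0)//.
  rewrite -[leLHS]mulr1; apply: ler_pM => //.
  rewrite -natrM ler_nat (leq_trans (size_near_times _ _ _))//.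
  by rewrite addnn -mul2n leq_mul2r orbT.
have bEa : `|Ea| <= C * eta.
  by apply: E_bound => // w; rewrite (normrM (Y i w)) ler_pM.
have b5 : `|Ea * (E2 - Ey)| <= q%:R * C * eta ^+ 2 * EB.
  rewrite normrM (@le_trans _ _ (C * eta * (q%:R * eta * EB)))//.
    apply: ler_pM => //; rewrite /E2 /Ey -E_B; try (apply: bm_integrable => //; solve_bm).
    by apply: EB_norm_le; [solve_bm|move=> w; apply: diffB => //; rewrite distrC].
  by rewrite le_eqVlt; apply/orP; left; apply/eqP; ring.
have q1 : (1 : R) <= q%:R by rewrite ler1n.
have EB0 : 0 <= EB by apply: E_ge0 => w; rewrite exprn_ge0 ?(le_trans ler01).
have qq : q%:R * (q%:R * C * eta ^+ 2 * EB) = q%:R ^+ 2 * C * eta ^+ 2 * EB by ring.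
have t3 : `|q%:R * E R3| <= q%:R ^+ 2 * C * eta ^+ 2 * EB.
  by rewrite normrM ger0_norm// -qq ler_wpM2l.
have t5 : `|q%:R * Ea * (E2 - Ey)| <= q%:R ^+ 2 * C * eta ^+ 2 * EB.
  by rewrite -mulrA normrM ger0_norm// -qq ler_wpM2l.
have c0 : 0 <= 3 * C ^+ q.+1 * N%:R ^+ q * dl.
  by rewrite !mulr_ge0// exprn_ge0.
have t2 : `|E R2| <= q%:R * (3 * C ^+ q.+1 * N%:R ^+ q * dl).
  by rewrite (le_trans b2)// ler_peMl.
have t4 : `|q%:R * (E R4 - Ea * E2)| <= q%:R * (3 * C ^+ q.+1 * N%:R ^+ q * dl).
  by rewrite normrM ger0_norm// ler_wpM2l.
rewrite (_ : 3 * q%:R ^+ 2 * C * eta ^+ 2 * EB = 3 * (q%:R ^+ 2 * C * eta ^+ 2 * EB)); last by ring.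
rewrite (_ : 6 * q%:R * C ^+ q.+1 * N%:R ^+ q * dl = 2 * (q%:R * (3 * C ^+ q.+1 * N%:R ^+ q * dl))); last by ring.
exact: norm_sum5_le.
Qed.

(** Summation of the previous estimate over [i]: the case of exponent one
    identifies the sum of the [E (Y i * a)] with the second moment. Without the
    error terms this is the recursion between the moments of a centered normal law. *)
Lemma moment_recursion :
  `|E (fun w => y w ^+ q.+1)
    - q%:R * E (fun w => y w ^+ 2) * E (fun w => y w ^+ q.-1)|
  <= 108 * q%:R ^+ 2 * C ^+ 3 * (r%:R ^+ 2 * x) * E (fun w => (1 + `|y w|) ^+ q.-1)
     + 9 * q%:R * C ^+ q.+1 * N%:R ^+ q.+1 * dl.
Proof.
have EyS k : E (fun w => y w ^+ k.+1) =
    x * \sum_(i <- iota 0 N) E (fun w => Y i w * y w ^+ k).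
  rewrite -E_sum//; last by move=> i; apply: bm_integrable => //; solve_bm.
  rewrite -E_Z; last by apply: bm_integrable => //; apply: bm_sum => i; solve_bm.
  by apply: eq_Rintegral => w _; rewrite -mulr_suml exprS {1}/y mulrA.
pose Ea i := E (fun w => Y i w * (x * psum (near_times r i N) w)).
pose Ey := E (fun w => y w ^+ q.-1).
pose EB := E (fun w => B w ^+ q.-1); rewrite -/Ey -/EB.
rewrite EyS [E (fun w => y w ^+ 2)](EyS 1%N).
pose D i := E (fun w => Y i w * y w ^+ 1).
have DE i : D i = E (fun w => Y i w * y w ^+ 1) by [].
have sizeN : size (iota 0 N) = N by rewrite size_iota.
have N1 : (1 : R) <= N%:R by rewrite ler1n.
have qS : q = q.-1.+1 by rewrite prednK.
have q1 : (1 : R) <= q%:R by rewrite ler1n.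
have sum_le (F : nat -> R) c : (forall i, `|F i| <= c) ->
    `|\sum_(i <- iota 0 N) F i| <= N%:R * c.
  move=> Fc; rewrite (le_trans (ler_norm_sum _ _ _))// -[in leRHS]sizeN.
  rewrite mulr_natl -[leRHS]iter_addr_0 -count_predT -big_const_seq.
  exact: ler_sum.
have bD i : `|D i - Ea i| <= x * (N%:R * (3 * C * dl)).
  have -> : D i - Ea i = x * (E (fun w => \prod_(j <- [:: i]) Y j w *
      psum (far_times r i N) w ^+ 1) - mixed_moment [:: i] *
      E (fun w => psum (far_times r i N) w ^+ 1)).
    rewrite centered mul0r subr0 -E_Z; last by apply: bm_integrable => //; apply: bmM => //; [exact: bm_prod|solve_bm].
    rewrite /D /Ea -E_B; try (apply: bm_integrable => //; solve_bm).
    apply: eq_Rintegral => w _; rewrite big_seq1 !expr1 /y (psum_near_far r i).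
    by ring.
  rewrite normrM (ger0_norm (ltW x0)) ler_wpM2l ?(ltW x0)//.
  apply: le_trans; first apply: isolated_power => //.
  - by rewrite (leq_trans _ qp).
  - by move=> j /far_timesP[h|h]; [left|right] => k; rewrite inE => /eqP ->.
  rewrite /= !expr1; apply: ler_pM => //.
  - by rewrite mulr_ge0 ?addr_ge0.
  - by rewrite ler_nat size_far_times.
  by rewrite ler_wpM2r//; have := C1; lra.
have bEy : `|Ey| <= (N%:R * C) ^+ q.-1.
  apply: E_bound => //; first by solve_bm.
  move=> w; rewrite normrX lerXn2r ?nnegrE ?mulr_ge0//.
  rewrite /y normrM (ger0_norm (ltW x0)) (le_trans (ler_pM _ _ x1 (psum_bound _ _))) ?(ltW x0)//.
  by rewrite mul1r sizeN.
rewrite [X in q%:R * (x * X)](_ : _ = \sum_(i <- iota 0 N) D i)//.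
rewrite (_ : _ - _ = x * \sum_(i <- iota 0 N)
     (E (fun w => Y i w * y w ^+ q) - q%:R * Ea i * Ey)
   - q%:R * Ey * (x * \sum_(i <- iota 0 N) (D i - Ea i))); last first.
  rewrite !sumrB.
  rewrite (_ : \sum_(i <- iota 0 N) q%:R * Ea i * Ey = q%:R * (\sum_(i <- iota 0 N) Ea i) * Ey).
    by ring.
  by rewrite mulr_sumr mulr_suml.
apply: (le_trans (ler_normB _ _)).
rewrite (_ : _ + 9 * _ * _ * _ * _ =
    (108 * q%:R ^+ 2 * C ^+ 3 * (r%:R ^+ 2 * x) * EB +
     6 * q%:R * C ^+ q.+1 * N%:R ^+ q.+1 * dl) +
    3 * q%:R * C ^+ q.+1 * N%:R ^+ q.+1 * dl); last by ring.
apply: lerD.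
  rewrite normrM (ger0_norm (ltW x0)).
  rewrite (le_trans (ler_wpM2l (ltW x0) (sum_le _ _ one_term)))//.
  rewrite -/EB mulrDr mulrDr; apply: lerD.
    rewrite le_eqVlt; apply/orP; left; apply/eqP.
    have e : r%:R ^+ 2 * x = r%:R ^+ 2 * x * (x ^+ 2 * N%:R) by rewrite xN mulr1.
    by rewrite [in RHS]e /eta; ring.
  have c0 : 0 <= 6 * q%:R * C ^+ q.+1 * N%:R ^+ q.+1 * dl.
    by rewrite !mulr_ge0// exprn_ge0.
  rewrite (_ : x * _ = x * (6 * q%:R * C ^+ q.+1 * N%:R ^+ q.+1 * dl)).
    by rewrite ler_piMl.
  by rewrite (exprS N%:R); ring.
rewrite normrM (normrM q%:R) (normrM x) (ger0_norm (ltW x0)).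
rewrite (@ger0_norm _ q%:R)//.
apply: (@le_trans _ _ (q%:R * (N%:R * C) ^+ q.-1 *
     (x * (N%:R * (x * (N%:R * (3 * C * dl))))))).
  apply: ler_pM.
  - by rewrite mulr_ge0.
  - by rewrite mulr_ge0 ?(ltW x0).
  - by rewrite ler_wpM2l.
  by rewrite ler_wpM2l ?(ltW x0)// sum_le.
rewrite (_ : _ * (x * _) = (x ^+ 2 * N%:R) * (3 * q%:R * C ^+ q * N%:R ^+ q * dl)); last first.
  have eC : C ^+ q = C * C ^+ q.-1 by rewrite -exprS -qS.
  have eN : N%:R ^+ q = N%:R * N%:R ^+ q.-1 :> R by rewrite -exprS -qS.
  by rewrite eC eN exprMn; ring.
rewrite xN mul1r ler_wpM2r//; apply: ler_pM; rewrite ?mulr_ge0 ?exprn_ge0//.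
  by apply: ler_wpM2l; rewrite ?mulr_ge0// ler_weXn2l.
by rewrite ler_weXn2l.
Qed.

End OneStep.

End MomentRecursion.

(** * Convergence to Gaussian moments *)

Section Scales.
Context {R : realType}.

Lemma exists_integer_root (b N : nat) : (0 < b)%N ->
  exists n, (n ^ b <= N < n.+1 ^ b)%N.
Proof.
move=> b0; elim: N => [|N [n /andP[h1 h2]]].
  by exists 0%N; rewrite exp0n// exp1n.
have [h|h] := ltnP N.+1 (n.+1 ^ b); first by exists n; rewrite h (leqW h1).
have e : (n.+1 ^ b = N.+1)%N by apply/eqP; rewrite eqn_leq h h2.
exists n.+1; apply/andP; split; first by rewrite e.
by rewrite -e ltn_exp2r.
Qed.

(** Powers are beaten by the exponential: [e^y = (e^(y/k))^k >= (y/k)^k]. *)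
Lemma exprn_le_expR (k : nat) (y : R) : 0 <= y ->
  y ^+ k <= k%:R ^+ k * expR y.
Proof.
move=> y0; case: k => [|k]; first by rewrite !expr0 mul1r -expR0 ler_expR.
have k0 : (0 : R) < k.+1%:R by [].
have -> : expR y = expR (y / k.+1%:R) ^+ k.+1.
  by rewrite -expRM_natl mulrC divfK// gt_eqF.
rewrite -exprMn; apply: lerXn2r; rewrite ?nnegrE ?mulr_ge0 ?expR_ge0//.
rewrite mulrC -ler_pdivrMr//.
by rewrite (le_trans _ (expR_ge1Dx _))// lerDr.
Qed.

Lemma expRN_decay (m : nat) : exists2 c : R, 0 <= c &
  forall n : nat, n.+1%:R ^+ m * expR (- n%:R) <= c / n.+1%:R.
Proof.
exists (m.+1%:R ^+ m.+1 * expR 1); first by rewrite mulr_ge0 ?expR_ge0 ?exprn_ge0.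
move=> n; rewrite ler_pdivlMr// mulrAC -exprSr.
have := @exprn_le_expR m.+1 n.+1%:R (ler0n _ _).
rewrite -[X in expR X]natr1 expRD => h.
rewrite (le_trans (ler_wpM2r (expR_ge0 _) h))//.
rewrite -[leLHS]mulrA [expR n%:R * expR 1]mulrC -[_ * _ * expR (- _)]mulrA.
by rewrite -expRD subrr expR0 mulr1.
Qed.

(** The integer [b]-th root of [N], with [b] large compared to [a]: its [a]-th power
    is negligible before [N ^ (1/4)], and powers of [N] are powers of the root,
    beaten by the exponential. *)
Lemma exists_scale (a m n0 : nat) (e : R) : 0 < e ->
  \forall N \near \oo, exists n, [/\ (n0 <= n)%N,
    (n ^ a)%:R ^+ 2 / Num.sqrt N%:R <= e & N%:R ^+ m * expR (- n%:R) <= e].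
Proof.
move=> e0; pose b := (4 * a.+1)%N.
have [c c0 cP] := expRN_decay (b * m).
pose n1 := maxn n0.+1 (Num.truncn ((1 + c) / e)).+1.
exists (n1 ^ b)%N => // N /= n1N.
have [n /andP[nN Nn]] := @exists_integer_root b N isT.
have n1n : (n1 <= n)%N.
  by rewrite -ltnS -(@ltn_exp2r _ _ b)// (leq_ltn_trans n1N).
have n_gt0 : (0 < n)%N by rewrite (leq_trans _ n1n)// /n1 leq_max.
have ne : (1 + c) / n%:R <= e.
  rewrite ler_pdivrMr ?ltr0n// -ler_pdivrMl// mulrC ltW//.
  rewrite (lt_le_trans (truncnS_gt _))// ler_nat.
  by rewrite (leq_trans _ n1n)// leq_maxr.
exists n; split.
- by rewrite (leq_trans _ n1n)// (leq_trans (leqnSn _))// leq_maxl.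
- apply: le_trans ne.
  have sN : (n%:R ^+ (2 * a.+1) : R) <= Num.sqrt N%:R.
    rewrite -(@ger0_norm _ (n%:R ^+ _)) ?exprn_ge0// -sqrtr_sqr ler_wsqrtr//.
    by rewrite -exprM -natrX ler_nat (leq_trans _ nN)//; rewrite leq_pexp2l // /b; lia.
  have p0 : (0 : R) < n%:R ^+ (2 * a.+1) by rewrite exprn_gt0// ltr0n.
  rewrite (@le_trans _ _ ((n ^ a)%:R ^+ 2 / n%:R ^+ (2 * a.+1)))//.
    rewrite ler_wpM2l ?exprn_ge0// lef_pV2 ?posrE//.
    exact: lt_le_trans sN.
  rewrite natrX -exprM mulnC (_ : (2 * a.+1 = 2 * a + 2)%N); last by lia.
  rewrite exprD invfM mulrA divff ?mul1r ?gt_eqF ?exprn_gt0 ?ltr0n//.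
  rewrite (@le_trans _ _ (n%:R^-1))//.
    by rewrite lef_pV2 ?posrE ?exprn_gt0 ?ltr0n// expr2 ler_peMl// ler1n.
  by rewrite ler_peMl ?invr_ge0//; lra.
- apply: le_trans ne; apply: (@le_trans _ _ (n.+1%:R ^+ (b * m) * expR (- n%:R))).
    rewrite ler_wpM2r ?expR_ge0// exprM lerXn2r ?nnegrE ?exprn_ge0//.
    by rewrite -natrX ler_nat ltnW.
  rewrite (le_trans (cP n))// ler_pM ?invr_ge0//; first by lra.
  by rewrite lef_pV2 ?posrE ?ltr0n// ler_nat.
Qed.

End Scales.

(** The moments of the centered normal law of variance [v]. *)
Fixpoint gauss_moment {R : realType} (v : R) (k : nat) : R :=
  match k with
  | 0%N => 1
  | 1%N => 0
  | k'.+2 => k'.+1%:R * v * gauss_moment v k'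
  end.

Lemma one_plus_pow_le {R : realType} (u : R) n : 0 <= u ->
  (1 + u) ^+ n <= 2 ^+ n * (1 + u ^+ n).
Proof.
move=> u0; have [u1|u1] := leP u 1.
  rewrite (@le_trans _ _ (2 ^+ n))//.
    by rewrite lerXn2r ?nnegrE//; lra.
  by rewrite ler_peMr ?exprn_ge0// lerDl exprn_ge0.
rewrite mulrDr -exprMn mulr1 -[leLHS]add0r lerD ?exprn_ge0//.
by rewrite lerXn2r ?nnegrE//; lra.
Qed.

Section MomentAsymptotics.
Context {R : realType} {d : measure_display} {X : measurableType d}.
Variable Q : {measure set X -> \bar R}.
Hypothesis Q1 : Q setT = 1%E.
Variables (Y : nat -> X -> R) (C : R).
Hypothesis C1 : 1 <= C.
Hypothesis mY : forall i, measurable_fun setT (Y i).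
Hypothesis YC : forall i x, `|Y i x| <= C.
Variables (p a n0 : nat) (V : R).
Hypothesis dec : forall n, (n0 <= n)%N ->
  decorrelated Q Y (n ^ a) (expR (- n%:R)) p.
Hypothesis centered : forall i, mixed_moment Q Y [:: i] = 0.

Local Notation E f := (Rintegral Q setT f).

Let y (N : nat) (w : X) : R := (Num.sqrt N%:R)^-1 * psum Y (iota 0 N) w.
Let v N := E (fun w => y N w ^+ 2).
Hypothesis vV : \forall N \near \oo, v N <= V.

Let bmy N : bounded_measurable (y N).
Proof. by apply: bmM => //; apply: bm_psum C mY YC _. Qed.
Local Hint Resolve bmy : core.

Let v0 N : 0 <= v N. Proof. by apply: E_ge0 => w; exact: sqr_ge0. Qed.

(** At the scale provided by [exists_scale] the first error term of the recursion
    is small against [sqrt N], and the second because [expR (- n)] beats the power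
    of [N]. *)
Let recursion_cvg q M : (0 < q)%N -> (q.+1 <= p)%N ->
  (\forall N \near \oo, E (fun w => (1 + `|y N w|) ^+ q.-1) <= M) ->
  (E (fun w => y N w ^+ q.+1) - q%:R * v N * E (fun w => y N w ^+ q.-1))
    @[N --> \oo] --> 0.
Proof.
move=> q0 qp hM; apply/cvgrPdist_le => e e0.
pose c1 := 108 * q%:R ^+ 2 * C ^+ 3; pose c2 := 9 * q%:R * C ^+ q.+1.
have C0 : 0 <= C by exact: le_trans ler01 C1.
have c10 : 0 <= c1 by rewrite /c1 !mulr_ge0// ?exprn_ge0.
have c20 : 0 <= c2 by rewrite /c2 !mulr_ge0// ?exprn_ge0.
have c1M : 0 <= c1 * `|M| by rewrite mulr_ge0.
(* The last summand of [D] serves the smallness condition of the recursion. *)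
pose D := c1 * `|M| + c2 + 6 * C.
have D0 : 0 < D by rewrite /D; have := C1; lra.
have [e' [e'0 e'D e'De]] : exists e', [/\ 0 < e', e' * D <= 1 & e' * D <= e].
  exists (Num.min e 1 / D); rewrite divfK ?gt_eqF//.
  split; first by rewrite divr_gt0// lt_min e0 ltr01.
    by rewrite ge_min lexx orbT.
  by rewrite ge_min lexx.
near=> N.
have N0 : (0 < N)%N by near: N; exists 1%N.
have [n [n0n rn dn]] : exists n, [/\ (n0 <= n)%N,
    (n ^ a)%:R ^+ 2 / Num.sqrt N%:R <= e' & N%:R ^+ q.+1 * expR (- n%:R) <= e'].
  by near: N; exact: exists_scale.
have sN0 : 0 < Num.sqrt (N%:R : R) by rewrite sqrtr_gt0 ltr0n.
have x0 : 0 < (Num.sqrt (N%:R : R))^-1 by rewrite invr_gt0.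
have xN : (Num.sqrt (N%:R : R))^-1 ^+ 2 * N%:R = 1.
  by rewrite exprVn sqr_sqrtr ?ler0n// mulVf// pnatr_eq0 -lt0n.
have e'c1M : 0 <= e' * (c1 * `|M|) := mulr_ge0 (ltW e'0) c1M.
have e'c2 : 0 <= e' * c2 := mulr_ge0 (ltW e'0) c20.
have e'C : 0 <= e' * (6 * C) := mulr_ge0 (ltW e'0) (mulr_ge0 (ler0n _ 6) C0).
have eDE : e' * D = e' * (c1 * `|M|) + e' * c2 + e' * (6 * C) by rewrite /D; ring.
have xr : 6 * (n ^ a)%:R * C * (Num.sqrt (N%:R : R))^-1 <= 1.
  have h : (n ^ a)%:R / Num.sqrt N%:R <= e'.
    apply: le_trans rn; rewrite ler_wpM2r ?(ltW x0)// -natrX ler_nat.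
    by case: (n ^ a)%N => // k; rewrite expnS expn1 leq_pmulr.
  have := ler_wpM2l C0 h.
  rewrite (_ : 6 * _ * _ * _ = 6 * (C * ((n ^ a)%:R / Num.sqrt N%:R))); last by ring.
  have h3 : e' * (6 * C) <= 1 by apply: le_trans e'D; rewrite eDE lerDr addr_ge0.
  by move=> h2; apply: (@le_trans _ _ (6 * (C * e'))); [rewrite ler_wpM2l|lra].
rewrite sub0r normrN.
have dec_n := @dec n n0n.
apply: le_trans (moment_recursion Q1 C1 mY YC dec_n centered N0 q0 qp x0 xN xr) _.
rewrite -/c1 -/c2.
have EBM : E (fun w => (1 + `|y N w|) ^+ q.-1) <= `|M|.
  by rewrite (le_trans _ (ler_norm M))//; near: N.
have EB0 : 0 <= E (fun w => (1 + `|y N w|) ^+ q.-1).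
  by apply: E_ge0 => w; rewrite exprn_ge0// addr_ge0.
apply: (@le_trans _ _ (e' * (c1 * `|M|) + e' * c2)); last by lra.
apply: lerD.
  rewrite -mulrA [e' * _]mulrCA; apply: ler_wpM2l => //.
  by apply: ler_pM => //; rewrite mulr_ge0 ?exprn_ge0// ltW.
by rewrite -mulrA mulrC; apply: ler_wpM2r.
Unshelve. all: by end_near. Qed.

Let pow_bound k M : (\forall N \near \oo, E (fun w => y N w ^+ (k + k)) <= M) ->
  forall j, (j <= k + k)%N ->
  \forall N \near \oo, E (fun w => (1 + `|y N w|) ^+ j) <= 2 ^+ (k + k) * (1 + M).
Proof.
move=> hM j jk; near=> N.
apply: (@le_trans _ _ (2 ^+ (k + k) * (1 + E (fun w => y N w ^+ (k + k))))); last first.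
  by rewrite ler_wpM2l ?exprn_ge0// lerD2l; near: N.
rewrite -[X in 2 ^+ _ * (X + _)](E_cst Q1) -E_D; try (apply: bm_integrable => //; solve_bm).
rewrite -E_Z; last by apply: bm_integrable => //; solve_bm.
apply: E_le => [||w]; try (apply: bm_integrable => //; solve_bm).
rewrite (@le_trans _ _ ((1 + `|y N w|) ^+ (k + k)))//.
  by rewrite ler_weXn2l// lerDl.
rewrite (le_trans (one_plus_pow_le _ (normr_ge0 _)))// -normrX ger0_norm//.
by rewrite exprD -expr2 sqr_ge0.
Unshelve. all: by end_near. Qed.

(** The recursion bounds the moment of order [k.+1 + k.+1] by the one of order
    [k + k]. *)
Let even_bounded k : (k + k <= p)%N ->
  exists2 M, 0 <= M & \forall N \near \oo, E (fun w => y N w ^+ (k + k)) <= M.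
Proof.
elim: k => [|k IH] kp.
  by exists 1 => //; near=> N; under eq_Rintegral do rewrite expr0; rewrite E_cst.
have [|M M0 hM] := IH; first by lia.
have hB := pow_bound hM (leqnn _).
have qp : ((k + k).+1.+1 <= p)%N by rewrite -addnS -addSn.
have /cvgrPdist_le/(_ 1 ltr01) := @recursion_cvg (k + k).+1 _ isT qp hB.
move=> h; exists ((k + k).+1%:R * `|V| * M + 1) => //.
  by rewrite addr_ge0// !mulr_ge0.
near=> N; rewrite addnS addSn.
have h1 : `|0 - (E (fun w => y N w ^+ (k + k).+2) -
  (k + k).+1%:R * v N * E (fun w => y N w ^+ (k + k)))| <= 1 by near: N.
rewrite sub0r normrN in h1.
rewrite -lerBlDl (le_trans _ (le_trans (ler_norm _) h1))// lerD2l lerN2.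
have vN : v N <= V by near: N.
apply: ler_pM; rewrite ?mulr_ge0//.
- by apply: E_ge0 => w; rewrite exprD -expr2 sqr_ge0.
- by rewrite ler_wpM2l// (le_trans vN)// ler_norm.
- by near: N.
Unshelve. all: by end_near. Qed.

Theorem moments_asymptotically_gaussian k : (k <= p)%N ->
  (E (fun w => y N w ^+ k) - gauss_moment (v N) k) @[N --> \oo] --> 0.
Proof.
have [n nk] := ubnP k; elim: n k nk => // n IH [|[|k]] nk kp.
- rewrite (_ : (fun _ => _) = fun=> 0); first exact: cvg_cst.
  by apply/funext => N; under eq_Rintegral do rewrite expr0; rewrite E_cst// subrr.
- rewrite (_ : (fun _ => _) = fun=> 0); first exact: cvg_cst.
  apply/funext => N; under eq_Rintegral do rewrite expr1.
  rewrite E_Z; last by apply: bm_integrable => //; apply: bm_psum C mY YC _.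
  rewrite /psum E_sum//; last by move=> i; apply: bm_integrable => //; split => //; exists C.
  rewrite big1 ?mulr0 ?subr0// => i _; rewrite -[RHS](centered i).
  by apply: eq_Rintegral => w _; rewrite big_seq1.
rewrite (_ : (fun _ => _) = fun N =>
   (E (fun w => y N w ^+ k.+2) - k.+1%:R * v N * E (fun w => y N w ^+ k)) +
   k.+1%:R * v N * (E (fun w => y N w ^+ k) - gauss_moment (v N) k)); last first.
  by apply/funext => N /=; ring.
rewrite -[X in _ --> X]addr0; apply: cvgD.
  (* The errors at order [k.+2] are bounded by the next even moment after [k]. *)
  pose l := uphalf k.
  have kl : (k <= l + l)%N by rewrite /l; lia.
  have lp : (l + l <= p)%N by rewrite /l; lia.
  have [M _ hM] := even_bounded lp.
  by apply: (@recursion_cvg k.+1 _ isT kp (pow_bound hM kl)).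
have /cvgrPdist_le h : (E (fun w => y N w ^+ k) - gauss_moment (v N) k) @[N --> \oo] --> 0.
  by apply: IH; lia.
apply/cvgrPdist_le => e e0.
have D0 : 0 < k.+1%:R * (`|V| + 1) by rewrite mulr_gt0// ltr_wpDl.
near=> N; rewrite sub0r normrN normrM.
have hN : `|0 - (E (fun w => y N w ^+ k) - gauss_moment (v N) k)| <= e / (k.+1%:R * (`|V| + 1)).
  by near: N; apply: h; rewrite divr_gt0.
rewrite sub0r normrN in hN.
have vN : v N <= V by near: N.
apply: (@le_trans _ _ (k.+1%:R * (`|V| + 1) * (e / (k.+1%:R * (`|V| + 1))))).
  apply: ler_pM => //; rewrite ger0_norm ?mulr_ge0// ler_wpM2l//.
  by rewrite (le_trans vN)// (le_trans (ler_norm _))// lerDl.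
by rewrite mulrC divfK// gt_eqF.
Unshelve. all: by end_near. Qed.

End MomentAsymptotics.

(** * Moments of the normal law *)

Section NormalMoments.
Context {R : realType}.
Variable s : R.
Hypothesis s_neq0 : s != 0.

Local Notation leb := (@lebesgue_measure R).
Local Notation N := (normal_prob 0 s : probability (measurableTypeR R) R).
Local Notation pdf := (normal_pdf 0 s).

Lemma ge0_integral_normal_prob (f : R -> \bar R) : (forall x, 0 <= f x)%E ->
  measurable_fun setT f ->
  (\int[N]_x f x = \int[leb]_x (f x * (pdf x)%:E))%E.
Proof.
move=> f0 mf.
have dom := @normal_prob_dominates R 0 s.
rewrite -(Radon_Nikodym_SigmaFinite.change_of_variables dom f0 measurableT mf).
have If := Radon_Nikodym_SigmaFinite.f_integrable dom.
apply: ae_eq_integral => //.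
- apply: emeasurable_funM => //; exact: measurable_int If.
- apply: emeasurable_funM => //; apply/measurable_EFinP.
  exact: measurable_normal_pdf.
- apply: ae_eqe_mul2l; apply: integral_ae_eq => //.
    by apply/measurable_EFinP; exact: measurable_normal_pdf.
  by move=> E _ mE; rewrite -Radon_Nikodym_SigmaFinite.f_integral.
Qed.

Let pdfE x : pdf x = normal_peak s * expR (- x ^+ 2 / (s ^+ 2 *+ 2)).
Proof. by rewrite normal_pdfE// /normal_fun subr0. Qed.

Let s2 : 0 < s ^+ 2. Proof. by rewrite exprn_even_gt0. Qed.

(** Half of the exponent absorbs the power; the other half gives the density of
    the normal law of variance [2 * s ^ 2]. *)
Lemma pow_normal_pdf_le k : exists2 c, 0 <= c &
  forall x, `|x ^+ k| * pdf x <= c * normal_pdf 0 (s * Num.sqrt 2) x.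
Proof.
pose t := s * Num.sqrt 2.
have t_neq0 : t != 0 by rewrite mulf_neq0// gt_eqF// sqrtr_gt0.
have t2 : t ^+ 2 = s ^+ 2 *+ 2 by rewrite exprMn sqr_sqrtr// mulr_natr.
pose u := 4 * s ^+ 2.
have u0 : 0 < u by rewrite mulr_gt0.
pose c := 1 + u ^+ k * k%:R ^+ k.
have c0 : 0 <= c by rewrite addr_ge0// mulr_ge0 ?exprn_ge0 ?(ltW u0).
exists (c * normal_peak s / normal_peak t).
  by rewrite divr_ge0 ?mulr_ge0 ?normal_peak_ge0.
move=> x; rewrite -/t (normal_pdfE 0 t_neq0) /normal_fun subr0 pdfE.
have pt0 : normal_peak t != 0 by rewrite gt_eqF// normal_peak_gt0.
set e' := expR (- x ^+ 2 / (t ^+ 2 *+ 2)).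
rewrite (_ : c * normal_peak s / normal_peak t * (normal_peak t * e') =
  normal_peak s * (c * e')); last by field.
rewrite mulrCA ler_wpM2l ?normal_peak_ge0// /e'.
have -> : expR (- x ^+ 2 / (s ^+ 2 *+ 2)) =
    expR (- x ^+ 2 / (t ^+ 2 *+ 2)) * expR (- (x ^+ 2 / u)).
  rewrite -expRD; congr expR; rewrite t2 /u.
  rewrite !mulr2n; field; rewrite s_neq0/= !gt_eqF//; have := s2; lra.
rewrite mulrCA mulrC ler_wpM2r ?expR_ge0//.
rewrite expRN -ler_pdivlMr ?invr_gt0 ?expR_gt0// invrK.
have x2u : 0 <= x ^+ 2 / u by rewrite divr_ge0 ?sqr_ge0 ?ltW.
have e1 : 1 <= expR (x ^+ 2 / u) by rewrite -expR0 ler_expR.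
have h : (x ^+ 2) ^+ k <= u ^+ k * k%:R ^+ k * expR (x ^+ 2 / u).
  have := exprn_le_expR k x2u; rewrite expr_div_n ler_pdivrMr ?exprn_gt0// => h.
  by rewrite (le_trans h)// le_eqVlt; apply/orP; left; apply/eqP; ring.
rewrite normrX /c mulrDl mul1r.
have [x1|x1] := leP `|x| 1.
  have xk1 : `|x| ^+ k <= 1 by rewrite exprn_ile1.
  by have := le_trans (sqr_ge0 (x ^+ k)) (eq_ind _ (fun z => z <= _) h _ (exprAC _ _ _)); lra.
have : `|x| ^+ k <= (x ^+ 2) ^+ k.
  by rewrite -real_normK ?num_real// -exprM mulnC ler_weXn2l ?(ltW x1)//; lia.
by lra.
Qed.

Let integrable_pow_pdf k : leb.-integrable setT (fun x => (x ^+ k * pdf x)%:E).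
Proof.
have [c c0 hc] := pow_normal_pdf_le k.
have Ig : leb.-integrable setT
    (fun x => c%:E * (normal_pdf 0 (s * Num.sqrt 2) x)%:E)%E.
  by apply: integrableZl => //; exact: integrable_normal_pdf.
apply: (le_integrable measurableT _ _ Ig) => [|x _].
  apply/measurable_EFinP/measurable_funM; first exact: measurable_funX.
  exact: measurable_normal_pdf.
rewrite /= lee_fin normrM (ger0_norm (normal_pdf_ge0 _ _ _)).
by rewrite (le_trans (hc x))// ler_norm.
Qed.

Lemma integrable_normal_pow k : N.-integrable setT (EFin \o (fun x => x ^+ k)).
Proof.
have mX : measurable_fun setT (fun x : R => x ^+ k) by exact: measurable_funX.
apply/integrableP; split; first exact/measurable_EFinP.
rewrite ge0_integral_normal_prob//; last first.
  by do 2 apply: measurableT_comp => //.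
have /integrableP[_] := integrable_pow_pdf k.
congr (_ < _)%E; apply: eq_integral => x _ /=.
by rewrite normrM (ger0_norm (normal_pdf_ge0 _ _ _)).
Qed.

Let J k := \int[leb]_x (x ^+ k * pdf x).

Let normal_powE k : \int[N]_x (x ^+ k) = J k.
Proof.
have mX : measurable_fun setT (fun x : R => x ^+ k) by exact: measurable_funX.
rewrite /J /Rintegral; congr fine.
rewrite integralE [in RHS]integralE.
have mE : measurable_fun setT (EFin \o (fun x : R => x ^+ k)) by exact/measurable_EFinP.
rewrite !ge0_integral_normal_prob//; [|exact: measurable_funeneg|exact: measurable_funepos].
congr (_ - _)%E; apply: eq_integral => x _.
  rewrite !funeposE /= -EFin_max -EFinM -EFin_max.
  by rewrite maxr_pMl ?normal_pdf_ge0// mul0r.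
rewrite !funenegE /= -EFin_max -EFinM -EFin_max.
by rewrite maxr_pMl ?normal_pdf_ge0// mul0r mulNr.
Qed.

Let derive_pow_pdf k (x : R) : is_derive x 1 (fun x => x ^+ k * pdf x)
   (k%:R * x ^+ k.-1 * pdf x - x ^+ k.+1 * pdf x / s ^+ 2).
Proof.
pose a := - (s ^+ 2 *+ 2)^-1.
rewrite (_ : (fun x => _) = ((@id R) ^+ k) *
   (cst (normal_peak s) * (expR \o (cst a * (@id R) ^+ 2)))); last first.
  apply/funext => z; rewrite pdfE !fctE /=; congr (_ * (_ * expR _)).
  by rewrite /a mulNr mulNr mulrC.
apply: is_derive_eq; rewrite !fctE /GRing.scale /= pdfE.
rewrite (_ : expR (- x ^+ 2 / (s ^+ 2 *+ 2)) = expR (a * x ^+ 2)); last first.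
  by congr expR; rewrite /a mulNr mulNr mulrC.
move: (expR (a * x ^+ 2)) => e.
rewrite (exprS x k) /a mulr2n; field.
by rewrite s_neq0/= gt_eqF//; have := s2; lra.
Qed.

(** The derivative of [x ^ k * pdf x]: its integral over the line vanishes, which
    links the moments of orders [k.+1] and [k.-1]. *)
Let dF k (x : R) := k%:R * x ^+ k.-1 * pdf x - x ^+ k.+1 * pdf x / s ^+ 2.

Let integrable_dF k : leb.-integrable setT (EFin \o dF k).
Proof.
rewrite (_ : _ \o _ = fun x => (k%:R%:E * (x ^+ k.-1 * pdf x)%:E -
   (s ^+ 2)^-1%:E * (x ^+ k.+1 * pdf x)%:E)%E); last first.
  by apply/funext => x /=; rewrite -!EFinM -EFinB /dF; congr EFin; ring.
by apply: integrableB => //; apply: integrableZl => //; exact: integrable_pow_pdf.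
Qed.

Let continuous_pdf : continuous pdf.
Proof. exact: continuous_normal_pdf. Qed.

Let continuous_pow_pdf k : continuous (fun x : R => x ^+ k * pdf x).
Proof. by move=> x; apply: cvgM; [exact: exprn_continuous|exact: continuous_pdf]. Qed.

Let FTC_dF k (n : nat) : (0 < n)%N ->
  (\int[leb]_(x in `[(- n%:R)%R, n%:R%R]) (dF k x)%:E =
   (n%:R ^+ k * pdf n%:R - (- n%:R) ^+ k * pdf (- n%:R))%:E)%E.
Proof.
move=> n0; pose F x := x ^+ k * pdf x.
have cF : continuous F by exact: continuous_pow_pdf.
rewrite (@continuous_FTC2 _ (dF k) F).
- by rewrite EFinB.
- by rewrite gtrN// ltr0n.
- apply: continuous_subspaceT => x.
  have h1 : {for x, continuous (fun y : R => k%:R * (y ^+ k.-1 * pdf y))}.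
    by apply: cvgMl_tmp; exact: continuous_pow_pdf.
  have h2 : {for x, continuous (fun y : R => y ^+ k.+1 * pdf y * (s ^+ 2)^-1)}.
    by apply: cvgMr_tmp; exact: continuous_pow_pdf.
  rewrite (_ : dF k = (fun y : R => k%:R * (y ^+ k.-1 * pdf y)) \-
    (fun y : R => y ^+ k.+1 * pdf y * (s ^+ 2)^-1)); first exact: cvgB h1 h2.
  by apply/funext => z; rewrite /dF /= -mulrA.
- split; [|exact/cvg_at_right_filter/cF|exact/cvg_at_left_filter/cF].
  by move=> x _; have [] := derive_pow_pdf k x.
- by move=> x _; rewrite derive1E; have [] := derive_pow_pdf k x.
Qed.

Let boundary_cvg k : (n%:R ^+ k * pdf n%:R - (- n%:R) ^+ k * pdf (- n%:R))
   @[n --> \oo] --> (0 : R).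
Proof.
have [c c0 hc] := pow_normal_pdf_le k.+1.
pose c' := c * normal_peak (s * Num.sqrt 2).
have hc' x : `|x ^+ k.+1| * pdf x <= c'.
  apply: le_trans (hc x) _; apply: ler_wpM2l => //; apply: normal_pdf_ub.
  by rewrite mulf_neq0// gt_eqF// sqrtr_gt0.
have b (x : R) : 0 < `|x| -> `|x ^+ k * pdf x| <= c' / `|x|.
  move=> x0; rewrite ler_pdivlMr// normrM (ger0_norm (normal_pdf_ge0 _ _ _)).
  by rewrite mulrAC -normrM -exprSr.
apply/cvgrPdist_le => e e0; near=> n.
have n0 : (0 : R) < n%:R by rewrite ltr0n; near: n; exists 1%N.
have c'n : c' / n%:R <= e / 2.
  rewrite ler_pdivrMr// -ler_pdivrMl ?divr_gt0//.
  by near: n; exact: nbhs_infty_ger.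
rewrite sub0r normrN (le_trans (ler_normB _ _))//.
have := b n%:R; have := b (- n%:R); rewrite normrN (ger0_norm (ltW n0)) => /(_ n0) b1 /(_ n0) b2.
by rewrite (le_trans (lerD b2 b1))//; lra.
Unshelve. all: by end_near. Qed.

Let J_recursion k : J k.+1 = k%:R * s ^+ 2 * J k.-1.
Proof.
pose f n := EFin \o ((dF k) \_ `[- n%:R, n%:R]).
have mdF : measurable_fun setT (dF k) by apply/measurable_EFinP; exact: measurable_int (integrable_dF k).
have [//|||||_ _] := @dominated_convergence _ _ R leb setT measurableT f (EFin \o dF k)
  (fun x => `|(dF k x)%:E|%E).
- move=> n; apply/measurable_EFinP; apply/(measurable_restrictT _ _).1 => //.
  exact: measurable_funTS.
- exact/measurable_EFinP.
- apply: aeW => x _; apply: cvg_near_cst; near=> n.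
  rewrite /f /= patchE mem_set//= in_itv/= -ler_norml.
  by near: n; exact: nbhs_infty_ger.
- exact: integrable_abse (integrable_dF k).
- apply: aeW => x n _; rewrite /f /= patchE; case: ifP => //= _.
  by rewrite normr0 lee_fin.
move=> h.
have {h} : (n%:R ^+ k * pdf n%:R - (- n%:R) ^+ k * pdf (- n%:R))%:E @[n --> \oo] -->
   (\int[leb]_x (dF k x)%:E)%E.
  apply: cvg_trans h; apply: near_eq_cvg; near=> n.
  rewrite -FTC_dF; last by near: n; exists 1%N.
  by rewrite [RHS]integral_mkcond; apply: eq_integral => x _; rewrite /f /= restrict_EFin.
have h0 : (n%:R ^+ k * pdf n%:R - (- n%:R) ^+ k * pdf (- n%:R))%:E @[n --> \oo] --> (0 : R)%:E.
  by apply: cvg_EFin; [exact: nearW|exact: boundary_cvg].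
move=> /(cvg_unique _ h0) => /(_ (@ereal_hausdorff R)) /(congr1 fine) /= h.
have : J k.+1 / s ^+ 2 = k%:R * J k.-1.
  rewrite /J mulrC -RintegralZl//; last exact: integrable_pow_pdf.
  rewrite -RintegralZl//; last exact: integrable_pow_pdf.
  apply/esym/eqP; rewrite -subr_eq0 -RintegralB//; last 2 first.
  - exact: intZ (integrable_pow_pdf _).
  - exact: intZ (integrable_pow_pdf _).
  rewrite [X in _ == X]h; apply/eqP; congr fine; apply: eq_integral => x _.
  by rewrite /dF; congr EFin; ring.
by move=> e; rewrite -[LHS](divfK (lt0r_neq0 s2)) e; ring.
Unshelve. all: by end_near. Qed.

Lemma normal_moment k : \int[N]_x (x ^+ k) = gauss_moment (s ^+ 2) k.
Proof.
rewrite normal_powE; have [n nk] := ubnP k; elim: n k nk => // n IH [|[|k]] nk /=.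
- rewrite -normal_powE; under eq_Rintegral do rewrite expr0.
  by rewrite E_cst//; exact: probability_setT.
- by rewrite J_recursion !mul0r.
- by rewrite J_recursion IH//; lia.
Qed.

End NormalMoments.

(** * Approximation by trigonometric sums *)

Section CosineTaylor.
Context {R : realType}.

(** The primitive of the bound minus [f] vanishes at 0 and has a nonnegative
    derivative. *)
Let antiderivative_pow_le_pos (f df : R -> R) n :
  (forall t : R, is_derive t 1 f (df t)) -> f 0 = 0 ->
  (forall t, 0 <= t -> df t <= t ^+ n / n`!%:R) ->
  forall u, 0 < u -> f u <= u ^+ n.+1 / n.+1`!%:R.
Proof.
move=> fdf f0 dfn u u0; pose h (t : R) := t ^+ n.+1 / n.+1`!%:R - f t.
have hd (t : R) : is_derive t 1 h (t ^+ n / n`!%:R - df t).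
  rewrite (_ : h = (@id R) ^+ n.+1 * cst (n.+1`!%:R^-1) - f); last first.
    by apply/funext => z; rewrite /h !fctE.
  apply: is_derive_eq; rewrite /GRing.scale /= !fctE mulr0 add0r mulr1.
  congr (_ - _); rewrite factS natrM.
  have : (n`!%:R : R) != 0 by rewrite pnatr_eq0 -lt0n fact_gt0.
  have : (n.+1%:R : R) != 0 by rewrite pnatr_eq0.
  by move: (n.+1%:R : R) (n`!%:R : R) => x y x0 y0; field; rewrite ?x0 ?y0.
have [|c + e] := MVT u0 (fun t _ => hd t).
  apply: continuous_subspaceT => t.
  by apply: differentiable_continuous; apply/derivable1_diffP; case: (hd t).
rewrite in_itv/= => /andP[c0 cu].
rewrite -subr_ge0 (_ : _ - _ = h u - h 0); last first.
  by rewrite /h f0 expr0n mul0r !subr0.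
by rewrite e subr0 mulr_ge0 ?(ltW u0)// subr_ge0 dfn// ltW.
Qed.

Let antiderivative_pow_le (f df : R -> R) n :
  (forall t : R, is_derive t 1 f (df t)) -> f 0 = 0 ->
  (forall t, `|df t| <= `|t| ^+ n / n`!%:R) ->
  forall u, `|f u| <= `|u| ^+ n.+1 / n.+1`!%:R.
Proof.
have pos (g dg : R -> R) : (forall t : R, is_derive t 1 g (dg t)) -> g 0 = 0 ->
    (forall t, `|dg t| <= `|t| ^+ n / n`!%:R) ->
    forall u, 0 < u -> `|g u| <= `|u| ^+ n.+1 / n.+1`!%:R.
  move=> gdg g0 dgn u u0; rewrite (gtr0_norm u0) ler_norml; apply/andP; split.
    rewrite lerNl; apply: (@antiderivative_pow_le_pos (\- g) (\- dg)) => //=.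
    - by rewrite g0 oppr0.
    - by move=> t t0; have := dgn t; rewrite (ger0_norm t0) ler_norml => /andP[]; lra.
  apply: (@antiderivative_pow_le_pos g dg) => // t t0.
  by have := dgn t; rewrite (ger0_norm t0) ler_norml => /andP[].
move=> fdf f0 dfn u; have [u0|u0|->] := ltgtP u 0; last first.
- by rewrite f0 !normr0 mulr_ge0 ?exprn_ge0.
- exact: (pos f df).
rewrite -[u]opprK [X in _ <= X / _](_ : _ = `|- u| ^+ n.+1); last by rewrite opprK normrN.
apply: (pos (f \o -%R) (fun t => df (- t) * -1)); rewrite /=.
- by rewrite oppr0.
- by move=> t; rewrite mulrN1 normrN (le_trans (dfn _))// normrN.
- by rewrite oppr_gt0.
Qed.

(** The [k]-th derivative of [cos] at [b] is [cos (b + k pi / 2)]. *)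
Definition cos_coef (b : R) (k : nat) : R := cos (b + k%:R * (pi / 2)) / k`!%:R.

(** By induction on the order, because the derivative of the remainder of order
    [n.+1] with phase [b] is the remainder of order [n] with phase [b + pi / 2]. *)
Lemma cos_taylor n b u :
  `|cos (u + b) - \sum_(k < n) cos_coef b k * u ^+ k| <= `|u| ^+ n / n`!%:R.
Proof.
elim: n b u => [|n IH] b u.
  rewrite big_ord0 subr0 expr0 fact0 divr1 ler_norml.
  by rewrite cos_geN1 cos_le1.
pose f (u : R) := cos (u + b) - \sum_(k < n.+1) cos_coef b k * u ^+ k.
pose df (u : R) := cos (u + (b + pi / 2)) - \sum_(k < n) cos_coef (b + pi / 2) k * u ^+ k.
apply: (@antiderivative_pow_le f df).
- move=> t; rewrite (_ : f = (cos \o (@id R + cst b)) -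
     \sum_(k < n.+1) (cst (cos_coef b k) * (@id R) ^+ k)); last first.
    apply/funext => z; rewrite /f !fctE fct_sumE; congr (_ - _).
    by apply: eq_bigr => k _; rewrite !fctE.
  apply: is_derive_eq; rewrite /GRing.scale /= !fctE /df.
  rewrite addr0 mulr1 addrA cosDpihalf; congr (_ - _).
  rewrite big_ord_recl /= !mul0r !mulr0 !addr0 add0r.
  apply: eq_bigr => i _; rewrite mulr0 addr0 mulr1 mulrA; congr (_ * _).
  rewrite /cos_coef (_ : b + _ = b + pi / 2 + i%:R * (pi / 2)).
    rewrite factS natrM invfM -mulrA; congr (_ * _).
    by rewrite mulrAC mulVf ?mul1r// pnatr_eq0.
  by rewrite /bump /= ?add1n -natr1; ring.
- rewrite /f big_ord_recl /= expr0 mulr1 add0r big1 ?addr0.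
    by rewrite /cos_coef mul0r addr0 fact0 divr1 subrr.
  by move=> i _; rewrite expr0n mulr0.
- by move=> t; exact: IH.
Qed.

Lemma cos_lipschitz (x y : R) : `|cos x - cos y| <= `|x - y|.
Proof.
have := cos_taylor 1 y (x - y); rewrite subrK big_ord1 expr0 mulr1 expr1 divr1.
by rewrite /cos_coef mul0r addr0 fact0 divr1.
Qed.

End CosineTaylor.

Section Bernstein.
Context {R : realType}.
Implicit Types (h : nat -> R) (x : R).

(** The mean of [h (k + S)] for [S] binomial with parameters [n] and [x], that
    is, a Bernstein polynomial; conditioning on the first trial gives a form in
    which positivity, degree and second moment are immediate. *)
Fixpoint bernstein h (n k : nat) x : R :=
  if n is n'.+1 then x * bernstein h n' k.+1 x + (1 - x) * bernstein h n' k x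
  else h k.

Lemma bernstein_le h g n k x : 0 <= x <= 1 -> (forall j, h j <= g j) ->
  bernstein h n k x <= bernstein g n k x.
Proof.
move=> /andP[x0 x1] hg; elim: n k => [|n IH] k //=.
by rewrite lerD// ler_wpM2l// subr_ge0.
Qed.

Lemma bernstein_lin h a b n k x :
  bernstein (fun j => a + b * h j) n k x = a + b * bernstein h n k x.
Proof. by elim: n k => //= n IH k; rewrite !IH; ring. Qed.

Lemma bernstein_sqr a n k x : bernstein (fun j => (j%:R - a) ^+ 2) n k x =
  (k%:R + n%:R * x - a) ^+ 2 + n%:R * x * (1 - x).
Proof.
elim: n k => [|n IH] k /=; first by rewrite !mul0r !addr0.
by rewrite !IH -!natr1; ring.
Qed.

Lemma bernstein_bound h D n k x : 0 <= x <= 1 -> (forall j, `|h j| <= D) ->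
  `|bernstein h n k x| <= D.
Proof.
move=> /andP[x0 x1] hD; elim: n k => [|n IH] k //=.
have x1' : 0 <= 1 - x by rewrite subr_ge0.
rewrite (le_trans (ler_normD _ _))// !normrM (ger0_norm x0) (ger0_norm x1').
rewrite (@le_trans _ _ (x * D + (1 - x) * D))//; last by lra.
by apply: lerD; apply: ler_wpM2l.
Qed.

(** Chebyshev's inequality for the binomial law: far from [x] the function is only
    known to be bounded, but the frequency is there with probability at most
    [1 / (dl ^ 2 * n)]. *)
Lemma bernstein_approx (G : R -> R) D e dl n x : 0 <= x <= 1 -> 0 < dl ->
  (0 < n)%N -> (forall y, `|G y| <= D) ->
  (forall y, `|y - x| < dl -> `|G y - G x| <= e) ->
  `|bernstein (fun j => G (j%:R / n%:R)) n 0 x - G x| <=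
    e + 2 * D / (dl ^+ 2 * n%:R).
Proof.
move=> x01 dl0 n0 GD Ge; have /andP[x0 x1] := x01.
have nR : (0 : R) < n%:R by rewrite ltr0n.
have e0 : 0 <= e by rewrite (le_trans _ (Ge x _))// subrr normr0.
have D0 : 0 <= D by rewrite (le_trans _ (GD 0)).
pose c := 2 * D / (dl ^+ 2 * n%:R ^+ 2).
have c0 : 0 <= c by rewrite /c divr_ge0 ?mulr_ge0 ?exprn_ge0 ?(ltW dl0)//.
have key (j : nat) : `|G (j%:R / n%:R) - G x| <= e + c * (j%:R - n%:R * x) ^+ 2.
  have [hd|hd] := ltP `|j%:R / n%:R - x| dl.
    by rewrite (le_trans (Ge _ hd))// lerDl mulr_ge0 ?sqr_ge0.
  apply: (@le_trans _ _ (2 * D)).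
    by rewrite (le_trans (ler_normB _ _))//; have := GD (j%:R / n%:R); have := GD x; lra.
  apply: (@le_trans _ _ (c * (j%:R - n%:R * x) ^+ 2)); last by rewrite lerDr.
  rewrite /c mulrAC ler_pdivlMr ?mulr_gt0 ?exprn_gt0// ler_wpM2l ?mulr_ge0//.
  rewrite -exprMn -[leRHS]real_normK ?num_real//.
  rewrite lerXn2r ?nnegrE ?mulr_ge0 ?(ltW dl0)//.
  rewrite (_ : j%:R - n%:R * x = (j%:R / n%:R - x) * n%:R); last first.
    by rewrite mulrBl divfK ?gt_eqF// mulrC.
  by rewrite normrM (gtr0_norm nR) ler_pM2r.
have sq : bernstein (fun j => (j%:R - n%:R * x) ^+ 2) n 0 x <= n%:R.
  rewrite bernstein_sqr add0r subrr expr0n add0r -mulrA -[leRHS]mulr1.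
  by rewrite ler_wpM2l//; have := mulr_ge0 x0 x0; lra.
have ub : e + c * bernstein (fun j => (j%:R - n%:R * x) ^+ 2) n 0 x <=
    e + 2 * D / (dl ^+ 2 * n%:R).
  rewrite lerD2l (le_trans (ler_wpM2l c0 sq))// /c le_eqVlt; apply/orP; left.
  by apply/eqP; field; rewrite !gt_eqF.
have GE : bernstein (fun j => G (j%:R / n%:R)) n 0 x - G x =
   bernstein (fun j => - G x + 1 * G (j%:R / n%:R)) n 0 x.
  by rewrite bernstein_lin; ring.
rewrite GE ler_norml; apply/andP; split.
  rewrite lerNl (le_trans _ ub)//.
  rewrite [leLHS](_ : _ = bernstein (fun j => G x + (-1) * G (j%:R / n%:R)) n 0 x); last first.
    by rewrite !bernstein_lin; ring.
  rewrite -bernstein_lin; apply: bernstein_le => // j.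
  by rewrite (le_trans _ (key j))// -normrN (le_trans _ (ler_norm _))//; lra.
rewrite (le_trans _ ub)// -bernstein_lin; apply: bernstein_le => // j.
by rewrite (le_trans _ (key j))// (le_trans _ (ler_norm _))//; lra.
Qed.

End Bernstein.

Section TrigonometricApproximation.
Context {R : realType}.

(** The phases make sines available and the class closed under products. *)
Inductive trig_sum : (R -> R) -> Prop :=
| trig_sum_cos a b : trig_sum (fun y => cos (a * y + b))
| trig_sum_lin c h g : trig_sum h -> trig_sum g ->
    trig_sum (fun y => c * h y + g y).

Lemma trig_sum_cst c : trig_sum (fun=> c).
Proof.
have h := trig_sum_lin (c - 1) (trig_sum_cos 0 0) (trig_sum_cos 0 0).
rewrite (_ : (fun=> c) = fun y => (c - 1) * cos (0 * y + 0) + cos (0 * y + 0))//.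
by apply/funext => y; rewrite mul0r addr0 cos0; ring.
Qed.

Lemma trig_sum_mul_cos h a b : trig_sum h ->
  trig_sum (fun y => cos (a * y + b) * h y).
Proof.
elim=> [a' b'|c h1 h2 _ IH1 _ IH2]; last first.
  rewrite (_ : (fun y => _) = fun y => c * (cos (a * y + b) * h1 y) +
     cos (a * y + b) * h2 y); first exact: trig_sum_lin.
  by apply/funext => y; ring.
rewrite (_ : (fun y => _) = fun y => 2^-1 * cos ((a + a') * y + (b + b')) +
   (2^-1 * cos ((a - a') * y + (b - b')) + 0)).
  apply: trig_sum_lin; first exact: trig_sum_cos.
  by apply: trig_sum_lin; [exact: trig_sum_cos|exact: trig_sum_cst].
apply/funext => y.
rewrite (_ : (a + a') * y + (b + b') = (a * y + b) + (a' * y + b')); last by ring.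
rewrite (_ : (a - a') * y + (b - b') = (a * y + b) - (a' * y + b')); last by ring.
by move: (a * y + b) (a' * y + b') => u v; rewrite cosD cosB; field.
Qed.

Lemma trig_sum_bernstein H n k a : trig_sum
  (fun y => bernstein H n k ((1 + sin (a * y)) / 2)).
Proof.
elim: n k => [|n IH] k /=; first exact: trig_sum_cst.
pose p k y := bernstein H n k ((1 + sin (a * y)) / 2).
rewrite (_ : (fun y => _) = fun y => 2^-1 * p k.+1 y + (2^-1 * p k y +
   (2^-1 * (cos (a * y + - (pi / 2)) * p k.+1 y) +
   (- 2^-1 * (cos (a * y + - (pi / 2)) * p k y) + 0)))).
  by do 4 (apply: trig_sum_lin; [by try apply: trig_sum_mul_cos; exact: IH|]);
    exact: trig_sum_cst.
by apply/funext => y; rewrite cosBpihalf /p; field.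
Qed.

Lemma uniform_continuity_01 (G : R -> R) (e : R) : continuous G -> 0 < e ->
  exists2 dl, 0 < dl & forall x y, 0 <= x <= 1 -> `|y - x| < dl ->
    `|G y - G x| <= e.
Proof.
move=> cG e0.
have /compact_near_coveringP := @segment_compact R 0 1.
move=> /(_ R (0 : R)^'+ (fun dl x => forall y, `|y - x| < dl -> `|G y - G x| <= e)).
move=> []; last first.
  move=> dl /= dl0 hdl; exists (dl / 2); first by rewrite divr_gt0.
  move=> x y x01; apply: (hdl (dl / 2)) => /=; rewrite ?in_itv//=.
  - by rewrite sub0r normrN gtr0_norm ?divr_gt0//; lra.
  - by rewrite divr_gt0.
move=> x _.
have e20 : 0 < e / 2 by rewrite divr_gt0.
have /cvgrPdist_le/(_ _ e20) [r /= r0 hr] := cG x.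
have r20 : 0 < r / 2 by rewrite divr_gt0.
exists (ball x (r / 2), [set dl | dl < r / 2]).
  split; first exact: nbhsx_ballx.
  by apply: nbhs_right_lt.
move=> [z dl] /= [xz dlr] y yz.
have zx : `|x - z| < r by move: xz; rewrite /ball /=; lra.
have yx : `|x - y| < r.
  rewrite (_ : x - y = (x - z) - (y - z)); last by ring.
  by rewrite (le_lt_trans (ler_normB _ _))//; move: xz; rewrite /ball /=; lra.
rewrite (_ : G y - G z = (G x - G z) - (G x - G y)); last by ring.
by rewrite (le_trans (ler_normB _ _))//; have := hr _ zx; have := hr _ yx; lra.
Qed.

(** On [-A, A] the function [y |-> sin (y / A)] is injective, hence every
    continuous function is there a continuous function of [sin (y / A)], which
    Bernstein polynomials approximate. *)
Lemma trig_sum_approx (g : R -> R) (D A e : R) : continuous g ->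
  (forall y, `|g y| <= D) -> 0 < A -> 0 < e ->
  exists h, [/\ trig_sum h, (forall y, `|h y| <= D) &
    forall y, `|y| <= A -> `|h y - g y| <= e].
Proof.
move=> cg gD A0 e0.
pose sg := sin 1 : R.
have pi1 : (1 : R) < pi / 2.
  have : (1 : R) <= pi / 2 := pihalf_ge1 R; rewrite le_eqVlt => /orP[/eqP h|//].
  have := cos1_gt0 R; by rewrite h cos_pihalf ltxx.
have sinmono : {in `[- (pi / 2), pi / 2] &, {mono (@sin R) : x y / x <= y}}.
  by move=> x y xI yI; rewrite !leNgt ltr_sin.
have in1 (z : R) : `|z| <= 1 -> z \in `[- (pi / 2), pi / 2].
  by rewrite ler_norml in_itv/= => /andP[z1 z2]; apply/andP; split; lra.
have sg0 : 0 <= sg by rewrite /sg -sin0 sinmono ?in1 ?normr0 ?normr1.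
have sg1 : -1 < sg < 1.
  apply/andP; split; first by lra.
  rewrite /sg -[ltRHS]sin_pihalf ltr_sin ?(in1 1) ?normr1// in_itv/= lexx andbT.
  by move: pi1; lra.
(* Clamping keeps the argument of [asin] away from the ends of its domain, and
   changes nothing for [|y| <= A], where [|sin (y / A)| <= sin 1]. *)
pose clamp (z : R) := Num.max (- sg) (Num.min sg z).
have cclamp : continuous clamp.
  move=> z; apply: (@continuous_max R R^o (cst (- sg)) (fun z => Num.min sg z)).
    exact: cvg_cst.
  by apply: (@continuous_min R R^o (cst sg) id); [exact: cvg_cst|exact: cvg_id].
have clampI z : -1 < clamp z < 1.
  by rewrite /clamp lt_max gt_max gt_min; apply/andP; split; [apply/orP; left; lra|apply/andP; split; [lra|apply/orP; left; lra]].
pose G x := g (A * asin (clamp (2 * x - 1))).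
have cG : continuous G.
  have c1 : continuous (fun x : R => 2 * x - 1).
    by move=> x; apply: cvgB; [apply: cvgMl_tmp; exact: cvg_id|exact: cvg_cst].
  have c2 : continuous (fun x : R => clamp (2 * x - 1)).
    by move=> x; exact: continuous_comp (c1 x) (cclamp _).
  have c3 : continuous (fun x : R => asin (clamp (2 * x - 1))).
    by move=> x; exact: continuous_comp (c2 x) (continuous_asin (clampI _)).
  have c4 : continuous (fun x : R => A * asin (clamp (2 * x - 1))).
    by move=> x; apply: cvgMl_tmp; exact: c3.
  by move=> x; exact: continuous_comp (c4 x) (cg _).
have e20 : 0 < e / 2 by rewrite divr_gt0.
have [dl dl0 Gdl] := uniform_continuity_01 cG e20.
have D0 : 0 <= D by rewrite (le_trans _ (gD 0)).
pose n := (Num.truncn (4 * D / (dl ^+ 2 * e))).+1.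
exists (fun y => bernstein (fun j => G (j%:R / n%:R)) n 0 ((1 + sin (A^-1 * y)) / 2)).
have t01 (y : R) : 0 <= (1 + sin y) / 2 <= 1.
  by have := sin_geN1 y; have := sin_le1 y; lra.
split.
- exact: trig_sum_bernstein.
- by move=> y; apply: bernstein_bound => [|j]; [exact: t01|exact: gD].
move=> y yA.
have yA1 : `|A^-1 * y| <= 1.
  by rewrite normrM gtr0_norm ?invr_gt0// mulrC ler_pdivrMr ?mul1r.
have Gy : G ((1 + sin (A^-1 * y)) / 2) = g y.
  rewrite /G (_ : 2 * _ - 1 = sin (A^-1 * y)); last by field.
  have [h1 h2] : - sg <= sin (A^-1 * y) /\ sin (A^-1 * y) <= sg.
    have mN1 : (-1 : R) \in `[- (pi / 2), pi / 2] by rewrite in1// normrN normr1.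
    have m1 : (1 : R) \in `[- (pi / 2), pi / 2] by rewrite in1// normr1.
    have my := in1 _ yA1; move: yA1; rewrite ler_norml => /andP[y1 y2].
    by rewrite /sg -sinN; split; rewrite sinmono.
  rewrite /clamp (min_idPr h2) (max_idPr h1) sinK ?in1//.
  by rewrite mulVKf// gt_eqF.
have hG := @bernstein_approx _ G D (e / 2) dl n _ (t01 _) dl0 isT (fun z => gD _)
  (fun z hz => Gdl _ _ (t01 (A^-1 * y)) hz).
rewrite -Gy (le_trans hG)//.
have nR : 4 * D / (dl ^+ 2 * e) < n%:R by exact: truncnS_gt.
have n0 : (0 : R) < n%:R by rewrite ltr0n.
suff : 2 * D / (dl ^+ 2 * n%:R) <= e / 2 by lra.
rewrite ler_pdivrMr ?mulr_gt0 ?exprn_gt0//.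
move: nR; rewrite ltr_pdivrMr ?mulr_gt0 ?exprn_gt0//.
by rewrite (_ : e / 2 * (dl ^+ 2 * n%:R) = n%:R * (dl ^+ 2 * e) / 2); [lra|field].
Qed.

End TrigonometricApproximation.

(** * The method of moments *)

Section CenteredNormal.
Context {R : realType}.
Variable s : R.

Lemma centered_normal_integrable_pow k :
  (centered_normal s).-integrable setT (EFin \o (fun x => x ^+ k)).
Proof.
rewrite /centered_normal; case: eqVneq => [_|s0]; last exact: integrable_normal_pow.
have mX : measurable_fun setT (fun x : R => x ^+ k) by exact: measurable_funX.
apply/integrableP; split; first exact/measurable_EFinP.
rewrite integral_dirac//; last by do 2 apply: measurableT_comp => //.
by rewrite diracT mul1e ltry.
Qed.

Lemma centered_normal_moment k :
  Rintegral (centered_normal s) setT (fun x => x ^+ k) = gauss_moment (s ^+ 2) k.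
Proof.
rewrite /centered_normal; case: eqVneq => [->|s0]; last exact: normal_moment.
have mX : measurable_fun setT (fun x : R => x ^+ k) by exact: measurable_funX.
rewrite /Rintegral integral_dirac//; last exact/measurable_EFinP.
rewrite diracT mul1e /= expr0n.
by case: k {mX} => [|[|k]] //=; rewrite expr0n /= mulr0 mul0r.
Qed.

End CenteredNormal.

Lemma gauss_moment_even {R : realType} (v : R) m :
  gauss_moment v (2 * m) / (2 * m)`!%:R = (v / 2) ^+ m / m`!%:R.
Proof.
elim: m => [|m IH]; first by rewrite muln0 expr0.
rewrite (_ : (2 * m.+1)%N = (2 * m).+2); last by lia.
rewrite /= exprS !factS !natrM.
have e : (2 * m).+2%:R = 2 * m.+1%:R :> R by rewrite -natrM; congr (_%:R); lia.
have f0 : ((2 * m)`!%:R : R) != 0 by rewrite pnatr_eq0 -lt0n fact_gt0.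
have g0 : (m`!%:R : R) != 0 by rewrite pnatr_eq0 -lt0n fact_gt0.
have h0 : ((2 * m).+1%:R : R) != 0 by rewrite pnatr_eq0.
have k0 : (m.+1%:R : R) != 0 by rewrite pnatr_eq0.
rewrite e; move: IH f0 g0 h0 k0.
move: (gauss_moment _ _) (_`!%:R) (m`!%:R) (_.+1%:R) (m.+1%:R) (_ ^+ m).
move=> G f g h k V IH f0 g0 h0 k0.
have -> : V = G / f * g by rewrite IH divfK.
by field; rewrite f0 g0 h0 k0.
Qed.

(** Since the even moment of order [2 m] is [v ^ m (2m)! / (2 ^ m m!)], the
    remainders are terms of exponential series. *)
Lemma gauss_tail_small {R : realType} (v a e : R) : 0 < e ->
  exists m, `|a| ^+ (2 * m) / (2 * m)`!%:R * (gauss_moment v (2 * m) + 1) <= e.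
Proof.
move=> e0; have e20 : 0 < e / 2 by rewrite divr_gt0.
have /cvgrPdist_le/(_ _ e20) [N1 _ h1] := @cvg_exp_coeff R (a ^+ 2 * v / 2).
have /cvgrPdist_le/(_ _ e20) [N2 _ h2] := @cvg_exp_coeff R `|a|.
exists (maxn N1 N2); set m := maxn N1 N2.
have {}h1 := h1 m (leq_maxl _ _).
have {}h2 : `|0 - exp_coeff `|a| (2 * m)| <= e / 2.
  by apply: h2 => /=; rewrite (leq_trans (leq_maxr N1 N2))// leq_pmull.
rewrite sub0r normrN /exp_coeff in h1; rewrite sub0r normrN /exp_coeff in h2.
rewrite mulrDr mulr1 (_ : e = e / 2 + e / 2); last by lra.
apply: lerD; last by rewrite (le_trans (ler_norm _)).
rewrite mulrAC -mulrA gauss_moment_even exprM real_normK ?num_real//.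
rewrite mulrA -exprMn mulrA (le_trans (ler_norm _))//.
Qed.

Section CosineExpectation.
Context {R : realType} {d : measure_display} {X : measurableType d}.
Variable Q : {measure set X -> \bar R}.
Hypothesis Q1 : Q setT = 1%E.
Local Notation E f := (Rintegral Q setT f).
Local Notation int f := (Q.-integrable setT (EFin \o f)).

Lemma bm_cos (Z : X -> R) a b : measurable_fun setT Z ->
  bounded_measurable (fun x => cos (a * Z x + b)).
Proof.
move=> mZ; apply: (@bm_comp _ _ _ (fun y => cos (a * y + b))) => //.
  apply: measurableT_comp => //; first exact: (continuous_measurable_fun (@continuous_cos R)).
  by apply: measurable_funD => //; apply: measurable_funM.
by exists 1 => y; rewrite ler_norml cos_geN1 cos_le1.
Qed.

Lemma E_cos_taylor (Z : X -> R) a b m : measurable_fun setT Z ->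
  (forall k, int (fun x => Z x ^+ k)) ->
  `|E (fun x => cos (a * Z x + b))
    - \sum_(k < 2 * m) cos_coef b k * a ^+ k * E (fun x => Z x ^+ k)|
  <= `|a| ^+ (2 * m) / (2 * m)`!%:R * E (fun x => Z x ^+ (2 * m)).
Proof.
move=> mZ iZ.
have ic : int (fun x => cos (a * Z x + b)).
  by apply: bm_integrable => //; exact: bm_cos.
have is_ : int (fun x => \sum_(k < 2 * m) cos_coef b k * a ^+ k * Z x ^+ k).
  by apply: int_sum => // k; exact: intZ.
have -> : \sum_(k < 2 * m) cos_coef b k * a ^+ k * E (fun x => Z x ^+ k) =
    E (fun x => \sum_(k < 2 * m) cos_coef b k * a ^+ k * Z x ^+ k).
  by rewrite E_sum//; [apply: eq_bigr => k _; rewrite E_Z|move=> k; exact: intZ].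
rewrite -E_B// -E_Z//; apply: E_norm_le => //.
- have := intD ic (intZ (-1) is_).
  by apply: eq_integrable => // x _; rewrite /= mulN1r.
- exact: intZ.
move=> x; have := cos_taylor (2 * m) b (a * Z x).
rewrite normrM exprMn mulrAC => h.
have -> : Z x ^+ (2 * m) = `|Z x| ^+ (2 * m).
  by rewrite !exprM real_normK ?num_real.
apply: le_trans h; rewrite le_eqVlt; apply/orP; left; apply/eqP.
by congr (`|_ - _|); apply: eq_bigr => k _; rewrite exprMn mulrA.
Qed.

End CosineExpectation.

Lemma trig_sum_bm {R : realType} {d} {X : measurableType d} (Z : X -> R) h :
  measurable_fun setT Z -> trig_sum h -> bounded_measurable (fun x => h (Z x)).
Proof.
move=> mZ; elim=> [a b|c h1 h2 _ IH1 _ IH2]; first exact: bm_cos.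
by apply: bmD => //; apply: bmM.
Qed.

Lemma measurable_comp_continuous {R : realType} {d} {X : measurableType d}
    (Z : X -> R) (g : R -> R) : measurable_fun setT Z -> continuous g ->
  measurable_fun setT (fun x => g (Z x)).
Proof.
move=> mZ cg; apply: (measurableT_comp _ mZ).
exact: continuous_measurable_fun.
Qed.

Section MethodOfMoments.
Context {R : realType} {d : measure_display} {X : measurableType d}.
Variable Q : {measure set X -> \bar R}.
Hypothesis Q1 : Q setT = 1%E.
Variables (Y : nat -> X -> R) (s : R).
Hypothesis bmY : forall n, bounded_measurable (Y n).

Local Notation E f := (Rintegral Q setT f).
Local Notation L := (centered_normal s).
Local Notation EL f := (Rintegral L setT f).

(** Convergence of moments is only required of processes close to [Y] in L2, which
    may depend on the order of the moments and on the precision. *)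
Hypothesis approx : forall (p : nat) (e : R), 0 < e ->
  exists Y' : nat -> X -> R, [/\ (forall n, bounded_measurable (Y' n)),
    (forall k, (k <= p)%N -> \forall n \near \oo,
       `|E (fun x => Y' n x ^+ k) - gauss_moment (s ^+ 2) k| <= e) &
    \forall n \near \oo, E (fun x => (Y n x - Y' n x) ^+ 2) <= e].

Let L1 : L setT = 1%E. Proof. exact: probability_setT. Qed.
Let id_meas : measurable_fun setT (id : R -> R). Proof. exact: measurable_id. Qed.
Let v0 : 0 <= s ^+ 2. Proof. exact: sqr_ge0. Qed.
Local Hint Resolve bmY : core.

(** Taylor polynomials of the cosine reduce characteristic functions to moments;
    the Lipschitz bound transfers the result from [Y'] to [Y]. *)
Let cvg_cos a b : E (fun x => cos (a * Y n x + b)) @[n --> \oo] -->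
  EL (fun y => cos (a * y + b)).
Proof.
apply/cvgrPdist_le => e e0.
have e40 : 0 < e / 4 by rewrite divr_gt0.
have [m hm] := gauss_tail_small (s ^+ 2) a e40.
pose A := \sum_(k < 2 * m) `|cos_coef b k * a ^+ k|.
have A0 : 0 <= A by apply: sumr_ge0.
have A10 : 0 < A + 1 by rewrite ltr_wpDl.
(* [eta] bounds the moment errors weighted by [A] and, as a tolerance for the
   L2 distance, it is calibrated against the Lipschitz constant [|a|]. *)
pose t := e / (4 * (`|a| + 1)).
have t0 : 0 < t by rewrite divr_gt0// mulr_gt0// ltr_wpDl.
pose eta := Num.min 1 (Num.min (e / 4 / (A + 1)) (t ^+ 2)).
have eta0 : 0 < eta by rewrite !lt_min ltr01 !divr_gt0// exprn_gt0.
have [Y' [bY' hY' dY']] := approx (2 * m) eta0.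
have near_all : \forall n \near \oo, forall k : 'I_(2 * m).+1,
    `|E (fun x => Y' n x ^+ k) - gauss_moment (s ^+ 2) k| <= eta.
  apply: filter_forall => k; apply: hY'; exact: ltn_ord k.
near=> n.
have hk (k : nat) : (k <= 2 * m)%N ->
    `|E (fun x => Y' n x ^+ k) - gauss_moment (s ^+ 2) k| <= eta.
  move=> km; have h : forall k : 'I_(2 * m).+1,
    `|E (fun x => Y' n x ^+ k) - gauss_moment (s ^+ 2) k| <= eta by near: n.
  exact: (h (Ordinal (km : (k < (2 * m).+1)%N))).
have hd : E (fun x => (Y n x - Y' n x) ^+ 2) <= eta by near: n.
have iY' k : Q.-integrable setT (EFin \o (fun x => Y' n x ^+ k)).
  by apply: bm_integrable => //; exact: bmX.
have T1 := E_cos_taylor Q1 a b m (bY' n).1 iY'.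
have T2 : `|EL (fun y => cos (a * y + b)) -
      \sum_(k < 2 * m) cos_coef b k * a ^+ k * gauss_moment (s ^+ 2) k|
    <= `|a| ^+ (2 * m) / (2 * m)`!%:R * gauss_moment (s ^+ 2) (2 * m).
  have := E_cos_taylor L1 a b m id_meas (centered_normal_integrable_pow s).
  rewrite centered_normal_moment; congr (`|_ - _| <= _).
  by apply: eq_bigr => k _; rewrite centered_normal_moment.
set PL := \sum_(k < _) _ in T2; set PY := \sum_(k < _) _ in T1.
have tail0 : 0 <= `|a| ^+ (2 * m) / (2 * m)`!%:R by rewrite divr_ge0 ?exprn_ge0.
have b1 : `|E (fun x => cos (a * Y' n x + b)) - PY| <= e / 4.
  rewrite (le_trans T1)// (le_trans _ hm)// ler_wpM2l//.
  have h1 := hk (2 * m)%N (leqnn _); have h2 : eta <= 1 by rewrite ge_min lexx.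
  by have := le_trans (ler_norm _) h1; lra.
have b2 : `|EL (fun y => cos (a * y + b)) - PL| <= e / 4.
  rewrite (le_trans T2)// (le_trans _ hm)// ler_wpM2l//.
  by rewrite lerDl.
have b3 : `|PL - PY| <= e / 4.
  rewrite /PL /PY -sumrB (le_trans (ler_norm_sum _ _ _))//.
  apply: (@le_trans _ _ (A * eta)).
    rewrite /A mulr_suml; apply: ler_sum => k _; rewrite -mulrBr normrM.
    by rewrite ler_wpM2l// distrC hk// ltnW.
  have h3 : eta <= e / 4 / (A + 1) by rewrite !ge_min lexx orbT.
  rewrite (le_trans (ler_wpM2l A0 h3))// mulrA ler_pdivrMr//.
  by rewrite mulrC ler_wpM2l ?(ltW e40)// lerDl.
have b4 : `|E (fun x => cos (a * Y n x + b)) - E (fun x => cos (a * Y' n x + b))|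
    <= e / 4.
  have c1 := @bm_cos _ _ _ (Y n) a b (bmY n).1.
  have c2 := @bm_cos _ _ _ (Y' n) a b (bY' n).1.
  rewrite -E_B; try exact: bm_integrable.
  pose G x := `|a| * ((2 * t)^-1 * (Y n x - Y' n x) ^+ 2 + t / 2).
  have bG : bounded_measurable G.
    by apply: bmM => //; apply: bmD => //; apply: bmM => //; apply: bmX; exact: bmB.
  apply: (@le_trans _ _ (E G)).
    apply: E_norm_le; [exact/bm_integrable/bmB|exact: bm_integrable|].
    move=> x; rewrite (le_trans (cos_lipschitz _ _))//.
    rewrite (_ : _ - _ = a * (Y n x - Y' n x)); last by ring.
    rewrite normrM /G ler_wpM2l//.
    set u := Y n x - Y' n x; rewrite -[u ^+ 2]real_normK ?num_real//.
    have : 0 <= (`|u| - t) ^+ 2 by exact: sqr_ge0.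
    move: `|u| => w h.
    rewrite -subr_ge0 (_ : _ - _ = (w - t) ^+ 2 / (2 * t)); last by field; rewrite gt_eqF.
    by rewrite divr_ge0// mulr_ge0// ltW.
  rewrite /G E_Z; last first.
    by apply: bm_integrable => //; apply: bmD => //; apply: bmM => //; apply: bmX; exact: bmB.
  rewrite E_D; try (apply: bm_integrable => //); last first.
    by apply: bmM => //; apply: bmX; exact: bmB.
  rewrite E_Z ?E_cst//; last by apply: bm_integrable => //; apply: bmX; exact: bmB.
  have h4 : eta <= t ^+ 2 by rewrite !ge_min lexx !orbT.
  apply: (@le_trans _ _ (`|a| * ((2 * t)^-1 * t ^+ 2 + t / 2))).
    have i0 : 0 <= (2 * t)^-1 by rewrite invr_ge0 mulr_ge0// ltW.
    apply: ler_wpM2l => //; rewrite lerD2r; apply: ler_wpM2l => //.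
    by rewrite (le_trans hd).
  rewrite (_ : (2 * t)^-1 * t ^+ 2 + t / 2 = t); last by field; rewrite gt_eqF.
  rewrite /t mulrA ler_pdivrMr ?mulr_gt0 ?ltr_wpDl//.
  rewrite (_ : e / 4 * (4 * (`|a| + 1)) = (`|a| + 1) * e); last by field.
  by rewrite ler_wpM2r ?(ltW e0)// lerDl.
rewrite (_ : _ - _ = (EL (fun y => cos (a * y + b)) - PL) + (PL - PY)
  - (E (fun x => cos (a * Y' n x + b)) - PY)
  - (E (fun x => cos (a * Y n x + b)) - E (fun x => cos (a * Y' n x + b)))); last by ring.
move: b1 b2 b3 b4.
move: (EL _ - PL) (PL - PY) (E _ - PY) (E _ - E _) => z1 z2 z3 z4 b1 b2 b3 b4.
rewrite (le_trans (ler_normB _ _))//; have := ler_normB (z1 + z2) z3.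
by have := ler_normD z1 z2; lra.
Unshelve. all: by end_near. Qed.

Let cvg_trig h : trig_sum h -> E (fun x => h (Y n x)) @[n --> \oo] --> EL h.
Proof.
elim=> [a b|c h1 h2 t1 IH1 t2 IH2]; first exact: cvg_cos.
have i1 := bm_integrable L1 (trig_sum_bm id_meas t1).
have i2 := bm_integrable L1 (trig_sum_bm id_meas t2).
rewrite E_D//; last exact: intZ.
rewrite E_Z//.
rewrite (_ : (fun n => _) = fun n =>
  c * E (fun x => h1 (Y n x)) + E (fun x => h2 (Y n x))).
  by apply: cvgD => //; apply: cvgMl_tmp.
apply/funext => n.
have j1 := bm_integrable Q1 (trig_sum_bm (bmY n).1 t1).
have j2 := bm_integrable Q1 (trig_sum_bm (bmY n).1 t2).
by rewrite E_D// ?E_Z//; exact: intZ.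
Qed.

Let second_moment_bounded : exists2 V, 0 <= V &
  \forall n \near \oo, E (fun x => Y n x ^+ 2) <= V.
Proof.
have [Y' [bY' hY' dY']] := approx 2 (@ltr01 R).
exists (2 * (s ^+ 2 + 1) + 2); first by rewrite addr_ge0// mulr_ge0// addr_ge0.
near=> n.
have h2 : `|E (fun x => Y' n x ^+ 2) - gauss_moment (s ^+ 2) 2| <= 1.
  by near: n; exact: hY'.
have hd : E (fun x => (Y n x - Y' n x) ^+ 2) <= 1 by near: n.
have b1 : bounded_measurable (fun x => Y' n x ^+ 2) by exact: bmX.
have b2 : bounded_measurable (fun x => (Y n x - Y' n x) ^+ 2).
  by apply: bmX; exact: bmB.
apply: (@le_trans _ _ (E (fun x => 2 * Y' n x ^+ 2 + 2 * (Y n x - Y' n x) ^+ 2))).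
  apply: E_le; try (apply: bm_integrable => //).
  - exact: bmX.
  - by apply: bmD; apply: bmM.
  move=> x; rewrite -subr_ge0 (_ : _ - _ = (Y n x - 2 * Y' n x) ^+ 2) ?sqr_ge0//.
  by ring.
rewrite E_D; try (by apply: intZ; exact: bm_integrable).
rewrite !E_Z; try exact: bm_integrable.
have := le_trans (ler_norm _) h2; rewrite /= !mulr1 mul1r => h3.
by lra.
Unshelve. all: by end_near. Qed.

(** Chebyshev's inequality: outside [-A, A] the functions are only known to be
    bounded. *)
Let tail_bound d' (Z : measurableType d') (W : {measure set Z -> \bar R}) (F : Z -> R)
    (g h : R -> R) (D A e V : R) :
  W setT = 1%E -> measurable_fun setT F ->
  W.-integrable setT (EFin \o (fun z => F z ^+ 2)) ->
  Rintegral W setT (fun z => F z ^+ 2) <= V -> 0 < A -> 0 <= e ->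
  continuous g -> trig_sum h ->
  (forall y, `|g y| <= D) -> (forall y, `|h y| <= D) ->
  (forall y, `|y| <= A -> `|h y - g y| <= e) ->
  `|Rintegral W setT (fun z => h (F z)) - Rintegral W setT (fun z => g (F z))|
   <= e + 2 * D / A ^+ 2 * V.
Proof.
move=> W1 mF iF FV A0 e0 cg th gD hD hg.
have D0 : 0 <= D by rewrite (le_trans _ (gD 0)).
have bh := trig_sum_bm mF th.
have bg : bounded_measurable (fun z => g (F z)).
  by split; [exact: measurable_comp_continuous|exists D].
have c0 : 0 <= 2 * D / A ^+ 2 by rewrite divr_ge0 ?mulr_ge0 ?exprn_ge0 ?(ltW A0).
rewrite -E_B//; try exact: bm_integrable.
apply: (@le_trans _ _ (Rintegral W setT (fun z => e + 2 * D / A ^+ 2 * F z ^+ 2))).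
  apply: E_norm_le => //.
  - by apply: bm_integrable => //; exact: bmB.
  - by apply: intD; [exact/bm_integrable/bm_cst|exact: intZ].
  move=> z; have [h1|h1] := leP `|F z| A.
    by rewrite (le_trans (hg _ h1))// lerDl mulr_ge0 ?sqr_ge0.
  apply: (@le_trans _ _ (2 * D)).
    by rewrite (le_trans (ler_normB _ _))//; have := gD (F z); have := hD (F z); lra.
  apply: (@le_trans _ _ (2 * D / A ^+ 2 * F z ^+ 2)); last by rewrite lerDr.
  rewrite mulrAC ler_pdivlMr ?exprn_gt0// ler_wpM2l ?mulr_ge0//.
  rewrite -[leRHS]real_normK ?num_real// lerXn2r ?nnegrE ?(ltW A0)//.
  exact: ltW.
rewrite E_D//; last 2 first.
- exact/bm_integrable/bm_cst.
- exact: intZ.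
by rewrite E_cst// E_Z// lerD2l ler_wpM2l.
Qed.

Theorem method_of_moments (g : R -> R) : continuous g -> bounded_fun g ->
  E (fun x => g (Y n x)) @[n --> \oo] --> EL g.
Proof.
move=> cg [D0 [_ gD0]].
pose D := `|D0| + 1.
have gD y : `|g y| <= D.
  by apply: gD0 => //; rewrite /D ltr_pwDr// ler_norm.
have D_ge0 : 0 <= D by rewrite addr_ge0.
have [V0 V00 hV0] := second_moment_bounded.
pose V := V0 + s ^+ 2 + 1.
have V0' : 0 < V by rewrite ltr_wpDl// addr_ge0.
apply/cvgrPdist_le => e e0.
pose A := Num.sqrt (10 * (D + 1) * V / e).
have A2 : A ^+ 2 = 10 * (D + 1) * V / e.
  by rewrite sqr_sqrtr// divr_ge0 ?(ltW e0)// !mulr_ge0 ?(ltW V0')// addr_ge0.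
have A0 : 0 < A.
  by rewrite sqrtr_gt0 divr_gt0// !mulr_gt0// ltr_wpDl.
have e50 : 0 < e / 5 by rewrite divr_gt0.
have tl : 2 * D / A ^+ 2 * V <= e / 5.
  rewrite A2 invf_div mulrA -[leRHS]mul1r.
  rewrite (_ : _ * V = D / (D + 1) * (e / 5)); last first.
    by field; rewrite (gt_eqF V0') andbT gt_eqF// ltr_wpDl.
  by rewrite ler_wpM2r ?(ltW e50)// ler_pdivrMr ?ltr_wpDl// mul1r lerDl.
have [h [th hD hg]] := trig_sum_approx cg gD A0 e50.
have /cvgrPdist_le/(_ _ e50) hcvg := cvg_trig th.
have tL := tail_bound L1 id_meas (centered_normal_integrable_pow s 2)
  _ A0 (ltW e50) cg th gD hD hg.
near=> n.
have hn : `|EL h - E (fun x => h (Y n x))| <= e / 5 by near: n.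
have hV : E (fun x => Y n x ^+ 2) <= V.
  apply: (@le_trans _ _ V0); first by near: n.
  by rewrite /V -addrA lerDl addr_ge0.
have hQ := tail_bound Q1 (bmY n).1 (bm_integrable Q1 (bmX 2 (bmY n))) hV
  A0 (ltW e50) cg th gD hD hg.
have hL : `|EL h - EL g| <= e / 5 + 2 * D / A ^+ 2 * V.
  apply: tL; rewrite centered_normal_moment /= mulr1 mul1r /V.
  by move: V00; lra.
rewrite (_ : _ - _ = - (EL h - EL g) + (EL h - E (fun x => h (Y n x))) +
  (E (fun x => h (Y n x)) - E (fun x => g (Y n x)))); last by ring.
move: hQ hn hL; move: (EL h - EL g) (EL h - _) (E _ - E _) => z1 z2 z3 hQ hn hL.
rewrite (le_trans (ler_normD _ _))//; have := ler_normD (- z1) z2; rewrite normrN.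
by lra.
Unshelve. all: by end_near. Qed.

End MethodOfMoments.

(** * The pointwise ergodic theorem *)

Section Birkhoff.
Context {R : realType} {d : measure_display} {Omega : measurableType d}.
Variables (P : probability Omega R) (sigma : Omega -> Omega).
Hypothesis sigma_meas : measurable_fun setT sigma.
Hypothesis sigma_pres : preserves P sigma.

Local Notation E f := (Rintegral P setT f).
Local Notation int f := (P.-integrable setT (EFin \o f)).

Let P1 : P setT = 1%E. Proof. exact: probability_setT. Qed.

Lemma ge0_integral_preserved (f : Omega -> \bar R) : measurable_fun setT f ->
  (forall x, 0 <= f x)%E -> (\int[P]_x f (sigma x) = \int[P]_x f x)%E.
Proof.
move=> mf f0.
have -> : (\int[P]_x f (sigma x) = \int[pushforward P sigma]_x f x)%E.
  by rewrite ge0_integral_pushforward//= preimage_setT.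
apply: eq_measure_integral => A mA _.
by exact: sigma_pres.
Qed.

Lemma integrable_preserved (f : Omega -> R) : int f -> int (fun x => f (sigma x)).
Proof.
move=> /integrableP[mf foo]; apply/integrableP; split.
  exact: (measurableT_comp mf sigma_meas).
rewrite (@ge0_integral_preserved (fun x => `|(f x)%:E|%E))//.
exact: measurableT_comp.
Qed.

Lemma E_preserved (f : Omega -> R) : int f -> E (fun x => f (sigma x)) = E f.
Proof.
move=> If; have mf := measurable_int _ If.
rewrite /Rintegral; congr fine; rewrite integralE [RHS]integralE.
rewrite -(@ge0_integral_preserved (fun x => ((EFin \o f)^\+ x)%E))//; last exact: measurable_funepos.
rewrite -(@ge0_integral_preserved (fun x => ((EFin \o f)^\- x)%E))//; last exact: measurable_funeneg.
by congr (_ - _)%E; apply: eq_integral => x _; rewrite ?funeposE ?funenegE.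
Qed.

(** The maximum of the ergodic sums of lengths 0 to [n]; starting one step later
    shifts all of these sums, hence the recursion. *)
Fixpoint running_max (g : Omega -> R) (n : nat) (w : Omega) : R :=
  if n is n'.+1 then Num.max 0 (g w + running_max g n' (sigma w)) else 0.

Definition orbit_sum (g : Omega -> R) (n : nat) (w : Omega) : R :=
  \sum_(0 <= k < n) g (iter k sigma w).

Lemma orbit_sumS g n w : orbit_sum g n.+1 w = g w + orbit_sum g n (sigma w).
Proof.
rewrite /orbit_sum big_nat_recl//=; congr (_ + _).
by apply: eq_bigr => k _; rewrite -iterSr.
Qed.

Lemma running_max_ge0 g n w : 0 <= running_max g n w.
Proof. by case: n => //= n; rewrite le_max lexx. Qed.

Lemma running_max_le g n w : running_max g n w <= running_max g n.+1 w.
Proof.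
elim: n w => [|n IH] w; first by rewrite /= le_max lexx.
rewrite [leLHS]/= [leRHS]/= ge_max le_max lexx /= le_max; apply/orP; right.
by rewrite lerD2l.
Qed.

Lemma running_max_homo g w : {homo running_max g ^~ w : m n / (m <= n)%N >-> m <= n}.
Proof.
apply: homo_leq => //; first exact: le_trans.
by move=> n; exact: running_max_le.
Qed.

Lemma orbit_sum_le_running_max g n w : orbit_sum g n w <= running_max g n w.
Proof.
elim: n w => [|n IH] w; first by rewrite /orbit_sum big_nil.
by rewrite orbit_sumS /= le_max; apply/orP; right; rewrite lerD2l.
Qed.

Lemma int_running_max g n : int g -> int (running_max g n).
Proof.
move=> Ig; elim: n => [|n IH]; first exact: integrable0.
have I1 : int (fun w => g w + running_max g n (sigma w)).
  by apply: intD => //; exact: integrable_preserved.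
apply: le_integrable (integrable_norm I1) => //=.
  apply/measurable_EFinP; apply: measurable_maxr => //.
  by apply/measurable_EFinP; exact: measurable_int I1.
move=> w _; rewrite lee_fin normr_id ger0_norm ?le_max ?lexx//.
by rewrite ge_max normr_ge0 ler_norm.
Qed.

Hypothesis sigma_erg : ergodic P sigma.

(** If the ergodic sums of [g] were unbounded on a positive (hence full) set,
    then [running_max g n.+1 - running_max g n \o sigma], whose integral is
    nonnegative, would decrease to [g]. *)
Lemma orbit_sum_bounded g : int g -> E g < 0 ->
  {ae P, forall w, exists M, forall n, orbit_sum g n w <= M}.
Proof.
move=> Ig Eg0.
have mg : measurable_fun setT g by apply/measurable_EFinP; exact: measurable_int Ig.
pose A := [set w | forall c : nat, exists n, c%:R < running_max g n w].
have mA : measurable A.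
  rewrite (_ : A = \bigcap_(c in [set: nat]) \bigcup_(n in [set: nat])
      [set w | c%:R < running_max g n w]); last first.
    apply/seteqP; split => w /=.
      by move=> h c _; have [n hn] := h c; exists n.
    by move=> h c; have [n _ hn] := h c I; exists n.
  apply: bigcapT_measurable => c; apply: bigcupT_measurable => n.
  rewrite -[X in measurable X]setTI.
  have mM : measurable_fun setT (running_max g n).
    by apply/measurable_EFinP; exact: measurable_int (int_running_max n Ig).
  have := mM measurableT `]c%:R, +oo[%classic (measurable_itv _).
  by congr (measurable (_ `&` _)); apply/seteqP; split => w /=; rewrite in_itv/= andbT.
pose cg (w : Omega) := (Num.truncn `|g w|).+1.
have cgP w : `|g w| < (cg w)%:R by exact: truncnS_gt.
have sA : sigma @^-1` A = A.
  apply/seteqP; split => w /= hA c; have [n hn] := hA (cg w + c)%N;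
    have := cgP w; have := ler_norm (g w); have := ler_norm (- g w);
    rewrite normrN natrD in hn *.
    exists n.+1 => /=; rewrite lt_max; apply/orP; right; lra.
  case: n hn => [|n] /=.
    by have := ler0n R c; have := normr_ge0 (g w); lra.
  rewrite lt_max => /orP[|hn]; first by have := ler0n R c; have := normr_ge0 (g w); lra.
  by move=> *; exists n; lra.
have [PA|PA] := sigma_erg mA sA.
  exists A; split => // w /= hw c; apply: contrapT => hc; apply: hw.
  exists c%:R => n; rewrite (le_trans (orbit_sum_le_running_max g n w))//.
  by rewrite leNgt; apply/negP => h; apply: hc; exists n.
exfalso.
pose D n w := Num.max (- running_max g n (sigma w)) (g w).
have DE n w : D n w = running_max g n.+1 w - running_max g n (sigma w).
  by rewrite /D /= addr_maxl sub0r addrK.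
have ID n : int (D n).
  rewrite (_ : D n = fun w => running_max g n.+1 w + -1 * running_max g n (sigma w)).
    by apply: intD; [exact: int_running_max|apply/intZ/integrable_preserved/int_running_max].
  by apply/funext => w; rewrite DE mulN1r.
have ED n : (0 <= \int[P]_w (D n w)%:E)%E.
  have fn : (\int[P]_w (D n w)%:E)%E \is a fin_num.
    by apply: integrable_fin_num => //; exact: ID.
  rewrite -(fineK fn) lee_fin -/(Rintegral P setT (D n)).
  rewrite (_ : D n = fun w => running_max g n.+1 w - running_max g n (sigma w)); last first.
    by apply/funext => w; exact: DE.
  rewrite E_B; [|exact: int_running_max|exact/integrable_preserved/int_running_max].
  rewrite E_preserved; last exact: int_running_max.
  rewrite subr_ge0; apply: E_le; try exact: int_running_max.
  by move=> w; exact: running_max_le.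
have PAC : P (~` A) = 0%E by rewrite probability_setC// PA subee.
have [//|||||_ _ cD] := @dominated_convergence _ _ R P setT measurableT
  (fun n => EFin \o D n) (EFin \o g) (fun w => `|(g w)%:E|%E).
- by move=> n; exact: measurable_int (ID n).
- exact/measurable_EFinP.
- exists (~` A); split => //; first exact: measurableC.
  move=> w /= hw hA; apply: hw => _; apply: cvg_near_cst.
  have hs : A (sigma w) by rewrite -[A (sigma w)]/((sigma @^-1` A) w) sA.
  have [n0 hn0] := hs (cg w); exists n0 => // n /= n0n; congr EFin.
  rewrite /D; apply/max_idPr.
  have := running_max_homo g (sigma w) n0n; have := cgP w; have := ler_norm (- g w).
  by rewrite normrN; lra.
- exact: integrable_abse Ig.
- apply: aeW => w n _; rewrite /= lee_fin /D.
  have M0 := running_max_ge0 g n (sigma w).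
  have h1 := ler_norm (g w); have h2 := normr_ge0 (g w); have h3 := ler_norm (- g w).
  rewrite normrN in h3; rewrite ler_norml le_max ge_max.
  by apply/andP; split; [apply/orP; right; lra|apply/andP; split; lra].
have : (0 <= \int[P]_w (g w)%:E)%E.
  have h : (\int[P]_w (D n w)%:E)%E @[n --> \oo] --> (\int[P]_w (g w)%:E)%E by exact: cD.
  rewrite -(cvg_lim _ h)//; apply: lime_ge; first by apply/cvg_ex; eexists; exact: h.
  by apply: nearW => n; exact: ED.
by move=> /fine_ge0; rewrite -/(Rintegral P setT g) leNgt Eg0.
Unshelve. all: by end_near. Qed.

(** The ergodic sums of [f - E f - q] and of [- f + E f - q], whose means are
    negative, are bounded above, so that the averages of [f] are eventually within
    [q] of the mean, up to a vanishing term. *)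
Theorem birkhoff f : int f ->
  {ae P, forall w, (n%:R^-1 * orbit_sum f n w) @[n --> \oo] --> E f}.
Proof.
move=> If; pose m := E f; pose q (j : nat) : R := j.+1%:R^-1.
have q0 j : 0 < q j by rewrite invr_gt0.
have Icst c : int (fun=> c) by apply: bm_integrable => //; exact: bm_cst.
have up : {ae P, forall w, forall j, exists M, forall n,
    orbit_sum (fun w => f w + (- m - q j)) n w <= M}.
  apply: ae_foralln => j; apply: orbit_sum_bounded; first exact: intD.
  by rewrite E_D// E_cst// -/m; have := q0 j; lra.
have down : {ae P, forall w, forall j, exists M, forall n,
    orbit_sum (fun w => -1 * f w + (m - q j)) n w <= M}.
  apply: ae_foralln => j; apply: orbit_sum_bounded; first by apply: intD => //; exact: intZ.
  rewrite E_D//; last exact: intZ.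
  by rewrite E_Z// E_cst// -/m; have := q0 j; lra.
apply: filterS2 up down => w up down.
apply/cvgrPdist_le => e e0.
pose j := Num.truncn (2 / e).
have qe : q j <= e / 2.
  rewrite /q -[e / 2]invrK lef_pV2 ?posrE ?invr_gt0 ?divr_gt0// invf_div.
  by rewrite ltW// truncnS_gt.
have [M1 h1] := up j; have [M2 h2] := down j.
have sumE c b n : orbit_sum (fun w => c * f w + b) n w = c * orbit_sum f n w + n%:R * b.
  rewrite /orbit_sum big_split/= mulr_sumr; congr (_ + _).
  by rewrite sumr_const_nat subn0 mulr_natl.
near=> n.
have n0 : (0 : R) < n%:R by rewrite ltr0n; near: n; exists 1%N.
have b1 : `|M1| / (e / 2) <= n%:R by near: n; exact: nbhs_infty_ger.
have b2 : `|M2| / (e / 2) <= n%:R by near: n; exact: nbhs_infty_ger.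
rewrite ler_pdivrMr ?divr_gt0// in b1; rewrite ler_pdivrMr ?divr_gt0// in b2.
have {}h1 := h1 n; have {}h2 := h2 n.
rewrite sumE in h2.
have e1 : orbit_sum (fun w => f w + (- m - q j)) n w = orbit_sum f n w + n%:R * (- m - q j).
  by rewrite -[orbit_sum f n w]mul1r -sumE; congr (orbit_sum _ n w); apply/funext => z; rewrite mul1r.
rewrite e1 in h1.
have nq : n%:R * q j <= n%:R * (e / 2) by rewrite ler_wpM2l.
rewrite -/m (_ : m - _ = n%:R^-1 * (n%:R * m - orbit_sum f n w)); last first.
  by rewrite mulrBr mulKf ?gt_eqF.
rewrite normrM (gtr0_norm (_ : 0 < n%:R^-1)) ?invr_gt0// ler_pdivrMl//.
have := ler_norm M1; have := ler_norm M2.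
by rewrite ler_norml => *; apply/andP; split; lra.
Unshelve. all: by end_near. Qed.

End Birkhoff.

(** * Decorrelation across a free scale *)

Fixpoint clusters (g : nat) (s : seq nat) : seq (seq nat) :=
  if s is x :: s' then
    if clusters g s' is c :: cs then
      if (x + g <= head 0%N c)%N then [:: x] :: c :: cs else (x :: c) :: cs
    else [:: [:: x]]
  else [::].

Section Clusters.
Implicit Types (g D : nat) (s : seq nat).

Lemma flatten_clusters g s : flatten (clusters g s) = s.
Proof.
elim: s => //= x s IH; case E: (clusters g s) IH => [|c cs] /= <- //.
by case: ifP.
Qed.

Lemma clusters_nil g s : clusters g s = [::] -> s = [::].
Proof. by move=> e; rewrite -(flatten_clusters g s) e. Qed.

Lemma clusters_neq_nil g s c : c \in clusters g s -> c != [::].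
Proof.
elim: s c => //= x s IH c; case E: (clusters g s) => [|c' cs].
  by rewrite inE => /eqP ->.
case: ifP => _; rewrite inE => /orP[/eqP -> //|h]; apply: IH; rewrite E //.
by rewrite inE h orbT.
Qed.

Lemma head_clusters g s c cs : clusters g s = c :: cs -> head 0%N c = head 0%N s.
Proof.
move=> e; have := @clusters_neq_nil g s c; rewrite e mem_head => /(_ isT).
by have <- := flatten_clusters g s; rewrite e /=; case: c {e}.
Qed.

Lemma clusters_cat g s t x y :
  (last x s + g <= y)%N ->
  clusters g (x :: s ++ y :: t) = clusters g (x :: s) ++ clusters g (y :: t).
Proof.
elim: s x => [|z s IH] x h.
  rewrite [LHS]/=; case E : (clusters g (y :: t)) => [|c cs].
    by have := clusters_nil E.
  by rewrite -/(clusters g (y :: t)) E (head_clusters E) /= h.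
rewrite cat_cons [clusters g (x :: _)]/= -/(clusters g (z :: s ++ y :: t)) IH//.
rewrite [clusters g (x :: z :: s)]/= -/(clusters g (z :: s)).
case E : (clusters g (z :: s)) => [|c cs] /=; first by have := clusters_nil E.
by case: ifP.
Qed.

Lemma sorted_clusters g s : sorted leq s ->
  sorted (fun c c' => (head 0%N c + g <= head 0%N c')%N) (clusters g s).
Proof.
elim: s => //= x s IH ss; have {}IH := IH (path_sorted ss).
case E: (clusters g s) IH => [|c cs] //= IH; case: ifP => h /=; first by rewrite h.
case: cs E IH => //= c' cs E /andP[h1 h2]; rewrite h2 andbT.
rewrite (leq_trans _ h1)// leq_add2r (head_clusters E).
by case: s ss E => //= y s /andP[].
Qed.

(** No gap has a length between [D] and [g], hence consecutive times of a cluster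
    are at distance less than [D]. *)
Lemma clusters_diameter g D s c i : sorted leq s ->
  sorted (fun x y => (y < x + D)%N || (x + g <= y)%N) s ->
  c \in clusters g s -> i \in c ->
  (head 0%N c <= i <= head 0%N c + D * size c)%N.
Proof.
elim: s c i => //= x s IH c i ss sg.
have {}IH := IH _ _ (path_sorted ss) (path_sorted sg).
case E: (clusters g s) IH => [|c' cs] IH.
  by rewrite !inE => /eqP -> /=; rewrite inE => /eqP ->; rewrite leqnn leq_addr.
case: ifP => h.
  rewrite inE => /orP[/eqP -> /=|/IH]; last exact.
  by rewrite inE => /eqP ->; rewrite leqnn leq_addr.
rewrite inE => /orP[/eqP -> /=|hc]; last by apply: IH; rewrite inE hc orbT.
rewrite inE => /orP[/eqP ->|ic]; first by rewrite leqnn leq_addr.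
have /andP[h1 h2] := IH c' i (mem_head _ _) ic.
have hh := head_clusters E.
case: s ss sg E hh {IH} => [|y s] //= /andP[xy _] /andP[yD _] _ hh.
rewrite hh in h h1 h2; rewrite h orbF in yD.
by rewrite (leq_trans xy h1)/= (leq_trans h2)// mulnS; lia.
Qed.

Lemma size_clusters g s : (size (clusters g s) <= size s)%N.
Proof.
elim: s => //= x s IH; case: (clusters g s) IH => [|c cs] //= h.
by case: ifP => _ //=; rewrite (leq_trans h).
Qed.

Lemma size_in_flatten (cs : seq (seq nat)) c :
  c \in cs -> (size c <= size (flatten cs))%N.
Proof.
elim: cs => //= c' cs IH; rewrite size_cat inE => /orP[/eqP ->|/IH h].
  by rewrite leq_addr.
by rewrite (leq_trans h)// leq_addl.
Qed.

(** Pigeonhole: fewer than [p] gaps cannot meet all of the [p] windows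
    [s 0, s 1), ..., [s (p - 1), s p). *)
Lemma free_window (sc : nat -> nat) p (G : seq nat) :
  (forall q, (sc q <= sc q.+1)%N) -> (size G < p)%N ->
  exists2 q, (q < p)%N & forall x, x \in G -> (x < sc q)%N || (sc q.+1 <= x)%N.
Proof.
elim: p sc G => // p IH sc G mono sG.
have [hn|/allPn[z zG hz]] := boolP (all (fun x => (x < sc 0%N)%N || (sc 1%N <= x)%N) G).
  by exists 0%N => // x; move/allP: hn; exact.
rewrite negb_or -!leqNgt -ltnNge in hz.
have [|/= |q qp hq] := IH (sc \o succn) [seq x <- G | (sc 1%N <= x)%N].
- by move=> q; exact: mono.
- have := count_predC (fun x => (sc 1%N <= x)%N) G; rewrite -size_filter => e.
  have : (0 < count (predC (fun x => (sc 1%N <= x)%N)) G)%N.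
    by rewrite -has_count; apply/hasP; exists z => //=; rewrite -ltnNge; case/andP: hz.
  by lia.
exists q.+1 => // x xG; have [h|h] := leqP (sc 1%N) x.
  by apply: hq; rewrite mem_filter h.
have mon : forall k, (sc 1%N <= sc k.+1)%N.
  by elim=> // k hk; rewrite (leq_trans hk).
by rewrite (leq_trans h (mon q)).
Qed.

Lemma sorted_pairmap (P : nat -> bool) x s : sorted leq (x :: s) ->
  all P (pairmap (fun a b => b - a)%N x s) ->
  path (fun a b => P (b - a)%N) x s.
Proof. by elim: s x => //= y s IH x /andP[_ ss] /andP[-> h] /=; exact: IH. Qed.

End Clusters.

Section Decorrelation.
Context {R : realType} {d : measure_display} {X : measurableType d}.
Variable Q : {measure set X -> \bar R}.
Hypothesis Q1 : Q setT = 1%E.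
Variables (Y : nat -> X -> R) (C K gamma theta : R).
Hypotheses (C1 : 1 <= C) (K1 : 1 <= K) (gamma0 : 0 < gamma) (theta0 : 0 < theta).
Hypothesis mY : forall i, measurable_fun setT (Y i).
Hypothesis YC : forall i x, `|Y i x| <= C.
Variable thr : nat -> nat -> nat.

Local Notation mm := (mixed_moment Q Y).

(** Factorisation of mixed moments over well separated blocks of times of
    diameter at most [D]: the error suffers from the growth [K ^+ D] of the norms
    of the block observables. *)
Hypothesis block_mixing : forall (g D : nat) (cs : seq (seq nat)),
  (2 <= size cs)%N -> (forall c, c \in cs -> c != [::]) ->
  (forall c i, c \in cs -> i \in c -> (head 0%N c <= i <= head 0%N c + D)%N) ->
  (forall c, c \in cs -> (thr (size cs) (head 0%N c) <= g)%N) ->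
  sorted (fun c c' => (head 0%N c + g <= head 0%N c')%N) cs ->
  `|mm (flatten cs) - \prod_(c <- cs) mm c| <=
    expR (- gamma * g%:R `^ theta) * (C * K ^+ D) ^+ size (flatten cs).

Variables (p L : nat).

Definition good_time (i : nat) : bool :=
  [forall m : 'I_p.+1, (2 <= m)%N ==> (thr m i <= L)%N].

(** Setting the process to zero at the other times makes their mixed moments
    vanish, and changes no mixed moment of good times. *)
Definition restricted (i : nat) (x : X) : R := if good_time i then Y i x else 0.

Lemma good_timeP i m : good_time i -> (2 <= m <= p)%N -> (thr m i <= L)%N.
Proof.
move=> /forallP gi /andP[m2 mp].
by have /implyP := gi (Ordinal (mp : (m < p.+1)%N)); apply.
Qed.

Lemma mixed_moment_restricted t :
  mixed_moment Q restricted t = if all good_time t then mm t else 0.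
Proof.
case: ifPn => [/allP gt|/allPn[i it bi]].
  apply: eq_Rintegral => x _; apply: eq_big_seq => i it.
  by rewrite /restricted gt.
rewrite -[RHS](E_cst Q1); apply: eq_Rintegral => x _.
apply/eqP; rewrite prodf_seq_eq0; apply/hasP; exists i => //=.
by rewrite /restricted (negbTE bi).
Qed.

Let mm_bound t : `|mm t| <= C ^+ size t.
Proof. exact: mixed_moment_bound. Qed.

Let C0 : 0 <= C. Proof. exact: le_trans ler01 C1. Qed.
Let K0 : 0 <= K. Proof. exact: le_trans ler01 K1. Qed.

Let prod_mm_bound cs : `|\prod_(c <- cs) mm c| <= C ^+ size (flatten cs).
Proof.
elim: cs => [|c cs IH]; first by rewrite big_nil normr1.
by rewrite big_cons /= size_cat exprD normrM ler_pM.
Qed.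

Let cluster_moment (g D : nat) s : (L <= g)%N -> sorted leq s -> (size s <= p)%N ->
  all good_time s ->
  sorted (fun x y => (y < x + D)%N || (x + g <= y)%N) s ->
  `|mm s - \prod_(c <- clusters g s) mm c| <=
    expR (- gamma * g%:R `^ theta) * (C * K ^+ (D * p)) ^+ p.
Proof.
move=> Lg ss sp gs sg.
have CK1 : 1 <= C * K ^+ (D * p).
  by rewrite -[leLHS]mulr1 ler_pM// -[leLHS](expr1n _ (D * p)) lerXn2r ?nnegrE.
have rhs0 : 0 <= expR (- gamma * g%:R `^ theta) * (C * K ^+ (D * p)) ^+ p.
  by rewrite mulr_ge0 ?expR_ge0// exprn_ge0// (le_trans ler01).
have [c2|c2] := ltnP 1 (size (clusters g s)); last first.
  rewrite -{1}(flatten_clusters g s); case: (clusters g s) c2 => [|c [|//]] _ /=.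
    rewrite big_nil /mixed_moment; under eq_Rintegral do rewrite big_nil.
    by rewrite E_cst// subrr normr0.
  by rewrite cats0 big_seq1 subrr normr0.
rewrite -{1}(flatten_clusters g s).
apply: le_trans (block_mixing (D := D * p) c2 _ _ _ _) _.
- by move=> c; exact: clusters_neq_nil.
- move=> c i hc ic; have /andP[-> h] := clusters_diameter ss sg hc ic.
  rewrite (leq_trans h)// leq_add2l leq_mul2l (leq_trans (size_in_flatten hc)) ?orbT//.
  by rewrite flatten_clusters.
- move=> c hc; apply: leq_trans Lg; apply: good_timeP.
    have := allP gs; apply; rewrite -(flatten_clusters g s); apply/flattenP; exists c => //.
    by case: c hc => [/clusters_neq_nil//|x c _]; rewrite mem_head.
  by rewrite c2 (leq_trans (size_clusters _ _)).
- exact: sorted_clusters.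
by rewrite ler_wpM2l ?expR_ge0// flatten_clusters ler_weXn2l.
Qed.

Let sorted_windows x s (lo hi : nat) : sorted leq (x :: s) ->
  (forall y, y \in pairmap (fun a b => b - a)%N x s -> (y < lo)%N || (hi <= y)%N) ->
  path (fun x y => (y < x + lo)%N || (x + hi <= y)%N) x s.
Proof.
move=> ss h.
have := sorted_pairmap ss (P := fun y => (y < lo)%N || (hi <= y)%N).
move=> /(_ (introT allP h)).
elim: s x ss {h} => //= y s IH x /andP[xy ss] /andP[h1 h2]; rewrite IH// andbT.
by lia.
Qed.

(** The [q]-th scale is [n ^ (l ^ q)]: the exponent [l >= 2 / theta] lets the mixing
    at one scale absorb the norms of clusters of the previous scale. *)
Let l := (Num.truncn (2 / theta)).+1.
Let scale (n q : nat) : nat := (n ^ (l ^ q))%N.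

(** [b0 * u] dominates the logarithm of the constants in front of the mixing error
    for clusters of diameter [u * p], increased by [u]. *)
Let b0 := ln (3 * C ^+ (3 * p)) + (p * p)%:R * ln K + 1.

Let scale_error (u g : nat) : (u ^ l <= g)%N -> b0 / gamma <= u%:R -> (0 < u)%N ->
  3 * C ^+ p * (expR (- gamma * g%:R `^ theta) * (C * K ^+ (u * p)) ^+ p)
    <= expR (- u%:R).
Proof.
move=> ug bu u0.
have u1 : (1 : R) <= u%:R by rewrite ler1n.
have gu : u%:R ^+ 2 <= g%:R `^ theta.
  apply: (@le_trans _ _ ((u ^ l)%:R `^ theta)); last first.
    by apply: ge0_ler_powR; rewrite ?nnegrE ?(ltW theta0)// ler_nat.
  rewrite natrX -!powR_mulrn// -powRrM ler_powR//.
  by rewrite -ler_pdivrMr// ltW// truncnS_gt.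
have Cp : 0 < 3 * C ^+ (3 * p) by rewrite mulr_gt0// exprn_gt0// (lt_le_trans ltr01).
have Kp : 0 < K by exact: lt_le_trans ltr01 K1.
apply: (@le_trans _ _ (expR (- gamma * u%:R ^+ 2) * (3 * C ^+ (3 * p)) * K ^+ (u * (p * p)))).
  rewrite (_ : 3 * C ^+ p * _ = expR (- gamma * g%:R `^ theta) *
     (3 * (C ^+ p * C ^+ p)) * K ^+ (u * (p * p))); last first.
    by rewrite exprMn -exprM mulnA; ring.
  rewrite -exprD ler_wpM2r ?exprn_ge0//; apply: ler_pM; rewrite ?expR_ge0//.
  - by rewrite mulr_ge0 ?exprn_ge0.
  - by rewrite ler_expR !mulNr lerN2 ler_wpM2l// ltW.
  - by rewrite ler_wpM2l// ler_weXn2l// addnn -mul2n leq_mul2r orbT.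
have eC : 3 * C ^+ (3 * p) = expR (ln (3 * C ^+ (3 * p))) by rewrite lnK ?posrE.
have eK k : K ^+ k = expR (k%:R * ln K) by rewrite expRM_natl lnK ?posrE.
rewrite eK [in leLHS]eC -!expRD ler_expR.
have h : b0 * u%:R <= gamma * u%:R ^+ 2.
  rewrite expr2 mulrA ler_wpM2r// -ler_pdivrMl// mulrC //.
have h2 : ln (3 * C ^+ (3 * p)) <= ln (3 * C ^+ (3 * p)) * u%:R.
  rewrite ler_peMr// ln_ge0//.
  have : 1 <= C ^+ (3 * p) by rewrite -[leLHS](expr1n _ (3 * p)) lerXn2r ?nnegrE.
  by lra.
rewrite (_ : (u * (p * p))%:R * ln K = (p * p)%:R * ln K * u%:R); last by rewrite natrM; ring.
move: h h2; rewrite /b0 !mulrDl mul1r.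
set A := ln _; set B := _ * ln K * _; set G := gamma * _ => h h2.
by rewrite mulNr -/G; move: h h2; lra.
Qed.

(** Among [p] scales one is free of gaps between the times of [s ++ t]. Cutting at
    this scale gives short clusters with long gaps between them. The distance from
    [s] to [t] exceeds every scale, so that the clusters of [s ++ t] are those of
    [s] together with those of [t]. *)
Theorem restricted_decorrelated : exists a n0, forall n, (n0 <= n)%N ->
  decorrelated Q restricted (n ^ a) (expR (- n%:R)) p.
Proof.
exists (l ^ p)%N, (maxn (maxn 1 L) (Num.truncn (b0 / gamma)).+1) => n.
rewrite !geq_max => /andP[/andP[n0 Ln] bn] s t st sep.
have e0 : 0 <= expR (- n%:R : R) by exact: expR_ge0.
rewrite !mixed_moment_restricted all_cat.
case gs: (all good_time s); last by rewrite /= mul0r subrr normr0.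
case gt: (all good_time t); last by rewrite /= mulr0 subrr normr0.
rewrite /=.
have mnil : mm [::] = 1.
  by rewrite /mixed_moment; under eq_Rintegral do rewrite big_nil; rewrite E_cst.
have sort_mm u : mm (sort leq u) = mm u.
  by apply: mixed_moment_perm; rewrite perm_sort.
have -> : mm (s ++ t) = mm (sort leq s ++ sort leq t).
  by apply: mixed_moment_perm; rewrite perm_sym; apply: perm_cat; rewrite perm_sort.
rewrite -(sort_mm s) -(sort_mm t).
have {}st : (size (sort leq s) + size (sort leq t) <= p)%N by rewrite !size_sort.
have {}gs : all good_time (sort leq s) by rewrite all_sort.
have {}gt : all good_time (sort leq t) by rewrite all_sort.
have {}sep i j : i \in sort leq s -> j \in sort leq t -> (i + n ^ (l ^ p) <= j)%N.
  by rewrite !mem_sort; exact: sep.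
have ss := sort_sorted leq_total s; have tt := sort_sorted leq_total t.
move: (sort leq s) (sort leq t) st gs gt sep ss tt => {s t sort_mm} s t.
case: s => [|x s]; first by rewrite mnil mul1r subrr normr0.
case: t => [|y t]; first by rewrite cats0 mnil mulr1 subrr normr0.
move=> st gs gt sep ss tt.
have xy : (last x s + n ^ (l ^ p) <= y)%N by apply: sep; rewrite ?mem_last ?mem_head.
have sst : sorted leq (x :: s ++ y :: t).
  rewrite /= cat_path; apply/and3P; split => //.
  exact: leq_trans (leq_addr _ _) xy.
pose G := pairmap (fun a b => b - a)%N x (s ++ y :: t).
have l0 : (0 < l)%N by [].
have scale_mono q : (scale n q <= scale n q.+1)%N.
  by rewrite /scale leq_pexp2l// expnS leq_pmull.
have scale_homo : {homo scale n : a b / (a <= b)%N >-> (a <= b)%N}.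
  exact: homo_leq leqnn leq_trans scale_mono.
have [|q qp hG] := @free_window (scale n) p G scale_mono.
  by rewrite size_pairmap size_cat -addSn.
pose u := scale n q; pose g := scale n q.+1.
have ug : (u ^ l <= g)%N by rewrite /u /g /scale -expnM expnS mulnC.
have nu : (n <= u)%N by rewrite /u -[leqLHS](expn1 n); apply: (scale_homo 0%N).
have ng : (n <= g)%N by rewrite (leq_trans nu)//; exact: scale_mono.
have u0 : (0 < u)%N by exact: leq_trans n0 nu.
have bu : b0 / gamma <= u%:R.
  by rewrite ltW// (lt_le_trans (truncnS_gt _))// ler_nat (leq_trans bn).
have gp : (g <= n ^ (l ^ p))%N by exact: (scale_homo q.+1 p qp).
have wst := sorted_windows sst hG.
have wss : path (fun x y => (y < x + u)%N || (x + g <= y)%N) x s.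
  by move: wst; rewrite cat_path => /andP[].
have wtt : path (fun x y => (y < x + u)%N || (x + g <= y)%N) y t.
  by move: wst; rewrite cat_path /= => /and3P[].
have Lg : (L <= g)%N by exact: leq_trans Ln ng.
have sp : (size (x :: s) <= p)%N := leq_trans (leq_addr _ _) st.
have tp : (size (y :: t) <= p)%N := leq_trans (leq_addl _ _) st.
have B1 := cluster_moment Lg (s := x :: s) ss sp gs wss.
have B2 := cluster_moment Lg (s := y :: t) tt tp gt wtt.
have stp : (size (x :: s ++ y :: t) <= p)%N by rewrite -cat_cons size_cat.
have gst : all good_time (x :: s ++ y :: t) by rewrite -cat_cons all_cat gs.
have B3 := cluster_moment Lg (s := x :: s ++ y :: t) sst stp gst wst.
rewrite clusters_cat in B3; last exact: leq_trans (leq_add (leqnn _) gp) xy.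
rewrite big_cat /= in B3.
have PI := prod_mm_bound (clusters g (y :: t)).
rewrite flatten_clusters in PI.
have MI := mm_bound (x :: s).
have Cle k : (k <= p)%N -> C ^+ k <= C ^+ p by move=> kp; rewrite ler_weXn2l.
have {}PI := le_trans PI (Cle _ tp); have {}MI := le_trans MI (Cle _ sp).
apply: (@le_trans _ _ (expR (- u%:R))); last by rewrite ler_expR lerN2 ler_nat.
apply: le_trans (scale_error ug bu u0).
have C1p : 1 <= C ^+ p by rewrite -[leLHS](expr1n _ p) lerXn2r ?nnegrE.
rewrite -cat_cons in B3 *.
move: B1 B2 B3 PI MI.
rewrite -/(clusters g (x :: s)) -/(clusters g (y :: t)).
set Er := expR _ * _; set a := mm (_ ++ _); set b := mm (x :: s); set c := mm (y :: t).
set A := \prod_(c <- clusters g (x :: s)) _; set B := \prod_(c <- clusters g (y :: t)) _.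
move=> B1 B2 B3 PI MI.
have Er0 : 0 <= Er by exact: le_trans B1.
rewrite (_ : a - b * c = (a - A * B) - (b - A) * B - b * (c - B)); last by ring.
have n1 := ler_normB (a - A * B - (b - A) * B) (b * (c - B)).
have n2 := ler_normB (a - A * B) ((b - A) * B).
have n3 : `|(b - A) * B| <= Er * C ^+ p by rewrite normrM ler_pM.
have n4 : `|b * (c - B)| <= C ^+ p * Er by rewrite normrM ler_pM.
have n5 : Er <= C ^+ p * Er by rewrite ler_peMl.
have -> : 3 * C ^+ p * Er = C ^+ p * Er + Er * C ^+ p + C ^+ p * Er by ring.
by lra.
Qed.

End Decorrelation.

(** * Disintegrations and their equivariance *)

Section CountablyGenerated.

(** Every open set is the union of the countably many basic open sets it contains. *)
Lemma borel_countably_generated (M : ptopologicalType) :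
  @second_countable M ->
  exists U : nat -> set (borel M),
    (@measurable _ (borel M) : set (set (borel M))) = <<s range U >>.
Proof.
move=> [B cB [Bopen Bbasis]].
have /countable_injP[f finj] := cB.
(* The basic open set numbered [n], or the empty set if there is none. *)
pose U (n : nat) : set M := [set x | exists X, [/\ B X, f X = n & X x]].
have UB X : B X -> U (f X) = X.
  move=> BX; apply/seteqP; split => [x [X' [BX' e X'x]]|x Xx]; last by exists X.
  by rewrite -(finj _ _ _ _ e)// ?inE.
have Uopen n : open (U n).
  have [[X [BX <-]]|h] := pselect (exists X, B X /\ f X = n).
    by rewrite UB//; exact: Bopen.
  rewrite (_ : U n = set0); first exact: open0.
  by apply/seteqP; split => // x [X [BX e _]]; apply: h; exists X.
exists U.
have sU : sigma_algebra setT <<s range U >> by exact: smallest_sigma_algebra.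
have oU (O : set M) : open O -> <<s range U >> O.
  move=> oO.
  rewrite (_ : O = \bigcup_(n in [set n | U n `<=` O]) U n); last first.
    apply/seteqP; split => [x Ox|x [n nO Ux]]; last exact: nO.
    have [V [BV Vx] VO] := Bbasis x O (open_nbhs_nbhs (conj oO Ox)).
    by exists (f V); rewrite /= UB.
  rewrite bigcup_mkcond.
  have [_ _ h] := sU; apply: h => n; case: ifP => _.
    by apply: sub_sigma_algebra; exists n.
  by case: sU.
apply/seteqP; split => A /= mA.
  by apply: (smallest_sub sU _ mA) => O; exact: oU.
have s2 : sigma_algebra setT (@measurable _ (borel M)) by exact: smallest_sigma_algebra.
apply: (smallest_sub s2 _ mA) => _ [n _ <-].
by apply: sub_sigma_algebra; exact: Uopen.
Qed.

(** The finite intersections of the generators form a countable pi-system, on which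
    almost sure equalities hold simultaneously. *)
Lemma ae_measure_ext {R : realType} {d d'} {Omega : measurableType d}
    {M : measurableType d'} (P : {measure set Omega -> \bar R})
    (U : nat -> set M) (mu1 mu2 : Omega -> {measure set M -> \bar R}) :
  (measurable : set (set M)) = <<s range U >> ->
  (forall w, mu1 w setT = 1%E) -> (forall w, mu2 w setT = 1%E) ->
  (forall A, measurable A -> {ae P, forall w, mu1 w A = mu2 w A}) ->
  {ae P, forall w, forall A, measurable A -> mu1 w A = mu2 w A}.
Proof.
move=> gU m1 m2 h.
pose G (t : seq nat) : set M := \big[setI/setT]_(i <- t) U i.
have mU n : measurable (U n) by rewrite gU; apply: sub_sigma_algebra; exists n.
have mG t : measurable (G t).
  by rewrite /G; elim: t => [|i t IH]; rewrite ?big_nil ?big_cons//; exact: measurableI.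
have : {ae P, forall w, forall n, mu1 w (G (odflt [::] (unpickle n))) = mu2 w (G (odflt [::] (unpickle n)))}.
  by apply: ae_foralln => n; exact: h.
apply: filterS => w hw A mA.
have hG t : mu1 w (G t) = mu2 w (G t) by have := hw (pickle t); rewrite pickleK.
apply: (measure_unique (range G) (fun=> setT)) => //.
- apply/seteqP; split => B mB.
    rewrite gU in mB; apply: smallest_sub mB; first exact: smallest_sigma_algebra.
    move=> _ [n _ <-]; apply: sub_sigma_algebra; exists [:: n] => //.
    by rewrite /G big_seq1.
  apply: smallest_sub mB; first exact: sigma_algebra_measurable.
  by move=> _ [t _ <-]; exact: mG.
- by move=> _ _ [t _ <-] [u _ <-]; exists (t ++ u) => //; rewrite /G big_cat.
- by move=> _; exists [::] => //; rewrite /G big_nil.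
- by rewrite bigcup_const//; exists 0%N.
- by move=> _ [t _ <-]; exact: hG.
- by move=> _; rewrite m1 ltry.
Qed.

End CountablyGenerated.

Section Orbits.
Context {R : realType} {d : measure_display} {Omega : measurableType d}.
Variables (P : probability Omega R) (sigma : Omega -> Omega).
Hypothesis sigma_meas : measurable_fun setT sigma.
Hypothesis sigma_pres : preserves P sigma.

(** The iterated preimages of a null set are null. *)
Lemma ae_orbit (A : Omega -> Prop) : {ae P, forall w, A w} ->
  {ae P, forall w, forall n, A (iter n sigma w)}.
Proof.
move=> hA; apply: ae_foralln; elim=> [//|n [N [mN N0 sN]]].
exists (sigma @^-1` N); split.
- by rewrite -[X in measurable X]setTI; exact: sigma_meas.
- exact: etrans (sigma_pres mN) N0.
- by move=> w; rewrite /= -iterS iterSr => h; apply: sN.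
Qed.

End Orbits.

(** The positive and negative parts have equal integrals on both sides, so that
    the identity persists when these are infinite. *)
Lemma Rintegral_image {R : realType} {d d'} {X : measurableType d}
    {Z : measurableType d'} (m : {measure set X -> \bar R})
    (n : {measure set Z -> \bar R}) (phi : X -> Z) (f : Z -> R) :
  measurable_fun setT phi -> (forall A, measurable A -> n A = m (phi @^-1` A)) ->
  measurable_fun setT f ->
  Rintegral n setT f = Rintegral m setT (fun x => f (phi x)).
Proof.
move=> mphi nm mf.
have ge0 (g : Z -> \bar R) : measurable_fun setT g -> (forall z, 0 <= g z)%E ->
    (\int[n]_z g z = \int[m]_x g (phi x))%E.
  move=> mg g0.
  rewrite -(@ge0_integral_pushforward _ _ _ _ R phi mphi m setT g)//.
  by apply: eq_measure_integral => A mA _; rewrite nm.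
have mE : measurable_fun setT (EFin \o f) by exact/measurable_EFinP.
rewrite /Rintegral; congr fine; rewrite integralE [RHS]integralE.
rewrite (ge0 (fun z => ((EFin \o f)^\+ z)%E)) ?(ge0 (fun z => ((EFin \o f)^\- z)%E))//;
  try exact: measurable_funepos; try exact: measurable_funeneg.
by congr (_ - _)%E; apply: eq_integral => x _; rewrite ?funeposE ?funenegE.
Qed.

Section KernelIntegral.
Context {R : realType} {d d'} {Omega : measurableType d} {M : measurableType d'}.
Variable mu : R.-pker Omega ~> M.

Lemma ge0_measurable_kernel_integral (k : M * Omega -> \bar R) :
  measurable_fun setT k -> (forall z, 0 <= k z)%E ->
  measurable_fun setT (fun w => \int[mu w]_x k (x, w))%E.
Proof.
move=> mk k0.
apply: (@measurable_fun_integral_finite_kernel _ _ _ _ R (fun p => k (p.2, p.1)) mu).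
  by move=> z; exact: k0.
by apply: (measurableT_comp mk); exact: measurable_fun_pair.
Qed.

Lemma measurable_kernel_Rintegral (k : M * Omega -> R) :
  measurable_fun setT k ->
  measurable_fun setT (fun w => Rintegral (mu w) setT (fun x => k (x, w))).
Proof.
move=> mk; have mE : measurable_fun setT (EFin \o k) by exact/measurable_EFinP.
rewrite /Rintegral.
apply: (measurableT_comp (fine_measurable measurableT)).
rewrite (_ : (fun w => _) = (fun w => (\int[mu w]_x ((EFin \o k)^\+ (x, w)) -
   \int[mu w]_x ((EFin \o k)^\- (x, w)))%E)); last first.
  apply/funext => w; rewrite integralE.
  by congr (_ - _)%E; apply: eq_integral => x _; rewrite ?funeposE ?funenegE.
apply: emeasurable_funB; apply: ge0_measurable_kernel_integral => //.
- exact: measurable_funepos.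
- exact: measurable_funeneg.
Qed.

End KernelIntegral.

Section Equivariance.
Context {R : realType} {d d'} {Omega : measurableType d} {M : measurableType d'}.
Variables (P : probability Omega R) (sigma : Omega -> Omega)
  (T : Omega -> M -> M) (mu : R.-pker Omega ~> M) (nu : probability (M * Omega)%type R).
Hypothesis sigma_inv : invertible_measurable sigma.
Hypothesis sigma_pres : preserves P sigma.
Hypothesis T_meas : measurable_fun setT (fun p : M * Omega => T p.2 p.1).
Hypothesis nu_pres : preserves nu (skew_product sigma T).
Hypothesis nu_disint : disintegration P mu nu.

Lemma measurable_fiber_map w : measurable_fun setT (T w).
Proof. exact: (@measurable_fun_pair1 _ _ _ _ _ _ (fun p : M * Omega => T p.2 p.1)). Qed.

Lemma measurable_skew_product : measurable_fun setT (skew_product sigma T).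
Proof.
apply: measurable_fun_pair => //.
exact: measurableT_comp sigma_inv.1 measurable_snd.
Qed.

Let preimage_fiber_meas A w : measurable A -> measurable (T w @^-1` A).
Proof. by move=> mA; rewrite -[X in measurable X]setTI; exact: measurable_fiber_map. Qed.

(** By invertibility every measurable set of the base is the preimage of some [D]
    under [sigma]; invariance of [nu] on the product of [A] and [D] says that both
    sides have the same integral over this preimage. *)
Lemma fiber_equivariance A : measurable A ->
  {ae P, forall w, mu (sigma w) A = mu w (T w @^-1` A)}.
Proof.
move=> mA; have [ms [sigma' [ms' sK s'K]]] := sigma_inv.
have m1 : measurable_fun setT (fun w => mu (sigma w) A).
  exact: (measurableT_comp (measurable_kernel mu A mA) ms).
have mAT : measurable ((fun p : M * Omega => T p.2 p.1) @^-1` A).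
  by rewrite -[X in measurable X]setTI; exact: T_meas.
have m2 : measurable_fun setT (fun w => mu w (T w @^-1` A)).
  rewrite (_ : (fun w => _) = fun w => (\int[mu w]_x
     (\1_((fun p : M * Omega => T p.2 p.1) @^-1` A) (x, w))%:E)%E).
    apply: (@ge0_measurable_kernel_integral _ _ _ _ _ mu
      (fun z => (\1_((fun p : M * Omega => T p.2 p.1) @^-1` A) z)%:E)) => //.
    by apply/measurable_EFinP; exact: measurable_indic.
  apply/funext => w.
  rewrite (_ : (fun x => _) = fun x => (\1_(T w @^-1` A) x)%:E)//.
  by rewrite integral_indic// ?setIT//; exact: preimage_fiber_meas.
have i1 : P.-integrable setT (fun w => mu (sigma w) A).
  apply/integrableP; split => //.
  apply: (@le_lt_trans _ _ (\int[P]_w (cst 1%E w))%E).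
    apply: ge0_le_integral => //.
    - by apply/(measurableT_comp _ m1); exact: abse_measurable.
    - by move=> w _; rewrite gee0_abs// -(@prob_kernel _ _ _ _ _ mu (sigma w)) le_measure ?inE.
  by rewrite integral_cst// mul1e (le_lt_trans (probability_le1 P measurableT))// ltry.
have : ae_eq P setT (fun w => mu (sigma w) A) (fun w => mu w (T w @^-1` A)).
  apply: integral_ae_eq => // E _ mE.
  pose D := sigma' @^-1` E.
  have mD : measurable D by rewrite -[X in measurable X]setTI; exact: ms'.
  have ED : E = sigma @^-1` D by rewrite /D -comp_preimage; apply/seteqP; split => w /=; rewrite sK.
  have mAD : measurable (A `*` D) by exact: measurableX.
  have mS : measurable (skew_product sigma T @^-1` (A `*` D)).
    by rewrite -[X in measurable X]setTI; exact: measurable_skew_product.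
  have e1 : (\int[P]_(w in E) mu (sigma w) A = nu (A `*` D))%E.
    rewrite nu_disint// integral_mkcond.
    rewrite -(@ge0_integral_preserved _ _ _ P sigma ms sigma_pres (fun w => mu w (ysection (A `*` D) w))).
    - apply: eq_integral => w _; rewrite patchE ED.
      have -> : (w \in sigma @^-1` D) = (sigma w \in D).
        by apply/idP/idP; rewrite !inE.
      case: ifPn => h; first by rewrite in_ysectionX.
      by rewrite notin_ysectionX// measure0.
    - rewrite (_ : (fun w => _) = (fun w => mu w A) \_ D).
        apply/(measurable_restrictT _ _).1 => //.
        by apply: measurable_funTS; exact: measurable_kernel.
      apply/funext => w; rewrite patchE; case: ifPn => h; first by rewrite in_ysectionX.
      by rewrite notin_ysectionX// measure0.
    - by move=> w; exact: measure_ge0.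
  have e2 : (\int[P]_(w in E) mu w (T w @^-1` A) =
      nu (skew_product sigma T @^-1` (A `*` D)))%E.
    rewrite nu_disint// integral_mkcond; apply: eq_integral => w _.
    rewrite patchE ysectionE; case: ifPn => h.
      rewrite inE ED in h; congr (mu w _); apply/seteqP; split => x //=.
      by move=> [].
    rewrite (_ : _ @^-1` _ = set0) ?measure0//.
    apply/seteqP; split => // x [_ /= hD].
    by move: h; rewrite ED notin_setE; apply.
  by rewrite e1 e2; exact/esym/nu_pres.
by apply: filterS => w; exact.
Qed.

Lemma ae_equivariance (U : nat -> set M) :
  (measurable : set (set M)) = <<s range U >> ->
  {ae P, forall w, forall A, measurable A -> mu (sigma w) A = mu w (T w @^-1` A)}.
Proof.
move=> gU.
pose im w := measure_function_pushforward__canonical__measure_function_Measure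
  (mu w) (measurable_fiber_map w).
have imE w A : im w A = mu w (T w @^-1` A) by [].
have := @ae_measure_ext R _ _ Omega M P U (fun w => mu (sigma w)) im gU.
have h1 w : mu (sigma w) setT = 1%E by exact: prob_kernel.
have h2 w : im w setT = 1%E by rewrite imE preimage_setT; exact: prob_kernel.
move=> /(_ h1 h2) h.
have {h} : {ae P, forall w, forall A, measurable A -> mu (sigma w) A = im w A}.
  by apply: h => A mA; have := fiber_equivariance mA; apply: filterS => w; rewrite imE.
by apply: filterS => w hw A mA; rewrite hw.
Qed.

End Equivariance.

(** * The central limit theorem for one process with random thresholds *)

Section StretchedExponentialSums.
Context {R : realType}.

Lemma sum_ltn_le (j m : nat) : (\sum_(0 <= n < m) (n < j) <= j)%N.
Proof.
elim: m => [|m IH]; first by rewrite big_geq.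
rewrite big_nat_recr//=; case: ltnP => mj; last by rewrite addn0.
rewrite addn1 (leq_trans _ mj)// ltnS -[leqRHS](subn0 m) -[leqRHS]muln1.
by rewrite -sum_nat_const_nat; apply: leq_sum => n _; exact: leq_b1.
Qed.

(** A power of order at least [2 / theta] is beaten by the exponential. *)
Lemma stretched_exp_le_inv_sqr (gamma theta : R) : 0 < gamma -> 0 < theta ->
  exists2 c, 0 <= c & forall n : nat, (0 < n)%N ->
    expR (- gamma * n%:R `^ theta) <= c / n%:R ^+ 2.
Proof.
move=> g0 t0; pose j := (Num.truncn (2 / theta)).+1.
have tj : 2 <= theta * j%:R by rewrite mulrC -ler_pdivrMr// ltW// truncnS_gt.
exists ((j%:R / gamma) ^+ j); first by rewrite exprn_ge0// divr_ge0// ltW.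
move=> n n0.
have n1 : (1 : R) <= n%:R by rewrite ler1n.
have nR : (0 : R) < n%:R by rewrite ltr0n.
have pn0 : 0 <= (n%:R : R) `^ theta by exact: powR_ge0.
have := @exprn_le_expR R j (gamma * n%:R `^ theta).
rewrite mulr_ge0 ?(ltW g0)// => /(_ isT) h.
rewrite mulNr expRN ler_pdivlMr ?exprn_gt0// mulrC ler_pdivrMr ?expR_gt0//.
apply: (@le_trans _ _ ((n%:R `^ theta) ^+ j)).
  by rewrite -!powR_mulrn// ?powR_ge0// -powRrM ler_powR.
rewrite exprMn in h; rewrite expr_div_n mulrAC ler_pdivlMr ?exprn_gt0//.
by rewrite mulrC.
Qed.

(** Telescoping, as [2 / n - 2 / n.+1] dominates [1 / n ^ 2]. *)
Lemma sum_inv_sqr_le (k l : nat) : (0 < k)%N ->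
  \sum_(k <= n < l) (n%:R ^+ 2)^-1 <= 2 / k%:R :> R.
Proof.
move=> k0; have [lk|kl] := leqP l k; first by rewrite big_geq// divr_ge0.
suff h : \sum_(k <= n < l) (n%:R ^+ 2)^-1 <= 2 / k%:R - 2 / l%:R :> R.
  by rewrite (le_trans h)// gerBl divr_ge0.
elim: l kl => // l IH; rewrite ltnS leq_eqVlt => /orP[/eqP <-|kl].
  have kR : (0 : R) < k%:R by rewrite ltr0n.
  rewrite big_nat1 -natr1 -subr_ge0.
  rewrite (_ : _ - _ = (k%:R - 1) / (k%:R ^+ 2 * (k%:R + 1))); last first.
    by field; rewrite !gt_eqF// addr_gt0.
  apply: divr_ge0; first by rewrite subr_ge0 ler1n.
  by apply: mulr_ge0; [exact: sqr_ge0|rewrite addr_ge0].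
rewrite big_nat_recr ?(ltnW kl)//= (le_trans (lerD (IH kl) (lexx _)))//.
have lR : (0 : R) < l%:R by rewrite ltr0n (leq_trans _ kl).
have l1 : (1 : R) <= l%:R by rewrite ler1n (leq_trans _ kl).
rewrite -natr1 -subr_ge0.
rewrite (_ : _ - _ = (l%:R - 1) / (l%:R ^+ 2 * (l%:R + 1))); last first.
  by field; rewrite !gt_eqF// ?addr_gt0// ltr0n.
apply: divr_ge0; first by rewrite subr_ge0.
by apply: mulr_ge0; [exact: sqr_ge0|rewrite addr_ge0].
Qed.

End StretchedExponentialSums.

Section QuenchedProcess.
Context {R : realType} {d : measure_display} {X : measurableType d}.
Variable Q : {measure set X -> \bar R}.
Hypothesis Q1 : Q setT = 1%E.
Variables (Y : nat -> X -> R) (C K gamma theta c : R).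
Hypotheses (C1 : 1 <= C) (K1 : 1 <= K) (gamma0 : 0 < gamma) (theta0 : 0 < theta).
Hypothesis c0 : 0 <= c.
Hypothesis cP : forall n : nat, (0 < n)%N ->
  expR (- gamma * n%:R `^ theta) <= c / n%:R ^+ 2.
Hypothesis mY : forall i, measurable_fun setT (Y i).
Hypothesis YC : forall i x, `|Y i x| <= C.
Variable thr : nat -> nat -> nat.

Local Notation mm := (mixed_moment Q Y).
Local Notation E f := (Rintegral Q setT f).

Hypothesis block_mixing : forall (g D : nat) (cs : seq (seq nat)),
  (2 <= size cs)%N -> (forall c, c \in cs -> c != [::]) ->
  (forall c i, c \in cs -> i \in c -> (head 0%N c <= i <= head 0%N c + D)%N) ->
  (forall j, (j.+1 < size cs)%N -> (thr (size cs) (head 0%N (nth [::] cs j)) <= g)%N) ->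
  sorted (fun c c' => (head 0%N c + g <= head 0%N c')%N) cs ->
  `|mm (flatten cs) - \prod_(c <- cs) mm c| <=
    expR (- gamma * g%:R `^ theta) * (C * K ^+ D) ^+ size (flatten cs).
Hypothesis centered : forall i, mm [:: i] = 0.

Let C0 : 0 <= C. Proof. exact: le_trans ler01 C1. Qed.

Lemma pair_moment_le i n : `|mm [:: i; i + n]| <= C ^+ 2.
Proof. by rewrite -[2%N]/(size [:: i; (i + n)%N]); exact: mixed_moment_bound. Qed.

Lemma pair_moment_decay i n : (thr 2 i <= n)%N ->
  `|mm [:: i; i + n]| <= C ^+ 2 * expR (- gamma * n%:R `^ theta).
Proof.
move=> tn; have := @block_mixing n 0 [:: [:: i]; [:: (i + n)%N]] isT.
rewrite !big_cons big_nil !centered mul0r subr0 /= expr0 mulr1 leqnn mulrC.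
apply=> //.
- by move=> s; rewrite !inE => /orP[] /eqP ->.
- by move=> s j; rewrite !inE => /orP[] /eqP -> /=; rewrite inE => /eqP ->; rewrite addn0 leqnn.
- by case.
Qed.

(** Correlations at distances between [k] and the threshold are only bounded one by
    one; those beyond the threshold are summable. *)
Definition correlation_tail (k i : nat) : R :=
  C ^+ 2 * ((if (thr 2 i <= k)%N then 0 else (thr 2 i)%:R) + 2 * c / k%:R).

Lemma correlation_tailP k l i : (0 < k)%N ->
  \sum_(k <= n < l) `|mm [:: i; i + n]| <= correlation_tail k i.
Proof.
move=> k0.
pose a (n : nat) : R := (n < thr 2 i)%N%:R; pose b (n : nat) : R := c / n%:R ^+ 2.
have term n : (k <= n < l)%N -> `|mm [:: i; i + n]| <= C ^+ 2 * (a n + b n).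
  move=> /andP[kn _]; have b0 : 0 <= b n by rewrite divr_ge0 ?exprn_ge0.
  rewrite /a; have [h|h] := ltnP n (thr 2 i).
    rewrite (le_trans (pair_moment_le _ _))// -[leLHS]mulr1 ler_wpM2l ?exprn_ge0//.
    by rewrite lerDl.
  rewrite (le_trans (pair_moment_decay h))// ler_wpM2l ?exprn_ge0// add0r.
  by rewrite cP// (leq_trans k0).
apply: (@le_trans _ _ (\sum_(k <= n < l) C ^+ 2 * (a n + b n))).
  by rewrite big_nat_cond [leRHS]big_nat_cond; apply: ler_sum => n; rewrite andbT; exact: term.
rewrite -mulr_sumr big_split/= /correlation_tail ler_wpM2l ?exprn_ge0//.
apply: lerD; last first.
  rewrite /b -mulr_sumr [2 * c]mulrC -mulrA ler_wpM2l//.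
  exact: sum_inv_sqr_le.
case: leqP => [tk|kt].
  rewrite big_nat big1// => n /andP[kn _].
  by rewrite /a ltnNge (leq_trans tk kn).
rewrite -natr_sum ler_nat.
have [kl|kl] := leqP k l; last by rewrite big_geq// ltnW.
apply: leq_trans (sum_ltn_le _ l); rewrite (@big_cat_nat _ _ _ k 0 l)//=.
exact: leq_addl.
Qed.

Lemma weighted_second_moment (w : nat -> R) N :
  E (fun x => (\sum_(0 <= i < N) w i * Y i x) ^+ 2) =
  \sum_(0 <= i < N) w i * (w i * mm [:: i; i] +
     2 * \sum_(1 <= n < N - i) w (i + n)%N * mm [:: i; (i + n)%N]).
Proof.
have bY i : bounded_measurable (Y i) by split => //; exists C.
have bS m : bounded_measurable (fun x => \sum_(0 <= i < m) w i * Y i x).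
  by apply: bm_sum => i; exact: bmM.
have mmE i j : mm [:: i; j] = E (fun x => Y i x * Y j x).
  by apply: eq_Rintegral => x _; rewrite big_cons big_seq1.
elim: N => [|N IH].
  rewrite [RHS]big_geq//; under eq_Rintegral do rewrite big_geq// expr0n.
  by rewrite E_cst.
rewrite (_ : (fun x => _) = fun x => (\sum_(0 <= i < N) w i * Y i x) ^+ 2 +
   (\sum_(0 <= i < N) (2 * w i * w N) * (Y i x * Y N x) + w N ^+ 2 * (Y N x * Y N x))); last first.
  apply/funext => x; rewrite big_nat_recr//= sqrrD.
  rewrite (_ : \sum_(0 <= i < N) 2 * w i * w N * (Y i x * Y N x) =
     (\sum_(0 <= i < N) w i * Y i x) * (w N * Y N x) *+ 2); first by ring.
  rewrite mulr_suml [RHS]mulr2n -big_split/=; apply: eq_bigr => i _.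
  by ring.
have bYY i j : bounded_measurable (fun x => Y i x * Y j x) by exact: bmM.
have bC i : bounded_measurable (fun x => 2 * w i * w N * (Y i x * Y N x)) by apply: bmM.
have bCS : bounded_measurable (fun x => \sum_(0 <= i < N) 2 * w i * w N * (Y i x * Y N x)).
  exact: bm_sum.
have bl : bounded_measurable (fun x => w N ^+ 2 * (Y N x * Y N x)) by apply: bmM.
rewrite E_D; [|exact/bm_integrable/bmX|exact/bm_integrable/bmD].
rewrite E_D; try exact: bm_integrable.
rewrite E_sum//; last by move=> i; exact: bm_integrable.
rewrite IH E_Z; last exact: bm_integrable.
rewrite [RHS]big_nat_recr//= subSn// subnn (@big_geq _ _ _ 1 1)// mulr0 addr0 mulrA -expr2 -mmE addrA.
congr (_ + _); rewrite -big_split/= big_nat [RHS]big_nat; apply: eq_bigr => i /andP[_ iN].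
rewrite E_Z; last exact: bm_integrable.
rewrite subSn ?(ltnW iN)// big_nat_recr ?subn_gt0//= subnKC ?(ltnW iN)// -mmE.
by ring.
Qed.

Definition truncated_correlations (k i : nat) : R :=
  mm [:: i; i] + 2 * \sum_(1 <= n < k) mm [:: i; (i + n)%N].

(** Beyond the truncation there are the tails, and the at most [k] times closer
    than [k] to [N], whose truncated sums extend past [N]. *)
Lemma second_moment_approx k N : (0 < k)%N ->
  `|E (fun x => psum Y (iota 0 N) x ^+ 2)
     - \sum_(0 <= i < N) truncated_correlations k i| <=
  2 * (\sum_(0 <= i < N) correlation_tail k i + k%:R ^+ 2 * C ^+ 2).
Proof.
move=> k0.
have -> : E (fun x => psum Y (iota 0 N) x ^+ 2) =
    E (fun x => (\sum_(0 <= i < N) 1 * Y i x) ^+ 2).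
  apply: eq_Rintegral => x _; rewrite /psum /index_iota subn0.
  by congr (_ ^+ 2); apply: eq_bigr => i _; rewrite mul1r.
rewrite (weighted_second_moment (fun=> 1)) -sumrB.
pose t i := correlation_tail k i + (N - i < k)%N%:R * (k%:R * C ^+ 2).
have tailge0 i : 0 <= correlation_tail k i.
  rewrite /correlation_tail mulr_ge0 ?exprn_ge0// addr_ge0//.
    by case: ifP.
  by rewrite divr_ge0// mulr_ge0.
have sum_le_k lo hi i : (hi <= k)%N -> `|\sum_(lo <= n < hi) mm [:: i; (i + n)%N]| <= k%:R * C ^+ 2.
  move=> hik; rewrite (le_trans (ler_norm_sum _ _ _))//.
  apply: (@le_trans _ _ (\sum_(lo <= n < hi) C ^+ 2)).
    by apply: ler_sum => n _; exact: pair_moment_le.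
  rewrite sumr_const_nat -[leLHS]mulr_natl ler_wpM2r ?exprn_ge0// ler_nat.
  by rewrite (leq_trans (leq_subr _ _)).
have term i : (0 <= i < N)%N ->
   `|1 * (1 * mm [:: i; i] + 2 * \sum_(1 <= n < N - i) 1 * mm [:: i; (i + n)%N])
      - truncated_correlations k i| <= 2 * t i.
  move=> /andP[_ iN]; rewrite !mul1r.
  under [X in _ + 2 * X - _]eq_bigr do rewrite mul1r.
  rewrite /truncated_correlations.
  rewrite (_ : _ - _ = 2 * (\sum_(1 <= n < N - i) mm [:: i; (i + n)%N] -
      \sum_(1 <= n < k) mm [:: i; (i + n)%N])); last by ring.
  rewrite normrM ger0_norm// ler_wpM2l// /t.
  have [h|h] := leqP k (N - i).
    rewrite mul0r addr0 (@big_cat_nat _ _ _ k 1 (N - i))//= addrAC subrr add0r.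
    rewrite (le_trans (ler_norm_sum _ _ _))//; exact: correlation_tailP.
  rewrite mul1r -[leLHS]add0r lerD// distrC.
  rewrite (@big_cat_nat _ _ _ (N - i) 1 k)//= ?subn_gt0// ?(ltnW h)// addrAC subrr add0r.
  exact: sum_le_k.
rewrite (le_trans (ler_norm_sum _ _ _))//.
apply: (@le_trans _ _ (\sum_(0 <= i < N) 2 * t i)).
  by rewrite big_nat_cond [leRHS]big_nat_cond; apply: ler_sum => i; rewrite andbT; exact: term.
rewrite -mulr_sumr ler_wpM2l// big_split/= lerD2l -mulr_suml expr2 -mulrA.
rewrite ler_wpM2r ?mulr_ge0 ?exprn_ge0// -natr_sum ler_nat big_nat_rev add0n.
apply: leq_trans (sum_ltn_le k N); rewrite big_nat [leqRHS]big_nat.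
by apply: leq_sum => i /andP[_ iN]; rewrite subKn//; case: ltnP => // h; rewrite (ltnW h).
Qed.

(** What a bad time adds to the variance of the sum over bad times: its own variance
    and its correlations with later times. *)
Definition bad_weight (p L i : nat) : R :=
  if good_time thr p L i then 0 else 1 + (thr 2 i)%:R + 2 * c.

Lemma bad_second_moment p L N :
  E (fun x => (psum Y (iota 0 N) x - psum (restricted Y thr p L) (iota 0 N) x) ^+ 2)
    <= 2 * C ^+ 2 * \sum_(0 <= i < N) bad_weight p L i.
Proof.
pose w i : R := if good_time thr p L i then 0 else 1.
have -> : E (fun x => (psum Y (iota 0 N) x - psum (restricted Y thr p L) (iota 0 N) x) ^+ 2) =
    E (fun x => (\sum_(0 <= i < N) w i * Y i x) ^+ 2).
  apply: eq_Rintegral => x _; rewrite /psum -sumrB /index_iota subn0.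
  congr (_ ^+ 2); apply: eq_bigr => i _; rewrite /restricted /w.
  by case: ifP => _; rewrite ?mul0r ?mul1r ?subrr ?subr0.
rewrite weighted_second_moment mulr_sumr; apply: ler_sum => i _.
have w01 j : 0 <= w j <= 1 by rewrite /w; case: ifP; rewrite ?lexx ?ler01.
rewrite /bad_weight {1 2}/w; case: ifP => _; first by rewrite mul0r mulr0.
rewrite !mul1r.
have h1 : mm [:: i; i] <= C ^+ 2.
  by rewrite (le_trans (ler_norm _))// -{2}[i]addn0 pair_moment_le.
have h2 : \sum_(1 <= n < N - i) w (i + n)%N * mm [:: i; (i + n)%N] <= correlation_tail 1 i.
  apply: le_trans (@correlation_tailP 1 (N - i) i isT); apply: ler_sum => n _.
  have /andP[w0 w1] := w01 (i + n)%N.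
  rewrite (le_trans (ler_norm _))// normrM (ger0_norm w0) -[leRHS]mul1r.
  by rewrite ler_wpM2r.
have h3 : correlation_tail 1 i <= C ^+ 2 * ((thr 2 i)%:R + 2 * c).
  rewrite /correlation_tail divr1 ler_wpM2l ?exprn_ge0// lerD2r.
  by case: ifP.
have h4 : 0 <= C ^+ 2 by rewrite exprn_ge0.
have -> : 2 * C ^+ 2 * (1 + (thr 2 i)%:R + 2 * c) =
  2 * C ^+ 2 + 2 * (C ^+ 2 * ((thr 2 i)%:R + 2 * c)) by ring.
by lra.
Qed.

Let y (N : nat) (w : X) : R := (Num.sqrt N%:R)^-1 * psum Y (iota 0 N) w.

Variable V : R.
Hypothesis variance_cvg : E (fun x => y N x ^+ 2) @[N --> \oo] --> V.
Hypothesis bad_sparse : forall (p : nat) (e : R), 0 < e -> exists L,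
  \forall N \near \oo, N%:R^-1 * \sum_(0 <= i < N) bad_weight p L i <= e.

Let V0 : 0 <= V.
Proof.
rewrite -(cvg_lim _ variance_cvg)//; apply: limr_ge.
  by apply/cvg_ex; exists V; exact: variance_cvg.
by apply: nearW => N; apply: E_ge0 => x; exact: sqr_ge0.
Qed.

Let bmY i : bounded_measurable (Y i).
Proof. by split => //; exists C. Qed.

Let bmy N : bounded_measurable (y N).
Proof. by apply: bmM => //; apply: bm_sum. Qed.
Local Hint Resolve bmY bmy : core.

Let inv_sqrt_sqr (N : nat) : (Num.sqrt (N%:R : R))^-1 ^+ 2 = N%:R^-1.
Proof. by rewrite exprVn sqr_sqrtr. Qed.

Let restricted_meas p L i : measurable_fun setT (restricted Y thr p L i).
Proof.
rewrite /restricted; case: (good_time thr p L i); last exact: measurable_cst.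
exact: mY.
Qed.

Let restricted_bound p L i x : `|restricted Y thr p L i x| <= C.
Proof. by rewrite /restricted; case: ifP; rewrite ?normr0. Qed.

Let gauss_moment_continuous p (e : R) : 0 < e -> exists2 rho, 0 < rho &
  forall v, `|V - v| <= rho -> forall k, (k <= p)%N ->
    `|gauss_moment v k - gauss_moment V k| <= e.
Proof.
move=> e0.
have cg k : gauss_moment v k @[v --> V] --> gauss_moment V k.
  have [n nk] := ubnP k; elim: n k nk => // n IH [|[|k]] nk /=; try exact: cvg_cst.
  apply: cvgM; first by apply: cvgMl_tmp; exact: cvg_id.
  by apply: IH; lia.
have : \forall v \near V, forall k : 'I_p.+1,
    `|gauss_moment V k - gauss_moment v k| <= e.
  apply: (@filter_forall _ _
    (fun (k : 'I_p.+1) v => `|gauss_moment V k - gauss_moment v k| <= e) (nbhs V)).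
  by move=> k; move/cvgrPdist_le : (cg k); exact.
move=> [r /= r0 hr]; exists (r / 2); first by rewrite divr_gt0.
move=> v vr k kp; rewrite distrC.
by apply: (hr v _ (Ordinal (kp : (k < p.+1)%N))); rewrite /=; lra.
Qed.

(** The sum over good times is close to the whole sum in L2, hence its variance is
    close to [V]; its moments are Gaussian because the restricted process
    decorrelates. *)
Let approximation (p : nat) (e : R) : 0 < e ->
  exists Y' : nat -> X -> R, [/\ (forall n, bounded_measurable (Y' n)),
    (forall k, (k <= p)%N -> \forall n \near \oo,
       `|E (fun x => Y' n x ^+ k) - gauss_moment (Num.sqrt V ^+ 2) k| <= e) &
    \forall n \near \oo, E (fun x => (y n x - Y' n x) ^+ 2) <= e].
Proof.
move=> e0; rewrite sqr_sqrtr//.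
have e20 : 0 < e / 2 by rewrite divr_gt0.
(* Order two is always included, for the comparison of variances. *)
pose p' := maxn p 2.
have [rho rho0 hrho] := gauss_moment_continuous p' e20.
pose eta := Num.min 1 (rho / (4 * (V + 1))).
have V1 : 0 < V + 1 by rewrite ltr_wpDl.
have eta0 : 0 < eta by rewrite lt_min ltr01 divr_gt0// mulr_gt0.
have eta_le : eta * (V + 1) <= rho / 4.
  apply: (@le_trans _ _ (rho / (4 * (V + 1)) * (V + 1))).
    by rewrite ler_wpM2r ?(ltW V1)// ge_min lexx orbT.
  by rewrite invfM mulrA divfK// gt_eqF.
pose dl := Num.min e (rho / 4 / (eta^-1 + 1)).
have ei0 : 0 < eta^-1 + 1 by rewrite addr_gt0// invr_gt0.
have dl0 : 0 < dl by rewrite lt_min e0 !divr_gt0.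
have dl_le : (eta^-1 + 1) * dl <= rho / 4.
  rewrite mulrC -ler_pdivlMr//; by rewrite ge_min lexx orbT.
have C2 : 0 < 2 * C ^+ 2 by rewrite mulr_gt0// exprn_gt0// (lt_le_trans ltr01).
have [L hL] := bad_sparse p' (divr_gt0 dl0 C2).
pose Z := restricted Y thr p' L.
have bmZ i : bounded_measurable (Z i).
  by split; [exact: restricted_meas|exists C => x; exact: restricted_bound].
pose Y' N w : R := (Num.sqrt N%:R)^-1 * psum Z (iota 0 N) w.
have bmY' N : bounded_measurable (Y' N) by apply: bmM => //; apply: bm_sum.
have close : \forall N \near \oo, E (fun x => (y N x - Y' N x) ^+ 2) <= dl.
  near=> N.
  rewrite (_ : (fun x => _) = fun x => N%:R^-1 *
      (psum Y (iota 0 N) x - psum Z (iota 0 N) x) ^+ 2); last first.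
    by apply/funext => x; rewrite /y /Y' -mulrBr exprMn inv_sqrt_sqr.
  rewrite E_Z; last by apply: bm_integrable => //; apply: bmX; apply: bmB; exact: bm_sum.
  have h1 : N%:R^-1 * \sum_(0 <= i < N) bad_weight p' L i <= dl / (2 * C ^+ 2).
    by near: N.
  have h2 := bad_second_moment p' L N.
  have iN : (0 : R) <= N%:R^-1 by rewrite invr_ge0.
  rewrite (le_trans (ler_wpM2l iN h2))// mulrCA mulrC -ler_pdivlMr//.
have [a [n0 hdec]] : exists a n0, forall n, (n0 <= n)%N ->
    decorrelated Q Z (n ^ a) (expR (- n%:R)) p'.
  apply: (restricted_decorrelated Q1 C1 K1 gamma0 theta0 mY YC _ p' L).
  move=> g D cs s2 nn dd tt ss; apply: block_mixing => // j jcs.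
  by apply: tt; rewrite mem_nth// ltnW.
have Zcentered i : mixed_moment Q Z [:: i] = 0.
  by rewrite mixed_moment_restricted//; case: ifP.
have v_close : \forall N \near \oo, `|V - E (fun x => Y' N x ^+ 2)| <= rho.
  near=> N.
  have hd : E (fun x => (y N x - Y' N x) ^+ 2) <= dl by near: N.
  have hV : `|V - E (fun x => y N x ^+ 2)| <= Num.min 1 (rho / 4).
    near: N; move/cvgrPdist_le : variance_cvg; apply.
    by rewrite lt_min ltr01 divr_gt0.
  move: hV; rewrite le_min => /andP[hV1 hV2].
  have bd : bounded_measurable (fun x => (y N x - Y' N x) ^+ 2).
    by apply: bmX; exact: bmB.
  have by2 : bounded_measurable (fun x => y N x ^+ 2) by exact: bmX.
  have by2' : bounded_measurable (fun x => Y' N x ^+ 2) by exact: bmX.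
  (* Young's inequality with weight [eta] compares the second moments. *)
  have key : `|E (fun x => Y' N x ^+ 2) - E (fun x => y N x ^+ 2)| <= rho / 4 + rho / 4.
    rewrite -E_B; try exact: bm_integrable.
    apply: (@le_trans _ _ (E (fun x => eta * y N x ^+ 2 + (eta^-1 + 1) * (y N x - Y' N x) ^+ 2))).
      apply: E_norm_le.
      - by apply: bm_integrable => //; exact: bmB.
      - by apply: intD; apply: intZ; exact: bm_integrable.
      move=> x; set u := y N x; set w := u - Y' N x.
      rewrite (_ : Y' N x = u - w); last by rewrite /w; ring.
      have id1 : eta * u ^+ 2 + eta^-1 * w ^+ 2 - 2 * u * w = eta^-1 * (eta * u - w) ^+ 2.
        by field; rewrite gt_eqF.
      have id2 : eta * u ^+ 2 + eta^-1 * w ^+ 2 + 2 * u * w = eta^-1 * (eta * u + w) ^+ 2.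
        by field; rewrite gt_eqF.
      have i0 : 0 <= eta^-1 by rewrite invr_ge0 ltW.
      have p1 := mulr_ge0 i0 (sqr_ge0 (eta * u - w)).
      have p2 := mulr_ge0 i0 (sqr_ge0 (eta * u + w)).
      have p3 := sqr_ge0 w.
      rewrite (_ : (u - w) ^+ 2 - u ^+ 2 = w ^+ 2 - 2 * u * w); last by ring.
      rewrite ler_norml mulrDl mul1r; apply/andP; split.
        by rewrite -id2 in p2; lra.
      by rewrite -id2 in p2; lra.
    rewrite E_D; try by (apply: intZ; exact: bm_integrable).
    rewrite !E_Z; try exact: bm_integrable.
    apply: lerD.
      apply: le_trans eta_le; rewrite ler_wpM2l ?(ltW eta0)//.
      by have := le_trans (ler_norm _) (eq_ind _ (fun z => z <= 1) hV1 _ (distrC _ _)); lra.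
    by apply: le_trans dl_le; rewrite ler_wpM2l ?(ltW ei0).
  rewrite (_ : V - _ = (V - E (fun x => y N x ^+ 2)) -
     (E (fun x => Y' N x ^+ 2) - E (fun x => y N x ^+ 2))); last by ring.
  by rewrite (le_trans (ler_normB _ _))//; lra.
have v_bound : \forall N \near \oo, E (fun x => Y' N x ^+ 2) <= V + rho.
  near=> N; have : `|V - E (fun x => Y' N x ^+ 2)| <= rho by near: N.
  by rewrite ler_norml => /andP[]; lra.
exists Y'; split => //.
  move=> k kp; have kp' : (k <= p')%N by rewrite (leq_trans kp)// leq_maxl.
  have := moments_asymptotically_gaussian Q1 C1 (restricted_meas p' L)
    (restricted_bound p' L) hdec Zcentered v_bound kp'.
  move=> /cvgrPdist_le/(_ _ e20) hk.
  near=> N.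
  have h1 : `|0 - (E (fun x => Y' N x ^+ k) - gauss_moment (E (fun x => Y' N x ^+ 2)) k)| <= e / 2.
    by near: N.
  have h2 : `|V - E (fun x => Y' N x ^+ 2)| <= rho by near: N.
  have h3 := hrho _ h2 k kp'.
  rewrite sub0r normrN in h1.
  rewrite (_ : _ - _ = (E (fun x => Y' N x ^+ k) - gauss_moment (E (fun x => Y' N x ^+ 2)) k) +
    (gauss_moment (E (fun x => Y' N x ^+ 2)) k - gauss_moment V k)); last by ring.
  by rewrite (le_trans (ler_normD _ _))//; lra.
near=> N; have : E (fun x => (y N x - Y' N x) ^+ 2) <= dl by near: N.
by move=> h; rewrite (le_trans h)// ge_min lexx.
Unshelve. all: by end_near. Qed.

Theorem quenched_clt (g : R -> R) : continuous g -> bounded_fun g ->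
  E (fun x => g (y N x)) @[N --> \oo] -->
  Rintegral (centered_normal (Num.sqrt V)) setT g.
Proof. by move=> cg bg; exact: method_of_moments approximation g cg bg. Qed.

End QuenchedProcess.

(** * The process over a point of the base *)

Section Fiber.
Context {R : realType} {d d'} {Omega : measurableType d} {M : measurableType d'}.
Variables (sigma : Omega -> Omega)
  (T : Omega -> M -> M) (mu : R.-pker Omega ~> M) (B : functionBanachAlgebra R M).
Hypothesis T_meas : measurable_fun setT (fun p : M * Omega => T p.2 p.1).
Variable f : Omega -> B.
Variable C : R.
Hypothesis C1 : 1 <= C.
Hypothesis f_norm : forall w, `|f w| <= C.
Hypothesis f_bound : forall w, {ae mu w, forall x, `|fba_eval B (f w) x| <= C}.
Hypothesis f_centered : forall w, (\int[mu w]_x fba_eval B (f w) x)%R = 0.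
Variables (K gamma theta : R).
Hypotheses (K1 : 1 <= K) (gamma0 : 0 < gamma) (theta0 : 0 < theta).
Variable Nstar : nat -> Omega -> nat.

Local Notation ev := (fba_eval B).

Definition equivariant_at (w : Omega) : Prop :=
  forall A, measurable A -> mu (sigma w) A = mu w (T w @^-1` A).

Definition composition_bounded_at (w : Omega) : Prop :=
  forall h : B, exists2 g : B, ev g = ev h \o T w & `|g| <= K * `|h|.

Definition mixing_at (w : Omega) : Prop :=
  forall m, (2 <= m)%N -> forall (h : nat -> B) (k : nat -> nat),
    k 0%N = 0%N ->
    (forall j, (j.+1 < m)%N -> (k j <= k j.+1)%N) ->
    (forall j, (j.+1 < m)%N ->
       (Nstar m (iter (k j) sigma w) <= k j.+1 - k j)%N) ->
    `| (\int[mu w]_x (\prod_(j < m) ev (h j) (cocycle sigma T (k j) w x)))%R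
       - \prod_(j < m) (\int[mu (iter (k j) sigma w)]_x ev (h j) x)%R |
    <= expR (- gamma * min_gap m theta k) * \prod_(j < m) `|h j|.

Lemma cocycle_add m n w x : cocycle sigma T (m + n) w x =
  cocycle sigma T n (iter m sigma w) (cocycle sigma T m w x).
Proof. by elim: n => [|n IH]; rewrite ?addn0// addnS /= IH addnC iterD. Qed.

Lemma measurable_cocycle n w : measurable_fun setT (cocycle sigma T n w).
Proof.
elim: n => [|n IH] /=; first exact: measurable_id.
exact: (measurableT_comp (measurable_fiber_map T_meas _) IH).
Qed.

Variable w : Omega.
Hypothesis equivariant_orbit : forall n, equivariant_at (iter n sigma w).
Hypothesis composition_orbit : forall n, composition_bounded_at (iter n sigma w).
Hypothesis mixing_orbit : forall n, mixing_at (iter n sigma w).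

Local Notation s n := (iter n sigma w).

Lemma cocycle_equivariant m n A : measurable A ->
  mu (s (n + m)) A = mu (s m) (cocycle sigma T n (s m) @^-1` A).
Proof.
elim: n A => [//|n IH] A mA; rewrite addSn /= equivariant_orbit// IH ?iterD//.
by rewrite -[X in measurable X]setTI; exact: measurable_fiber_map.
Qed.

Lemma Rintegral_cocycle m n (h : M -> R) : measurable_fun setT h ->
  Rintegral (mu (s m)) setT (fun x => h (cocycle sigma T n (s m) x)) =
  Rintegral (mu (s (n + m))) setT h.
Proof.
move=> mh; apply/esym/Rintegral_image => //; first exact: measurable_cocycle.
by move=> A; exact: cocycle_equivariant.
Qed.

Definition fiber_process (n : nat) (x : M) : R :=
  ev (f (s n)) (cocycle sigma T n w x).

(** The observables are bounded only up to null sets; truncation makes the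
    bound hold everywhere without changing any integral. *)
Definition truncated_process (n : nat) (x : M) : R :=
  Num.max (- C) (Num.min C (fiber_process n x)).

Lemma measurable_fiber_process n : measurable_fun setT (fiber_process n).
Proof. exact: (measurableT_comp (fba_measurable (f (s n))) (measurable_cocycle n w)). Qed.

Lemma measurable_truncated_process n : measurable_fun setT (truncated_process n).
Proof.
apply: measurable_maxr; first exact: measurable_cst.
by apply: measurable_minr; [exact: measurable_cst|exact: measurable_fiber_process].
Qed.

Lemma truncated_process_bound n x : `|truncated_process n x| <= C.
Proof.
have C0 : 0 <= C by exact: le_trans ler01 C1.
rewrite /truncated_process ler_norml le_max lexx /= ge_max ge_min lexx /= andbT.
by rewrite (le_trans _ C0)// oppr_le0.
Qed.

Lemma truncated_process_ae :
  {ae mu w, forall x, forall n, truncated_process n x = fiber_process n x}.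
Proof.
apply: ae_foralln => n.
have [Z [mZ Z0 sZ]] := f_bound (s n).
exists (cocycle sigma T n w @^-1` Z); split.
- by rewrite -[X in measurable X]setTI; exact: measurable_cocycle.
- by rewrite -[LHS](@cocycle_equivariant 0 n)// addn0.
- move=> x /=; apply: contra_notP => nZ.
  have : `|fiber_process n x| <= C.
    by apply: contrapT => h; apply: nZ; apply: sZ.
  rewrite ler_norml => /andP[h1 h2].
  by rewrite /truncated_process (min_idPr h2) (max_idPr h1).
Qed.

Local Notation X := fiber_process.
Local Notation Y := truncated_process.
Local Notation mm := (mixed_moment (mu w) Y).

Lemma Rintegral_truncated (F : (nat -> R) -> R) :
  measurable_fun setT (fun x => F (X ^~ x)) ->
  measurable_fun setT (fun x => F (Y ^~ x)) ->
  Rintegral (mu w) setT (fun x => F (Y ^~ x)) = Rintegral (mu w) setT (fun x => F (X ^~ x)).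
Proof.
move=> mX mY; congr fine; apply: ae_eq_integral => //; try exact/measurable_EFinP.
by apply: filterS truncated_process_ae => x e _ /=; congr (F _)%:E; exact/funext.
Qed.

Lemma mixed_momentE t : mm t = Rintegral (mu w) setT (fun x => \prod_(i <- t) X i x).
Proof.
apply: (Rintegral_truncated (F := fun z => \prod_(i <- t) z i)).
  by apply: measurable_prod => i _; exact: measurable_fiber_process.
by apply: measurable_prod => i _; exact: measurable_truncated_process.
Qed.

Lemma fiber_centered i : mm [:: i] = 0.
Proof.
rewrite mixed_momentE; under eq_Rintegral do rewrite big_seq1.
have := @Rintegral_cocycle 0 i (ev (f (s i))) (fba_measurable _).
by rewrite /= addn0 f_centered.
Qed.

Lemma pair_moment_corr i n : mm [:: i; i + n] = corr sigma T mu f n (s i).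
Proof.
rewrite mixed_momentE /corr.
under eq_Rintegral => x _ do rewrite big_cons big_seq1.
pose h (z : M) := corr_fun sigma T f n (s i) z.
have mh : measurable_fun setT h.
  apply: measurable_funM; first exact: fba_measurable.
  exact: (measurableT_comp (fba_measurable _) (measurable_cocycle n (s i))).
have := @Rintegral_cocycle 0 i h mh; rewrite /= addn0 => <-.
apply: eq_Rintegral => x _; rewrite /h /corr_fun /fiber_process cocycle_add.
by rewrite -iterD addnC.
Qed.

Lemma composition_iter n h (b : B) : exists2 g : B,
  ev g = ev b \o cocycle sigma T n (s h) & `|g| <= K ^+ n * `|b|.
Proof.
elim: n b => [|n IH] b; first by exists b; rewrite // expr0 mul1r.
have [g1 e1 n1] := composition_orbit (n + h) b.
have [g e n2] := IH g1.
exists g; first by rewrite e e1 /= iterD.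
rewrite (le_trans n2)// exprSr -mulrA ler_wpM2l// exprn_ge0//.
exact: le_trans ler01 K1.
Qed.

(** Each of the [i - h] steps of the dynamics costs a factor [K], and products are
    submultiplicative. The induction starts at a single time because the algebra
    may lack a unit. *)
Lemma cluster_observable D (c : seq nat) h : c != [::] ->
  (forall i, i \in c -> (h <= i <= h + D)%N) ->
  exists F : B, (forall z, ev F z = \prod_(i <- c)
      ev (f (s i)) (cocycle sigma T (i - h) (s h) z)) /\
    `|F| <= (C * K ^+ D) ^+ size c.
Proof.
have K0 : 0 <= K by exact: le_trans ler01 K1.
have one i : (h <= i <= h + D)%N -> exists F : B,
    (forall z, ev F z = ev (f (s i)) (cocycle sigma T (i - h) (s h) z)) /\
    `|F| <= C * K ^+ D.
  move=> /andP[hi iD]; have [g e n] := composition_iter (i - h) h (f (s i)).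
  exists g; split; first by move=> z; rewrite e.
  apply: (le_trans n); rewrite [leLHS]mulrC.
  apply: ler_pM => //; first exact: exprn_ge0.
  by rewrite ler_weXn2l// leq_subLR.
case: c => // i c _; elim: c i => [|j c IH] i hc.
  have [F [e n]] := one i (hc i (mem_head _ _)).
  by exists F; rewrite expr1; split=> // z; rewrite big_seq1 e.
have [F1 [e1 n1]] := one i (hc i (mem_head _ _)).
have hj i' : i' \in j :: c -> (h <= i' <= h + D)%N.
  by move=> i'c; apply: hc; rewrite inE i'c orbT.
have [F2 [e2 n2]] := IH j hj.
have [F e n] := fba_mul F1 F2.
exists F; split; first by move=> z; rewrite e e1 e2 [RHS]big_cons.
apply: (le_trans n); rewrite -[size (i :: _)]/(size (j :: c)).+1 exprS.
exact: ler_pM.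
Qed.

Lemma min_gap_ge (g m : nat) (k : nat -> nat) : (2 <= m)%N ->
  (forall j, (j.+1 < m)%N -> (g <= k j.+1 - k j)%N) ->
  g%:R `^ theta <= min_gap m theta k.
Proof.
move=> m2 hk.
have gap j : (j.+1 < m)%N -> g%:R `^ theta <= (k j.+1 - k j)%N%:R `^ theta.
  by move=> jm; rewrite ge0_ler_powR ?nnegrE ?ler0n ?(ltW theta0)// ler_nat hk.
rewrite /min_gap; apply: (big_ind (fun z => g%:R `^ theta <= z)).
- exact: gap.
- by move=> x z hx hz; rewrite le_min hx hz.
- by move=> j _; apply: gap; rewrite -ltn_predRL.
Qed.

(** Mixing from the first time of the first cluster on, applied to the observables
    of the clusters at their first times. *)
Lemma fiber_block_mixing (g D : nat) (cs : seq (seq nat)) :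
  (2 <= size cs)%N -> (forall c, c \in cs -> c != [::]) ->
  (forall c i, c \in cs -> i \in c -> (head 0%N c <= i <= head 0%N c + D)%N) ->
  (forall j, (j.+1 < size cs)%N ->
     (Nstar (size cs) (s (head 0%N (nth [::] cs j))) <= g)%N) ->
  sorted (fun c c' => (head 0%N c + g <= head 0%N c')%N) cs ->
  `|mm (flatten cs) - \prod_(c <- cs) mm c| <=
    expR (- gamma * g%:R `^ theta) * (C * K ^+ D) ^+ size (flatten cs).
Proof.
move=> m2 cs0 csD csN css.
set m := size cs in m2 csN *.
have /choice[G hG] : forall c : seq nat, exists F : B, c \in cs ->
    (forall z, ev F z = \prod_(i <- c) ev (f (s i))
        (cocycle sigma T (i - head 0%N c) (s (head 0%N c)) z)) /\
    `|F| <= (C * K ^+ D) ^+ size c.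
  move=> c; have [cc|] := boolP (c \in cs); last by exists 0.
  have [F hF] := cluster_observable (cs0 _ cc) (fun i => csD c i cc).
  by exists F.
pose c_ j := nth [::] cs j; pose h_ j := head 0%N (c_ j).
have c_in j : (j < m)%N -> c_ j \in cs by move=> jm; rewrite mem_nth.
have step j : (j.+1 < m)%N -> (h_ j + g <= h_ j.+1)%N.
  by move=> jm; have /(sortedP [::])/(_ j jm) := css.
have h0 j : (j < m)%N -> (h_ 0%N <= h_ j)%N.
  elim: j => // j IH jm; rewrite (leq_trans (IH (ltnW jm)))//.
  by rewrite (leq_trans _ (step j jm))// leq_addr.
pose k j := (h_ j - h_ 0%N)%N.
have hk j : (j < m)%N -> (k j + h_ 0%N)%N = h_ j by move=> jm; rewrite subnK// h0.
have gap j : (j.+1 < m)%N -> (g <= k j.+1 - k j)%N.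
  by move=> jm; have := step j jm; have := hk j (ltnW jm); have := hk j.+1 jm; lia.
have mono j : (j.+1 < m)%N -> (k j <= k j.+1)%N.
  by move=> jm; have := step j jm; have := hk j (ltnW jm); have := hk j.+1 jm; lia.
have iterk j : (j < m)%N -> iter (k j) sigma (s (h_ 0%N)) = s (h_ j).
  by move=> jm; rewrite -iterD hk.
have thr j : (j.+1 < m)%N -> (Nstar m (iter (k j) sigma (s (h_ 0%N))) <= k j.+1 - k j)%N.
  by move=> jm; rewrite (iterk j (ltnW jm)); exact: leq_trans (csN j jm) (gap j jm).
have := @mixing_orbit (h_ 0%N) m m2 (fun j => G (c_ j)) k (subnn _) mono thr.
have prodX c x : c \in cs -> \prod_(i <- c) X i x = ev (G c) (cocycle sigma T (head 0%N c) w x).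
  move=> cc; have [-> _] := hG c cc; apply: eq_big_seq => i ic.
  have /andP[hi _] := csD c i cc ic.
  by rewrite /fiber_process -cocycle_add subnKC.
have flat x : \prod_(i <- flatten cs) X i x =
    \prod_(j < m) ev (G (c_ j)) (cocycle sigma T (h_ j) w x).
  rewrite big_flatten (big_nth [::]) big_mkord; apply: eq_bigr => j _.
  by rewrite prodX// c_in.
have -> : (\int[mu (s (h_ 0%N))]_x \prod_(j < m)
    ev (G (c_ j)) (cocycle sigma T (k j) (s (h_ 0%N)) x))%R = mm (flatten cs).
  rewrite mixed_momentE.
  have mH : measurable_fun setT (fun x => \prod_(j < m)
      ev (G (c_ j)) (cocycle sigma T (k j) (s (h_ 0%N)) x)).
    apply: measurable_prod => j _.
    exact: (measurableT_comp (fba_measurable _) (measurable_cocycle _ _)).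
  have := @Rintegral_cocycle 0 (h_ 0%N) _ mH; rewrite /= addn0 => <-.
  apply: eq_Rintegral => x _; rewrite flat; apply: eq_bigr => j _.
  by rewrite -cocycle_add addnC hk.
have -> : \prod_(j < m) (\int[mu (iter (k j) sigma (s (h_ 0%N)))]_x ev (G (c_ j)) x)%R =
    \prod_(c <- cs) mm c.
  rewrite (big_nth [::]) big_mkord; apply: eq_bigr => j _.
  rewrite iterk// mixed_momentE.
  have := @Rintegral_cocycle 0 (h_ j) _ (fba_measurable (G (c_ j))).
  rewrite /= addn0 => <-.
  by apply: eq_Rintegral => x _; rewrite prodX// c_in.
move=> /le_trans; apply; apply: ler_pM; rewrite ?expR_ge0//.
- by apply: prodr_ge0.
- by rewrite ler_expR !mulNr lerN2 ler_wpM2l ?(ltW gamma0)// min_gap_ge.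
- rewrite -(big_mkord xpredT (fun j => `|G (c_ j)|)) -(big_nth [::] xpredT (fun c => `|G c|)).
  have : {subset cs <= cs} by [].
  elim: {1 3 4}cs => [|c cs' IH] sub; first by rewrite big_nil expr0.
  rewrite big_cons /= size_cat exprD; apply: ler_pM => //.
  + by apply: prodr_ge0.
  + by have [_] := hG c (sub c (mem_head _ _)).
  + by apply: IH => c' c'in; apply: sub; rewrite inE c'in orbT.
Qed.

Lemma birkhoff_sum_psum N x : birkhoff_sum sigma T f N w x = psum X (iota 0 N) x.
Proof. by rewrite /birkhoff_sum /psum /index_iota subn0. Qed.

End Fiber.

(** * Almost everywhere estimates and measurability of limits *)

Section AlmostEverywhere.
Context {R : realType} {d} {Omega : measurableType d}.
Variable P : {measure set Omega -> \bar R}.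

Local Notation int f := (P.-integrable setT (EFin \o f)).
Local Notation E f := (Rintegral P setT f).

Lemma E_ae_eq (g h : Omega -> R) : measurable_fun setT g -> measurable_fun setT h ->
  {ae P, forall w, g w = h w} -> E g = E h.
Proof.
move=> mg mh gh; congr fine; apply: ae_eq_integral => //; try exact/measurable_EFinP.
by apply: filterS gh => w e _ /=; rewrite e.
Qed.

Lemma measurable_of_int (g : Omega -> R) : int g -> measurable_fun setT g.
Proof. by move=> /integrableP[/measurable_EFinP]. Qed.

Lemma ae_dominated_integrable (g G : Omega -> R) : measurable_fun setT g -> int G ->
  {ae P, forall w, `|g w| <= G w} -> int g.
Proof.
move=> mg IG gG; apply/integrableP; split; first exact/measurable_EFinP.
have /integrableP[mG fG] := IG.
apply: le_lt_trans fG; apply: ae_ge0_le_integral => //.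
- by apply/measurable_EFinP; apply: measurableT_comp.
- by apply/measurable_EFinP; apply: measurableT_comp => //; exact/measurable_EFinP.
- apply: filterS gG => w h _; rewrite lee_fin (le_trans h)//.
  exact: ler_norm.
Qed.

Lemma ae_E_norm_le (g G : Omega -> R) : measurable_fun setT g -> int G ->
  {ae P, forall w, `|g w| <= G w} -> `|E g| <= E G.
Proof.
move=> mg IG gG; have Ig := ae_dominated_integrable mg IG gG.
have mG := measurable_of_int IG.
pose G' w := Num.max `|g w| (G w).
have mG' : measurable_fun setT G' by apply: measurable_maxr => //; exact: measurableT_comp.
have GG' : {ae P, forall w, `|G' w| <= G w}.
  apply: filterS gG => w h; rewrite /G' (max_idPr h) ger0_norm//.
  exact: le_trans h.
rewrite (@E_ae_eq G G')//; last by apply: filterS gG => w h; rewrite /G' (max_idPr h).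
apply: E_norm_le => //; first exact: ae_dominated_integrable GG'.
by move=> w; rewrite /G' le_max lexx.
Qed.

Lemma E_dominated_cvg0 (u : nat -> Omega -> R) (G : Omega -> R) :
  (forall n, measurable_fun setT (u n)) -> int G ->
  (forall n w, `|u n w| <= G w) -> (forall w, u n w @[n --> \oo] --> 0) ->
  E (u n) @[n --> \oo] --> 0.
Proof.
move=> mu IG uG u0.
have := @dominated_cvg _ _ _ P setT measurableT (fun n w => (u n w)%:E) (cst 0%E) (EFin \o G).
move=> /(_ (fun n => (measurable_EFinP _ _).2 (mu n))).
have h1 x : setT x -> (u n x)%:E @[n --> \oo] --> (0%R : R)%:E.
  by move=> _; apply: cvg_EFin; [exact: nearW|exact: u0].
move=> /(_ h1 (fun x _ => isT) IG (fun n x _ => uG n x)).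
by rewrite integral0 => /fine_cvgP[_].
Qed.

End AlmostEverywhere.

Section MeasurableLimit.
Context {R : realType} {d} {Omega : measurableType d}.

(** The limit operator takes a fixed default value where the sequence diverges,
    so that measurability also requires that of the set of convergence. *)
Lemma measurable_limn (u : nat -> Omega -> R) :
  (forall n, measurable_fun setT (u n)) ->
  measurable_fun setT (fun w => limn (u ^~ w)).
Proof.
move=> mu; pose b w := `[< cvgn (u ^~ w) >].
have mb : measurable_fun setT b.
  apply: (measurable_fun_bool true); rewrite setTI.
  rewrite (_ : _ @^-1` _ = \bigcap_k \bigcup_m \bigcap_n
     [set w | `|u (m + n)%N w - u m w| <= k.+1%:R^-1]).
    apply: bigcapT_measurable => k; apply: bigcupT_measurable => m.
    apply: bigcapT_measurable => n.
    have mD : measurable_fun setT (fun w => `|u (m + n)%N w - u m w|).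
      by apply: measurableT_comp => //; exact: measurable_funB.
    rewrite (_ : [set w | _] = setT `&` (fun w => `|u (m + n)%N w - u m w|) @^-1` `]-oo, k.+1%:R^-1]).
      exact: mD.
    by apply/seteqP; split => w /=; rewrite in_itv/=; [move=> h; split|case].
  apply/seteqP; split => w /=.
    move=> /asboolP /cvg_ex[l /cvgrPdist_le ul] k _.
    have k0 : 0 < (k.+1%:R : R)^-1 / 2 by rewrite divr_gt0.
    have [m _ hm] := ul _ k0; exists m => // n _ /=.
    rewrite (_ : _ - _ = (l - u m w) - (l - u (m + n)%N w)); last by ring.
    rewrite (le_trans (ler_normB _ _))// [leRHS]splitr lerD//; apply: hm => //=.
    exact: leq_addr.
  move=> h; apply/asboolP/cauchy_cvgP/cauchyP => e e0.
  have [k ke] : exists k, k.+1%:R^-1 < e.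
    by have [k _ hk] := near_infty_natSinv_lt (PosNum e0); exists k; apply: (hk k) => /=.
  have [m _ hm] := h k I; exists (u m w), m => // i /= mi.
  have := hm (i - m)%N I; rewrite /= subnKC// /ball /= distrC.
  by move=> /le_lt_trans; apply.
rewrite (_ : (fun w => _) = fun w => if b w then (if b w then limn (u ^~ w) else 0) else point); last first.
  apply/funext => w; rewrite /b; case: asboolP => // h.
  by rewrite dvgP.
apply: measurable_fun_ifT => //.
apply: (@measurable_fun_cvg _ _ _ _ (fun n w => if b w then u n w else 0)).
  by move=> n; apply: measurable_fun_ifT.
move=> w _; rewrite /b; case: asboolP => h; [exact: h|exact: cvg_cst].
Qed.

End MeasurableLimit.

(** * Ergodic averages of correlations and of bad times *)

Section CorrelationAverages.
Context {R : realType} {d} {Omega : measurableType d}.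
Variables (P : probability Omega R) (sigma : Omega -> Omega).
Hypothesis sigma_meas : measurable_fun setT sigma.
Hypothesis sigma_pres : preserves P sigma.
Hypothesis sigma_erg : ergodic P sigma.
Variables (C c : R) (Nstar : nat -> Omega -> nat).
Hypotheses (C1 : 1 <= C) (c0 : 0 <= c).

Local Notation int f := (P.-integrable setT (EFin \o f)).
Local Notation E f := (Rintegral P setT f).
Local Notation thr w := (fun m i => Nstar m (iter i sigma w)).

Hypothesis Nstar_int : forall m, (2 <= m)%N -> int (fun w => (Nstar m w)%:R).

Let P1 : P setT = 1%E. Proof. exact: probability_setT. Qed.

Let C2 : 0 <= C ^+ 2. Proof. exact: sqr_ge0. Qed.

Lemma measurable_threshold m L : (2 <= m)%N -> measurable_fun setT (fun w => (Nstar m w <= L)%N).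
Proof.
move=> m2; apply: (measurable_fun_bool true).
rewrite (_ : _ `&` _ = setT `&` (fun w => (Nstar m w)%:R : R) @^-1` `]-oo, L%:R]).
  by apply: (measurable_of_int (Nstar_int m2)).
by apply/seteqP; split => w /=; rewrite in_itv/= ler_nat.
Qed.

(** Functions on the base whose values along an orbit are the correlation tails and
    the weights of bad times, so that the ergodic theorem applies to them. *)
Definition tail (k : nat) (w : Omega) : R := correlation_tail C c (thr w) k 0.

Definition bad (p L : nat) (w : Omega) : R := bad_weight c (thr w) p L 0.

Lemma measurable_tail k : measurable_fun setT (tail k).
Proof.
rewrite /tail /correlation_tail.
apply: measurable_funM => //; apply: measurable_funD => //.
apply: measurable_fun_ifT => //; first exact: measurable_threshold.
exact: (measurable_of_int (Nstar_int (leqnn 2))).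
Qed.

Lemma measurable_bad p L : measurable_fun setT (bad p L).
Proof.
rewrite /bad /bad_weight; apply: measurable_fun_ifT => //.
  apply: (measurable_fun_bool true); rewrite setTI.
  rewrite (_ : _ @^-1` _ = \bigcap_(m in [set m | (2 <= m <= p)%N])
     [set w | (Nstar m w <= L)%N]).
    have [p2|p2] := ltnP p 2.
      rewrite (_ : \bigcap_(m in _) _ = setT)//.
      by apply/seteqP; split => // w _ m /= /andP[m2 mp]; lia.
    apply: bigcap_measurable; first by exists 2%N; apply/andP.
    move=> m /andP[m2 _]; have := @measurable_threshold m L m2 measurableT [set true] I.
    by rewrite setTI.
  apply/seteqP; split => w /=.
    by move=> h m /= mp; exact: (good_timeP h).
  move=> h; apply/forallP => m; apply/implyP => m2; apply: (h m).
  by rewrite /= m2 -ltnS ltn_ord.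
apply: measurable_funD => //; apply: measurable_funD => //.
exact: (measurable_of_int (Nstar_int (leqnn 2))).
Qed.

Lemma tail_ge0 k w : 0 <= tail k w.
Proof.
rewrite /tail /correlation_tail mulr_ge0// addr_ge0//; first by case: ifP.
by rewrite divr_ge0// mulr_ge0.
Qed.

Let majorant_tail w : R := C ^+ 2 * ((Nstar 2 w)%:R + 2 * c).

Let tail_le k w : `|tail k w| <= majorant_tail w.
Proof.
rewrite ger0_norm ?tail_ge0// ler_wpM2l// lerD//; first by case: ifP.
rewrite ler_piMr ?mulr_ge0//.
by case: k => [|k]; rewrite ?invr0// invf_le1 ?ler1n ?ltr0n.
Qed.

Let majorant_bad w : R := (1 + 2 * c) + (Nstar 2 w)%:R.

Let int_majorant_bad : int majorant_bad.
Proof. by apply: intD => //; [exact/bm_integrable/bm_cst|exact: Nstar_int]. Qed.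

Let int_majorant_tail : int majorant_tail.
Proof.
by apply: intZ; apply: intD; [exact: Nstar_int|exact/bm_integrable/bm_cst].
Qed.

Lemma int_tail k : int (tail k).
Proof.
apply: (ae_dominated_integrable (measurable_tail k) int_majorant_tail).
exact: aeW.
Qed.

Let bad_le p L w : `|bad p L w| <= majorant_bad w.
Proof.
rewrite /bad /bad_weight /majorant_bad; case: ifP => _.
  by rewrite normr0 !addr_ge0// mulr_ge0.
by rewrite ger0_norm ?addr_ge0 ?mulr_ge0// addrAC.
Qed.

Lemma int_bad p L : int (bad p L).
Proof.
apply: (ae_dominated_integrable (measurable_bad p L) int_majorant_bad).
exact: aeW.
Qed.

Lemma E_tail_cvg0 : E (tail k) @[k --> \oo] --> 0.
Proof.
apply: (E_dominated_cvg0 measurable_tail int_majorant_tail) => // w.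
rewrite -[X in _ --> X](mulr0 (C ^+ 2)) /tail /correlation_tail.
apply: cvgMl_tmp; rewrite -[X in _ --> X](addr0 0); apply: cvgD.
  apply: cvg_near_cst; near=> k; case: leqP => //; rewrite ltnNge => /negP[].
  by near: k; exact: nbhs_infty_ge.
rewrite -(mulr0 (2 * c)); apply: cvgMl_tmp.
by rewrite -cvg_shiftS; exact: cvg_harmonic.
Unshelve. all: by end_near. Qed.

(** Thresholds are finite, so that every point is good for large [L]; integrability
    of the threshold of order two gives the domination. *)
Lemma E_bad_cvg0 p : E (bad p L) @[L --> \oo] --> 0.
Proof.
apply: (E_dominated_cvg0 (measurable_bad p) int_majorant_bad) => // w.
apply: cvg_near_cst; exists (\max_(m < p.+1) Nstar m w)%N => // L /= hL.
rewrite /bad /bad_weight ifT//; apply/forallP => m; apply/implyP => _ /=.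
exact: leq_trans (leq_bigmax m) hL.
Qed.

Theorem bad_times_sparse : {ae P, forall w, forall (p : nat) (e : R), 0 < e -> exists L,
  \forall N \near \oo, N%:R^-1 * \sum_(0 <= i < N) bad_weight c (thr w) p L i <= e}.
Proof.
have : {ae P, forall w, forall p L,
    n%:R^-1 * orbit_sum sigma (bad p L) n w @[n --> \oo] --> E (bad p L)}.
  apply: ae_foralln => p; apply: ae_foralln => L.
  exact: birkhoff (int_bad p L).
apply: filterS => w hw p e e0.
have e20 : 0 < e / 2 by rewrite divr_gt0.
have /cvgrPdist_le/(_ _ e20)[L _ /(_ L (leqnn L))] := @E_bad_cvg0 p.
rewrite /= sub0r normrN => hL; exists L.
have /cvgrPdist_le/(_ _ e20) := hw p L; apply: filterS => N hN.
rewrite (_ : \sum_(0 <= i < N) _ = orbit_sum sigma (bad p L) N w)//.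
have := ler_norm (E (bad p L)).
by move: hN; rewrite ler_norml => /andP[]; lra.
Qed.

Variable corr : nat -> Omega -> R.
Hypothesis corr_meas : forall n, measurable_fun setT (corr n).
Hypothesis corr_bound : {ae P, forall w n, `|corr n w| <= C ^+ 2}.
Hypothesis corr_tail : {ae P, forall w k l, (0 < k)%N ->
  \sum_(k <= n < l) `|corr n w| <= tail k w}.

Let partial w N : R := \sum_(1 <= n < N) corr n w.

Definition green_kubo_density (w : Omega) : R := corr 0 w + 2 * limn (partial w).

Definition truncation (k : nat) (w : Omega) : R := corr 0 w + 2 * partial w k.

Lemma correlation_series_cvg : {ae P, forall w, cvgn (partial w)}.
Proof.
apply: filterS corr_tail => w hw.
pose u n := corr n.+1 w.
have e : partial w = fun N => series u N.-1.
  apply/funext => -[|N]; first by rewrite /partial /series/= !big_geq.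
  by rewrite /partial /series /= big_add1.
have cu : cvgn (series u).
  apply: normed_cvg; apply: nondecreasing_is_cvgn.
    by apply: nondecreasing_series => n _ _; exact: normr_ge0.
  exists (tail 1 w) => _ [N _ <-]; rewrite /series /=.
  by have := hw 1%N N.+1 isT; rewrite big_add1.
apply/cvg_ex; exists (limn (series u)); rewrite e -cvg_shiftS.
exact: cu.
Qed.

Lemma green_kubo_truncation : {ae P, forall w k, (0 < k)%N ->
  `|truncation k w - green_kubo_density w| <= 2 * tail k w}.
Proof.
apply: filterS2 corr_tail correlation_series_cvg => w hw cw k k0.
rewrite /truncation /green_kubo_density.
rewrite (_ : _ - _ = 2 * (partial w k - limn (partial w))); last by ring.
rewrite normrM ger0_norm// ler_wpM2l//.
have : `|partial w k - partial w N| @[N --> \oo] --> `|partial w k - limn (partial w)|.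
  by apply: cvg_norm; apply: cvgB; [exact: cvg_cst|exact: cw].
move=> h; rewrite -(cvg_lim _ h)//; apply: limr_le.
  by apply/cvg_ex; eexists; exact: h.
near=> N; have kN : (k <= N)%N by near: N; exact: nbhs_infty_ge.
rewrite /partial distrC (@big_cat_nat _ _ _ k 1 N)//= addrAC subrr add0r.
by rewrite (le_trans (ler_norm_sum _ _ _))// hw.
Unshelve. all: by end_near. Qed.

Lemma measurable_partial N : measurable_fun setT (fun w => partial w N).
Proof. by apply: measurable_sum => n; exact: corr_meas. Qed.

Lemma measurable_green_kubo : measurable_fun setT green_kubo_density.
Proof.
apply: measurable_funD => //; apply: measurable_funM => //.
by apply: measurable_limn => N; exact: measurable_partial.
Qed.

Lemma measurable_truncation k : measurable_fun setT (truncation k).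
Proof.
apply: measurable_funD => //; apply: measurable_funM => //; exact: measurable_partial.
Qed.

Lemma int_truncation k : int (truncation k).
Proof.
apply: (ae_dominated_integrable (G := fun=> C ^+ 2 + 2 * (k%:R * C ^+ 2))).
- exact: measurable_truncation.
- exact/bm_integrable/bm_cst.
apply: filterS corr_bound => w hw.
rewrite (le_trans (ler_normD _ _))// lerD// normrM ger0_norm// ler_wpM2l//.
rewrite (le_trans (ler_norm_sum _ _ _))//.
apply: (@le_trans _ _ (\sum_(1 <= n < k) C ^+ 2)); first exact: ler_sum.
by rewrite sumr_const_nat -[leLHS]mulr_natl ler_wpM2r// ler_nat leq_subr.
Qed.

Theorem int_green_kubo : int green_kubo_density.
Proof.
apply: (ae_dominated_integrable (G := fun w => C ^+ 2 + 2 * tail 1 w)).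
- exact: measurable_green_kubo.
- apply: intD => //; first exact/bm_integrable/bm_cst.
  by apply: intZ; exact: int_tail.
apply: filterS2 corr_bound green_kubo_truncation => w b /(_ 1%N isT).
rewrite /truncation {1}/partial big_geq// mulr0 addr0 => h.
rewrite -[green_kubo_density w](subrK (corr 0 w)) addrC.
by rewrite (le_trans (ler_normD _ _))// lerD// distrC.
Qed.

(** The averages of the truncations converge by the ergodic theorem; truncating
    costs twice an average of [tail k] before the limit and twice its mean in the
    limit, which vanishes as [k] grows. *)
Theorem averages_cvg_green_kubo (S : nat -> Omega -> R) :
  {ae P, forall w k N, (0 < k)%N ->
    `|S N w - \sum_(0 <= i < N) truncation k (iter i sigma w)| <=
      2 * (\sum_(0 <= i < N) tail k (iter i sigma w) + k%:R ^+ 2 * C ^+ 2)} ->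
  {ae P, forall w, N%:R^-1 * S N w @[N --> \oo] --> E green_kubo_density}.
Proof.
move=> hS.
have hT : {ae P, forall w k,
    n%:R^-1 * orbit_sum sigma (tail k) n w @[n --> \oo] --> E (tail k)}.
  by apply: ae_foralln => k; exact: birkhoff (int_tail k).
have hK : {ae P, forall w k,
    n%:R^-1 * orbit_sum sigma (truncation k) n w @[n --> \oo] --> E (truncation k)}.
  by apply: ae_foralln => k; exact: birkhoff (int_truncation k).
apply: filterS3 hS hT hK => w hS hT hK.
apply/cvgrPdist_le => e e0.
have e16 : 0 < e / 16 by rewrite divr_gt0.
have [k k0 hk] : exists2 k, (0 < k)%N & E (tail k) <= e / 16.
  have /cvgrPdist_le/(_ _ e16)[k _ hk] := E_tail_cvg0.
  exists k.+1 => //; have := hk k.+1 (leqnSn k); rewrite /= sub0r normrN.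
  exact/le_trans/ler_norm.
have hV : `|E (truncation k) - E green_kubo_density| <= 2 * (e / 16).
  rewrite -E_B//; try exact: int_truncation; try exact: int_green_kubo.
  apply: (@le_trans _ _ (E (fun w => 2 * tail k w))).
    apply: ae_E_norm_le.
    - exact: measurable_funB (measurable_truncation k) measurable_green_kubo.
    - by apply: intZ; exact: int_tail.
    by apply: filterS green_kubo_truncation => w' h; exact: h.
  by rewrite E_Z ?ler_wpM2l//; exact: int_tail.
have edge : \forall N \near \oo, N%:R^-1 * (k%:R ^+ 2 * C ^+ 2) <= e / 16.
  have : N%:R^-1 * (k%:R ^+ 2 * C ^+ 2) @[N --> \oo] --> (0 : R).
    rewrite -[X in _ --> X](mul0r (k%:R ^+ 2 * C ^+ 2)); apply: cvgMr_tmp.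
    by rewrite -cvg_shiftS; exact: cvg_harmonic.
  move=> /cvgrPdist_le/(_ _ e16); apply: filterS => N; rewrite sub0r normrN.
  exact/le_trans/ler_norm.
near=> N.
have h1 : `|E (tail k) - N%:R^-1 * orbit_sum sigma (tail k) N w| <= e / 16.
  by near: N; move/cvgrPdist_le : (hT k); exact.
have h2 : `|E (truncation k) - N%:R^-1 * orbit_sum sigma (truncation k) N w| <= e / 16.
  by near: N; move/cvgrPdist_le : (hK k); exact.
have h3 : N%:R^-1 * (k%:R ^+ 2 * C ^+ 2) <= e / 16 by near: N.
have Ni : 0 <= (N%:R : R)^-1 by rewrite invr_ge0.
have h4 := ler_wpM2l Ni (hS k N k0).
rewrite -[X in X * `|_|](ger0_norm Ni) -normrM mulrBr mulrCA mulrDr in h4.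
rewrite -!/(orbit_sum sigma _ N w) in h4.
have t1 := ler_norm (N%:R^-1 * orbit_sum sigma (tail k) N w - E (tail k)).
rewrite distrC in t1.
set a := N%:R^-1 * S N w in h4 *.
set b := N%:R^-1 * orbit_sum sigma (truncation k) N w in h2 h4.
rewrite (_ : _ - a = (E (truncation k) - b) - (E (truncation k) - E green_kubo_density) - (a - b)); last by ring.
rewrite (le_trans (ler_normB _ _))// (le_trans (lerD (ler_normB _ _) (lexx _)))//.
by lra.
Unshelve. all: by end_near. Qed.

End CorrelationAverages.

(** * Limit theorems over a regular orbit *)

Section RandomSystem.
Context {R : realType} {d d'} {Omega : measurableType d} {M : measurableType d'}.
Variable sigma : Omega -> Omega.
Hypothesis sigma_inv : invertible_measurable sigma.
Variable T : Omega -> M -> M.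
Hypothesis T_meas : measurable_fun setT (fun p : M * Omega => T p.2 p.1).
Variables (mu : R.-pker Omega ~> M) (B : functionBanachAlgebra R M).
Variable f : Omega -> B.
Hypothesis f_Bbar : centered_bounded_family mu f.

Local Notation ev := (fba_eval B).

Lemma fiber_mass w : mu w setT = 1%E.
Proof. exact: prob_kernel. Qed.

Lemma family_bound : exists C : R, [/\ 1 <= C, (forall w, `|f w| <= C) &
  forall w, {ae mu w, forall x, `|ev (f w) x| <= C}].
Proof.
have [_ _] := f_Bbar; set s := ereal_sup _ => s_fin.
have le_s w : (`|f w|%:E + 'N[mu w]_+oo[EFin \o ev (f w)] <= s)%E.
  by apply: ereal_sup_ubound; exists w.
have N0 w : (0 <= 'N[mu w]_+oo[EFin \o ev (f w)])%E by exact: Lnorm_ge0.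
have s_le (w : Omega) : (s <= (Num.max 1 (fine s))%:E)%E.
  have s0 : (0 <= s)%E by rewrite (le_trans _ (le_s w))// adde_ge0.
  by rewrite -[X in (X <= _)%E]fineK ?ge0_fin_numE// lee_fin le_max lexx orbT.
exists (Num.max 1 (fine s)); split; first by rewrite le_max lexx.
  move=> w; rewrite -lee_fin (le_trans _ (s_le w))// (le_trans _ (le_s w))//.
  by rewrite leeDl.
move=> w; have : ('N[mu w]_+oo[EFin \o ev (f w)] <= (Num.max 1 (fine s))%:E)%E.
  by rewrite (le_trans _ (s_le w))// (le_trans _ (le_s w))// leeDr.
rewrite unlock /Lnorm fiber_mass lte01 => /ess_supP.
by apply: filterS => x /=; rewrite lee_fin.
Qed.

Lemma iter_skew_product n (x : M) (w : Omega) :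
  iter n (skew_product sigma T) (x, w) = (cocycle sigma T n w x, iter n sigma w).
Proof. by elim: n => //= n ->. Qed.

(** The integrand is a product of values of one jointly measurable function at a
    point and at its image under an iterate of the skew product. *)
Lemma measurable_corr n : measurable_fun setT (corr sigma T mu f n).
Proof.
have [mf _ _] := f_Bbar.
pose F (p : M * Omega) := ev (f p.2) p.1.
rewrite (_ : corr _ _ _ _ _ = fun w => Rintegral (mu w) setT
    (fun x => F (x, w) * F (iter n (skew_product sigma T) (x, w)))); last first.
  apply/funext => w; apply: eq_Rintegral => x _.
  by rewrite iter_skew_product.
apply: (measurable_kernel_Rintegral mu (k := fun p => F p * F (iter n (skew_product sigma T) p))).
apply: measurable_funM => //; apply: (measurableT_comp mf).
elim: n => [|n IH]; first exact: measurable_id.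
exact: (measurableT_comp (measurable_skew_product sigma_inv T_meas) IH).
Qed.

End RandomSystem.

Section FiberLimit.
Context {R : realType} {d d'} {Omega : measurableType d} {M : measurableType d'}.
Variables (sigma : Omega -> Omega) (T : Omega -> M -> M).
Hypothesis T_meas : measurable_fun setT (fun p : M * Omega => T p.2 p.1).
Variables (mu : R.-pker Omega ~> M) (B : functionBanachAlgebra R M).
Variables (f : Omega -> B) (C K gamma theta c : R) (Nstar : nat -> Omega -> nat).
Hypotheses (C1 : 1 <= C) (K1 : 1 <= K) (gamma0 : 0 < gamma) (theta0 : 0 < theta).
Hypothesis f_norm : forall w, `|f w| <= C.
Hypothesis f_bound : forall w, {ae mu w, forall x, `|fba_eval B (f w) x| <= C}.
Hypothesis f_centered : forall w, (\int[mu w]_x fba_eval B (f w) x)%R = 0.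
Hypothesis c0 : 0 <= c.
Hypothesis cP : forall n : nat, (0 < n)%N ->
  expR (- gamma * n%:R `^ theta) <= c / n%:R ^+ 2.

Definition regular_orbit (w : Omega) : Prop := forall n,
  [/\ equivariant_at sigma T mu (iter n sigma w),
      composition_bounded_at T B K (iter n sigma w) &
      mixing_at sigma T mu B gamma theta Nstar (iter n sigma w)].

Variable w : Omega.
Hypothesis w_regular : regular_orbit w.

Let equi n : equivariant_at sigma T mu (iter n sigma w). Proof. by have [] := w_regular n. Qed.
Let comp n : composition_bounded_at T B K (iter n sigma w). Proof. by have [] := w_regular n. Qed.
Let mix n : mixing_at sigma T mu B gamma theta Nstar (iter n sigma w). Proof. by have [] := w_regular n. Qed.

Local Notation thr := (fun m i => Nstar m (iter i sigma w)).
Local Notation X := (fiber_process sigma T f w).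
Local Notation Y := (truncated_process sigma T f C w).

Let mY i : measurable_fun setT (Y i).
Proof. exact: measurable_truncated_process. Qed.

Let YC i x : `|Y i x| <= C.
Proof. exact: truncated_process_bound. Qed.

Let bmY i : bounded_measurable (Y i).
Proof. by split => //; exists C. Qed.

Let mix_blocks := fiber_block_mixing T_meas C1 f_norm f_bound K1 gamma0 theta0 equi comp mix.

Let centered i : mixed_moment (mu w) Y [:: i] = 0.
Proof. exact: fiber_centered. Qed.

Lemma corr_bound_at n : `|corr sigma T mu f n w| <= C ^+ 2.
Proof.
rewrite -[w in X in X <= _]/(iter 0 sigma w) -(@pair_moment_corr _ _ _ _ _ _ _ mu _ T_meas f C)//.
exact: (pair_moment_le (fiber_mass mu w)).
Qed.

Lemma corr_tail_at k l : (0 < k)%N ->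
  \sum_(k <= n < l) `|corr sigma T mu f n w| <= tail sigma C c Nstar k w.
Proof.
move=> k0.
under eq_bigr do rewrite -[w in corr _ _ _ _ _ w]/(iter 0 sigma w)
  -(@pair_moment_corr _ _ _ _ _ _ _ mu _ T_meas f C)//.
exact: (correlation_tailP (thr := thr) (fiber_mass mu w) C1 c0 cP mY YC mix_blocks centered).
Qed.

Let measurable_birkhoff_sum N : measurable_fun setT (birkhoff_sum sigma T f N w).
Proof.
rewrite (_ : birkhoff_sum _ _ _ _ _ = fun x => \sum_(i <- iota 0 N) X i x).
  by apply: measurable_sum => i; exact: measurable_fiber_process.
by apply/funext => x; rewrite birkhoff_sum_psum.
Qed.

Lemma Rintegral_birkhoff_sum (g : R -> R) N :
  measurable_fun setT g ->
  Rintegral (mu w) setT (fun x => g (birkhoff_sum sigma T f N w x)) =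
  Rintegral (mu w) setT (fun x => g (psum Y (iota 0 N) x)).
Proof.
move=> mg; apply/esym.
under [RHS]eq_Rintegral do rewrite birkhoff_sum_psum.
apply: (Rintegral_truncated T_meas f_bound equi (F := fun z => g (\sum_(i <- iota 0 N) z i))).
  by apply: (measurableT_comp mg); apply: measurable_sum => i; exact: measurable_fiber_process.
by apply: (measurableT_comp mg); apply: measurable_sum.
Qed.

Lemma second_moment_truncation k N : (0 < k)%N ->
  `|Rintegral (mu w) setT (fun x => birkhoff_sum sigma T f N w x ^+ 2) -
    \sum_(0 <= i < N) truncation (corr sigma T mu f) k (iter i sigma w)| <=
  2 * (\sum_(0 <= i < N) tail sigma C c Nstar k (iter i sigma w) + k%:R ^+ 2 * C ^+ 2).
Proof.
move=> k0; rewrite (Rintegral_birkhoff_sum (g := fun z => z ^+ 2)); last exact: measurable_funX.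
have := second_moment_approx (thr := thr) (fiber_mass mu w) C1 c0 cP mY YC mix_blocks centered N k0.
congr (`|_ - _| <= _); apply: eq_bigr => i _.
rewrite /truncated_correlations /truncation; congr (_ + 2 * _).
  rewrite -(@pair_moment_corr _ _ _ _ _ _ _ mu _ T_meas f C)//.
  by congr (mixed_moment _ _ [:: _; _]); exact/esym/addn0.
by apply: eq_bigr => n _; rewrite -(@pair_moment_corr _ _ _ _ _ _ _ mu _ T_meas f C).
Qed.

Lemma integral_birkhoff_sum_sqr N :
  (\int[mu w]_x ((birkhoff_sum sigma T f N w x) ^+ 2)%:E)%E =
  (Rintegral (mu w) setT (fun x => birkhoff_sum sigma T f N w x ^+ 2))%:E.
Proof.
have mS : measurable_fun setT (fun x => birkhoff_sum sigma T f N w x ^+ 2).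
  exact: measurable_funX.
have bZ : bounded_measurable (fun x => psum Y (iota 0 N) x ^+ 2) by apply: bmX; exact: bm_sum.
rewrite /Rintegral fineK//; apply: integrable_fin_num => //.
apply: (ae_dominated_integrable mS (bm_integrable (fiber_mass mu w) bZ)).
apply: filterS (truncated_process_ae T_meas f_bound equi) => x h.
rewrite ger0_norm ?sqr_ge0// birkhoff_sum_psum /psum.
by rewrite (eq_bigr _ (fun i _ => h i)).
Qed.

Lemma integrable_corr_fun n : (mu w).-integrable setT (EFin \o corr_fun sigma T f n w).
Proof.
apply: (ae_dominated_integrable (G := fun=> C ^+ 2)).
- apply: measurable_funM; first exact: fba_measurable.
  exact: (measurableT_comp (fba_measurable _) (measurable_cocycle _ T_meas n w)).
- exact/(bm_integrable (fiber_mass mu w))/bm_cst.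
apply: filterS (truncated_process_ae T_meas f_bound equi) => x h.
rewrite -[corr_fun _ _ _ _ _ _]/(X 0%N x * X n x) -!h normrM expr2.
exact: ler_pM.
Qed.

Lemma fiber_clt (V : R) :
  N%:R^-1 * Rintegral (mu w) setT (fun x => birkhoff_sum sigma T f N w x ^+ 2)
    @[N --> \oo] --> V ->
  (forall (p : nat) (e : R), 0 < e -> exists L,
    \forall N \near \oo, N%:R^-1 * \sum_(0 <= i < N) bad_weight c thr p L i <= e) ->
  cvg_in_distribution (mu w)
    (fun N x => birkhoff_sum sigma T f N w x / Num.sqrt N%:R)
    (centered_normal (Num.sqrt V)).
Proof.
move=> hV sparse; split.
  by move=> N; apply: measurable_funM.
move=> g cg bg.
under eq_fun => N.
  rewrite (Rintegral_birkhoff_sum (g := fun z => g (z / Num.sqrt N%:R))); last first.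
    by apply: measurable_comp_continuous => //; apply: measurable_funM.
  under eq_Rintegral do rewrite mulrC.
  over.
apply: (quenched_clt (thr := thr) (fiber_mass mu w) C1 K1 gamma0 theta0 c0 cP mY YC mix_blocks centered _ sparse cg bg).
move: hV; apply: cvg_trans; apply: near_eq_cvg; near=> N.
rewrite (Rintegral_birkhoff_sum (g := fun z => z ^+ 2)); last exact: measurable_funX.
rewrite -E_Z; last by apply: (bm_integrable (fiber_mass mu w)); apply: bmX; exact: bm_sum.
by apply: eq_Rintegral => x _; rewrite exprMn exprVn sqr_sqrtr.
Unshelve. all: by end_near. Qed.

End FiberLimit.

(** * The quenched central limit theorem *)

Unset Implicit Arguments.
Set Strict Implicit.
Set Printing Implicit Defensive.

Theorem theorem4 (R : realType)
  (dO : measure_display) (Omega : measurableType dO) (P : probability Omega R)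
  (sigma : Omega -> Omega)
  (sigma_inv : invertible_measurable sigma)
  (sigma_pres : preserves P sigma)
  (sigma_erg : ergodic P sigma)
  (kappa : R) (kappa_gt0 : 0 < kappa) (dim : nat)
  (M : ptopologicalType) (atlas : set (chart R dim M))
  (M_manifold : is_manifold kappa atlas)
  (T : Omega -> borel M -> borel M)
  (T_meas : measurable_fun setT (fun p : borel M * Omega => T p.2 p.1))
  (nu : probability (borel M * Omega)%type R)
  (nu_pres : preserves nu (skew_product sigma T))
  (nu_proj : forall A, measurable A -> nu (setT `*` A) = P A)
  (mu : R.-pker Omega ~> borel M)
  (nu_disint : disintegration P mu nu)
  (B : functionBanachAlgebra R (borel M))
  (Nstar : nat -> Omega -> nat)
  (mixing : quenched_mixing_all_orders P sigma T mu B Nstar)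
  (K : R) (K_gt0 : 0 < K)
  (comp_bounded : composition_bounded P T B K)
  (Nstar_L1 : forall m, (2 <= m)%N ->
     P.-integrable setT (fun w => ((Nstar m w)%:R : R)%:E))
  (f : Omega -> B)
  (f_Bbar : centered_bounded_family mu f) :
  exists sigma_f : R, [/\ 0 <= sigma_f,
    {ae P, forall w,
      cvg_in_distribution (mu w)
        (fun N x => birkhoff_sum sigma T f N w x / Num.sqrt N%:R)
        (centered_normal sigma_f)},
    {ae P, forall w,
      ((N%:R^-1)%:E * \int[mu w]_x ((birkhoff_sum sigma T f N w x) ^+ 2)%:E)%E
        @[N --> \oo] --> (sigma_f ^+ 2)%:E},
    green_kubo_well_defined P sigma T mu f &
    (sigma_f ^+ 2)%:E = (\int[P]_w (green_kubo sigma T mu f w)%:E)%E].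
Proof.
have [ms _] := sigma_inv.
have [_ sc _] := M_manifold.
have [U gU] := borel_countably_generated sc.
have [gamma [theta [gamma0 /andP[theta0 _] mix]]] := mixing.
have [c c0 cP] := stretched_exp_le_inv_sqr gamma0 theta0.
have [C [C1 f_norm f_bound]] := family_bound f_Bbar.
have [_ f_centered _] := f_Bbar.
pose K1 := Num.max K 1.
have K1_ge1 : 1 <= K1 by rewrite le_max lexx orbT.
pose regular := regular_orbit sigma T mu B K1 gamma theta Nstar.
have hreg : {ae P, forall w, regular w}.
  have h1 := ae_equivariance sigma_inv sigma_pres T_meas nu_pres nu_disint gU.
  have h2 : {ae P, forall w, composition_bounded_at T B K1 w}.
    apply: filterS comp_bounded => w hw h; have [g e n] := hw h.
    exists g => //; apply: le_trans n _.
    by apply: ler_wpM2r => //; rewrite le_max lexx.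
  have h3 : {ae P, forall w, mixing_at sigma T mu B gamma theta Nstar w}.
    apply: ae_foralln => m; have [m2|m2] := leqP 2 m; last by apply: aeW => w.
    by have [_] := mix m m2; apply: filterS => w hw _.
  apply: (ae_orbit ms sigma_pres (A := fun w => [/\ equivariant_at sigma T mu w,
    composition_bounded_at T B K1 w & mixing_at sigma T mu B gamma theta Nstar w])).
  by apply: filterS3 h1 h2 h3.
have mcorr := measurable_corr sigma_inv T_meas f_Bbar.
have bcorr : {ae P, forall w n, `|corr sigma T mu f n w| <= C ^+ 2}.
  by apply: filterS hreg => w hw n; exact: (corr_bound_at T_meas C1 f_bound hw).
have tcorr : {ae P, forall w k l, (0 < k)%N ->
    \sum_(k <= n < l) `|corr sigma T mu f n w| <= tail sigma C c Nstar k w}.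
  apply: filterS hreg => w hw k l k0.
  exact: (corr_tail_at T_meas C1 K1_ge1 gamma0 theta0 f_norm f_bound f_centered c0 cP hw).
have gk_int := int_green_kubo c0 Nstar_L1 mcorr bcorr tcorr.
pose V := Rintegral P setT (green_kubo sigma T mu f).
have var_cvg : {ae P, forall w, N%:R^-1 * Rintegral (mu w) setT
    (fun x => birkhoff_sum sigma T f N w x ^+ 2) @[N --> \oo] --> V}.
  apply: (averages_cvg_green_kubo ms sigma_pres sigma_erg c0 Nstar_L1 mcorr bcorr tcorr
    (S := fun N w => Rintegral (mu w) setT (fun x => birkhoff_sum sigma T f N w x ^+ 2))).
  apply: filterS hreg => w hw k N k0.
  exact: (second_moment_truncation T_meas C1 K1_ge1 gamma0 theta0 f_norm f_bound f_centered c0 cP hw).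
(* [V] is a limit of means of squares at almost every, hence at some, point. *)
have V0 : 0 <= V.
  have PT : (0 < P setT)%E by rewrite [P _]probability_setT.
  have aeP := ae_properfilter_algebraOfSetsType PT.
  have [w hw] := filter_ex var_cvg.
  rewrite -(cvg_lim _ hw)//; apply: limr_ge; first by apply/cvg_ex; exists V.
  apply: nearW => N; apply: mulr_ge0; first by rewrite invr_ge0.
  by apply: E_ge0 => x; exact: sqr_ge0.
have sparse := bad_times_sparse ms sigma_pres sigma_erg C1 c0 Nstar_L1.
exists (Num.sqrt V); rewrite sqr_sqrtr//; split; first exact: sqrtr_ge0.
- apply: filterS3 hreg var_cvg sparse => w hw hV hs.
  exact: (fiber_clt T_meas C1 K1_ge1 gamma0 theta0 f_norm f_bound f_centered c0 cP hw hV hs).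
- apply: filterS2 hreg var_cvg => w hw hV.
  under eq_fun do rewrite (integral_birkhoff_sum_sqr T_meas C1 f_bound hw) -EFinM.
  by apply: cvg_EFin; [exact: nearW|exact: hV].
- split=> //; last exact: (correlation_series_cvg tcorr).
  by apply: filterS hreg => w hw n; exact: (integrable_corr_fun T_meas C1 f_bound hw).
- by rewrite fineK// integrable_fin_num.
Qed.
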